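(* Let $a>1$, let $\Psi=\{\psi_1,\psi_2,\dots,\psi_L\}$ be a finite subset of $L^2(\mathbb{R}_+)$ with cardinality $L$, let $\mathcal{MD}(\Psi,a)$ be a frame for $L^2(\mathbb{R}_+)$, and let $S$ be its frame operator. Then: (i) the canonical dual $\mathcal{MD}(S^{-1}(\Psi),a)$ of $\mathcal{MD}(\Psi,a)$ is given by $$\Theta_a S^{-1}\psi_l(\cdot,\cdot)=\frac{\Theta_a\psi_l(\cdot,\cdot)}{\sum_{k=1}^{L}\left|\Theta_a\psi_k(\cdot,\cdot)\right|^2}\quad\text{a.e. on }[1,a)\times[0,1),\quad 1\le l\le L;$$ (ii) a dilation-and-modulation system $\mathcal{MD}(\Phi,a)$ with $\Phi=\{\varphi_1,\varphi_2,\dots,\varphi_L\}$ is a dual frame of $\mathcal{MD}(\Psi,a)$ if and only if $\Phi$ is defined, for $1\le l\le L$, by $$\Theta_a\varphi_l(\cdot,\cdot)=\frac{\Theta_a\psi_l(\cdot,\cdot)\left(1-\sum_{k=1}^{L}\overline{\Theta_a\psi_k(\cdot,\cdot)}\,X_k(\cdot,\cdot)\right)}{\sum_{k=1}^{L}\left|\Theta_a\psi_k(\cdot,\cdot)\right|^2}+X_l(\cdot,\cdot)\quad\text{a.e. on }[1,a)\times[0,1)$$ for some $X_1,\dots,X_L\in L^\infty([1,a)\times[0,1))$.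
   Context: $\mathbb{R}_+=(0,\infty)$, and $L^2(\mathbb{R}_+)$ is the space of complex-valued square-integrable functions on $\mathbb{R}_+$. A measurable function $h$ on $\mathbb{R}_+$ is $a$-dilation periodic if $h(ax)=h(x)$ for a.e. $x\in\mathbb{R}_+$. For $m\in\mathbb{Z}$, $\Lambda_m$ is the $a$-dilation periodic function on $\mathbb{R}_+$ determined by $\Lambda_m(x)=\frac{1}{\sqrt{a-1}}e^{\frac{2\pi i m x}{a-1}}$ for $x\in[1,a)$. For $c>0$, $D_c f(x)=\sqrt{c}\,f(cx)$. The dilation-and-modulation system is $\mathcal{MD}(\Psi,a)=\{\Lambda_m D_{a^j}\psi_l:\ m,j\in\mathbb{Z},\ 1\le l\le L\}$ (indexed by $(m,j,l)$), and for $\Phi=\{\varphi_1,\dots,\varphi_L\}\subset L^2(\mathbb{R}_+)$, $\mathcal{MD}(\Phi,a)$ is defined in the same way. The $\Theta_a$-transform of $f\in L^2(\mathbb{R}_+)$ is $\Theta_a f(x,\xi)=\sum_{l\in\mathbb{Z}}a^{l/2}f(a^l x)e^{-2\pi i l\xi}$ for a.e. $(x,\xi)\in\mathbb{R}_+\times\mathbb{R}$ (for a.e. $x$ the coefficient sequence is in $\ell^2(\mathbb{Z})$, so the series is a Fourier series converging in $L^2([0,1))$ in $\xi$). $\Theta_a$ is a unitary operator from $L^2(\mathbb{R}_+)$ onto $L^2([1,a)\times[0,1))$, so functions in $L^2(\mathbb{R}_+)$ can be defined by prescribing their $\Theta_a$-transforms on $[1,a)\times[0,1)$. $\mathcal{MD}(\Psi,a)$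 is a frame for $L^2(\mathbb{R}_+)$ if there are $0<C_1\le C_2<\infty$ with $C_1\|f\|^2\le\sum_{l=1}^{L}\sum_{m,j\in\mathbb{Z}}|\langle f,\Lambda_m D_{a^j}\psi_l\rangle|^2\le C_2\|f\|^2$ for all $f\in L^2(\mathbb{R}_+)$. Its frame operator is $Sf=\sum_{l=1}^{L}\sum_{m,j\in\mathbb{Z}}\langle f,\Lambda_m D_{a^j}\psi_l\rangle\Lambda_m D_{a^j}\psi_l$, which is bounded and invertible on $L^2(\mathbb{R}_+)$. The canonical dual is $S^{-1}(\mathcal{MD}(\Psi,a))$, which equals $\mathcal{MD}(S^{-1}(\Psi),a)$ with $S^{-1}(\Psi)=\{S^{-1}\psi_1,\dots,S^{-1}\psi_L\}$. $\mathcal{MD}(\Phi,a)$ is a dual (frame) of the frame $\mathcal{MD}(\Psi,a)$ if it is a frame for $L^2(\mathbb{R}_+)$ and $f=\sum_{l=1}^{L}\sum_{m,j\in\mathbb{Z}}\langle f,\Lambda_m D_{a^j}\varphi_l\rangle\Lambda_m D_{a^j}\psi_l$ for all $f\in L^2(\mathbb{R}_+)$. *)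

(* Defs.v *)
From HB Require Import structures.
From mathcomp Require Import all_boot all_order all_algebra.
From mathcomp Require Import finmap.
From mathcomp Require Import complex.
From mathcomp Require Import all_classical all_reals all_analysis.
From mathcomp Require summability.

Set Implicit Arguments.
Unset Strict Implicit.
Unset Printing Implicit Defensive.

Import Order.TTheory GRing.Theory Num.Theory.
Import numFieldNormedType.Exports.

Local Open Scope classical_set_scope.
Local Open Scope ring_scope.
Local Open Scope complex_scope.

Definition cmeasurable d (T : measurableType d) (R : realType)
    (D : set T) (f : T -> R[i]) : Prop :=
  measurable_fun D (fun x => complex.Re (f x)) /\
  measurable_fun D (fun x => complex.Im (f x)).

Definition cintegral d (T : measurableType d) (R : realType)
    (mu : {measure set T -> \bar R}) (D : set T) (f : T -> R[i]) : R[i] :=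
  Rintegral mu D (fun x => complex.Re (f x)) +i*
  Rintegral mu D (fun x => complex.Im (f x)).

(* The squared norm takes values in the extended reals, so that functions
   that are not square integrable have norm +oo rather than a junk value. *)
Definition L2normsq d (T : measurableType d) (R : realType)
    (mu : {measure set T -> \bar R}) (D : set T) (f : T -> R[i]) : \bar R :=
  (\int[mu]_(x in D) ((ComplexField.Normc.normc (f x)) ^+ 2)%:E)%E.

Definition memL2 d (T : measurableType d) (R : realType)
    (mu : {measure set T -> \bar R}) (D : set T) (f : T -> R[i]) : Prop :=
  cmeasurable D f /\ (L2normsq mu D f < +oo)%E.

Definition memLinfty d (T : measurableType d) (R : realType)
    (mu : {measure set T -> \bar R}) (D : set T) (f : T -> R[i]) : Prop :=
  cmeasurable D f /\
  exists M : R, {ae mu, forall x, D x -> ComplexField.Normc.normc (f x) <= M}.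

(* The series of the [u i] converges (unconditionally) to [f] in L^2(D): the
   net of the partial sums over finite sets of indices converges to [f]. *)
Definition L2sum_to d (T : measurableType d) (R : realType)
    (mu : {measure set T -> \bar R}) (D : set T) (I : choiceType)
    (u : I -> T -> R[i]) (f : T -> R[i]) : Prop :=
  L2normsq mu D (fun x => \sum_(i <- (A : {fset I})) u i x - f x)
    @[A --> @summability.totally I] --> 0%E.

Definition Rplus (R : realType) : set R := `]0, +oo[.
Arguments Rplus {R}.

Definition L2Rplus (R : realType) (f : R -> R[i]) : Prop :=
  memL2 lebesgue_measure Rplus f.

Definition inner (R : realType) (f g : R -> R[i]) : R[i] :=
  cintegral lebesgue_measure Rplus (fun x => f x * (g x)^*).

Definition cis (R : realType) (t : R) : R[i] := cos t +i* sin t.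

(* For [x > 0], the unique point of the orbit [{a^k x | k in Z}] lying in
   the fundamental domain [[1, a)]. *)
Definition dilation_rep (R : realType) (a x : R) : R :=
  a ^ (- Num.floor (ln x / ln a)) * x.

Definition Lambda (R : realType) (a : R) (m : int) (x : R) : R[i] :=
  ((Num.sqrt (a - 1))^-1)%:C *
  cis (2 * pi * m%:~R * dilation_rep a x / (a - 1)).

Lemma Lambda_fundamental (R : realType) (a : R) (m : int) (x : R) :
  1 < a -> 1 <= x < a ->
  Lambda a m x = ((Num.sqrt (a - 1))^-1)%:C *
                 cis (2 * pi * m%:~R * x / (a - 1)).
Proof.
move=> a1 /andP[x1 xa]; rewrite /Lambda /dilation_rep.
suff -> : Num.floor (ln x / ln a) = 0 by rewrite oppr0 expr0z mul1r.
have la : 0 < ln a by rewrite ln_gt0.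
apply: Num.Theory.floor_def.
have x0 : 0 < x by apply: lt_le_trans x1.
rewrite /= add0r ltr_pdivrMr// mul1r ltr_ln ?posrE//; last exact: lt_trans a1.
by rewrite xa andbT divr_ge0 ?ln_ge0// ltW.
Qed.

Lemma Lambda_periodic (R : realType) (a : R) (m : int) (x : R) :
  1 < a -> 0 < x -> Lambda a m (a * x) = Lambda a m x.
Proof.
move=> a1 x0; rewrite /Lambda /dilation_rep.
have a0 : 0 < a by rewrite (lt_trans _ a1).
have la : ln a != 0 by rewrite gt_eqF// ln_gt0.
have -> : ln (a * x) / ln a = 1 + ln x / ln a.
  by rewrite lnM ?posrE// mulrDl divff.
have -> : Num.floor (1 + ln x / ln a) = 1 + Num.floor (ln x / ln a).
  apply: Num.Theory.floor_def; rewrite -addrA !(intrD _ 1) !lerD2l !ltrD2l.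
  by rewrite Num.Theory.floor_le floorD1_gt.
by rewrite opprD expfzDr ?gt_eqF// exprN1 (mulrC a^-1) -[_ * _ * (a * x)]mulrA mulKf ?gt_eqF.
Qed.

Definition dilate (R : realType) (c : R) (f : R -> R[i]) (x : R) : R[i] :=
  (Num.sqrt c)%:C * f (c * x).

Definition MD (R : realType) (L : nat) (a : R) (psi : 'I_L -> R -> R[i])
    (i : 'I_L * (int * int)) (x : R) : R[i] :=
  let: (l, (m, j)) := i in Lambda a m x * dilate (a ^ j) (psi l) x.

Definition is_MD_frame (R : realType) (L : nat) (a : R)
    (psi : 'I_L -> R -> R[i]) : Prop :=
  exists C1 C2 : R, [/\ 0 < C1, C1 <= C2 &
    forall f : R -> R[i], L2Rplus f ->
      let s := (\sum_(l < L) \esum_(mj in [set: int * int])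
        ((ComplexField.Normc.normc (inner f (MD a psi (l, mj)))) ^+ 2)%:E)%E in
      (C1%:E * L2normsq lebesgue_measure Rplus f <= s)%E /\
      (s <= C2%:E * L2normsq lebesgue_measure Rplus f)%E].

Definition is_MD_dual (R : realType) (L : nat) (a : R)
    (psi phi : 'I_L -> R -> R[i]) : Prop :=
  is_MD_frame a phi /\
  forall f : R -> R[i], L2Rplus f ->
    L2sum_to lebesgue_measure Rplus
      (fun i x => inner f (MD a phi i) * MD a psi i x) f.

(* Elements of L^2(R_+) are represented by functions, hence the frame operator
   and its inverse are determined up to almost everywhere equality; [xget]
   selects a representative. *)
Definition frame_op (R : realType) (L : nat) (a : R)
    (psi : 'I_L -> R -> R[i]) (f : R -> R[i]) : R -> R[i] :=
  xget (fun=> 0) [set g | L2Rplus g /\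
    L2sum_to lebesgue_measure Rplus
      (fun i x => inner f (MD a psi i) * MD a psi i x) g].

Definition frame_op_inv (R : realType) (L : nat) (a : R)
    (psi : 'I_L -> R -> R[i]) (g : R -> R[i]) : R -> R[i] :=
  xget (fun=> 0) [set f | L2Rplus f /\
    frame_op a psi f = g %[ae lebesgue_measure in Rplus]].

(* [F] is a (jointly measurable) version of the Theta_a-transform of [f] on
   R_+ x R: for almost every [x], its slice at [x] is the sum in L^2 of the
   Fourier series in [xi], on each period interval [[n, n+1)]. *)
Definition is_Theta (R : realType) (a : R) (f : R -> R[i])
    (F : R * R -> R[i]) : Prop :=
  cmeasurable (Rplus `*` setT) F /\
  {ae lebesgue_measure, forall x : R, Rplus x -> forall n : int,
    L2sum_to lebesgue_measure `[n%:~R, (n + 1)%:~R[%classic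
      (fun (l : int) (xi : R) =>
        (a `^ (l%:~R / 2))%:C * f (a ^ l * x) * cis (- (2 * pi * l%:~R * xi)))
      (fun xi => F (x, xi))}.

(* The versions of the transform of [f] agree almost everywhere. *)
Definition Theta (R : realType) (a : R) (f : R -> R[i]) : R * R -> R[i] :=
  xget (fun=> 0) [set F | is_Theta a f F].

Definition lebesgue_measure2 (R : realType) :
    {measure set (measurableTypeR R * measurableTypeR R) -> \bar R} :=
  (@lebesgue_measure R \x @lebesgue_measure R)%E.
Arguments lebesgue_measure2 {R}.

Definition Theta_dom (R : realType) (a : R) : set (R * R) :=
  `[1, a[ `*` `[0, 1[.

(* Main.v *)
Require Import Defs.
From mathcomp Require Import all_boot all_order all_algebra.
From mathcomp Require Import finmap complex ring lra.
From mathcomp Require Import all_classical all_reals all_analysis.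
From mathcomp Require Import measurable_realfun.
From mathcomp Require summability.

(** The transform turns dilation-and-modulation systems into systems of
exponentials. Put dom = [1,a) x [0,1). The exponentials

  e_(m,j)(x,xi) = (a-1)^(-1/2) exp(2 pi i m x / (a-1)) exp(2 pi i j xi)

form an orthonormal basis of L^2(dom) ([MD_symbol_orthonormal],
[MD_symbol_parseval]), and the transform of Lambda_m D_(a^j) psi is
e_(m,j) Theta psi ([Theta_slices_MD]): modulations are constant on dilation
orbits, and a dilation by a^j shifts the Fourier coefficients in xi by j. Since
the transform is unitary ([Theta_isometry], [Theta_inner],
[Theta_slices_surjective]), the inner product of f with Lambda_m D_(a^j) psi is
the coefficient of conj(Theta psi) Theta f on e_(m,j). Hence

  sum_(l,m,j) |<f, Lambda_m D_(a^j) psi_l>|^2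
    = int_dom (sum_l |Theta psi_l|^2) |Theta f|^2     ([MD_energy_power]),

and when the transforms are bounded, the sum over (l,m,j) of
<f, Lambda_m D_(a^j) phi_l> Lambda_m D_(a^j) psi_l has the transform
(sum_l Theta psi_l conj(Theta phi_l)) Theta f ([L2sum_to_mixedP]).

By the first identity, a system is a frame if and only if sum_l |Theta psi_l|^2
lies between two positive constants almost everywhere on dom
([power_bounds_of_frame], [frame_of_power_bounds]). By the second one with
phi = psi, the frame operator is multiplication by sum_l |Theta psi_l|^2, so
its inverse is a division: this is the formula for the canonical dual. By the
second one again, phi generates a dual frame exactly when its transforms are
bounded and sum_l conj(Theta psi_l) Theta phi_l = 1 almost everywhere
([is_MD_dualP]); the lower frame bound for phi then follows from an
inequality of Cauchy-Schwarz type ([normc2_sum_mul_le]). Every right-hand side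
of the formula for duals satisfies this condition, and a dual phi is obtained with X_l = Theta phi_l, for which the
parenthesis in the formula vanishes.

The analytic input is Parseval for the trigonometric system
([fourier_parseval]) together with the unitarity of the transform. The transform
of f is a jointly measurable function whose slice at almost every x > 0 is the
sum of a Fourier series; on dom it is handled through the Fourier coefficients
of its slices ([Theta_slices]), which makes linearity, the isometry and the
action of modulations and dilations direct consequences of Parseval on each
slice. *)

Set Implicit Arguments.
Unset Strict Implicit.
Unset Printing Implicit Defensive.

Import Order.TTheory GRing.Theory Num.Theory.
Import numFieldNormedType.Exports.

Local Open Scope classical_set_scope.
Local Open Scope ring_scope.
Local Open Scope complex_scope.

Local Notation Re := complex.Re.
Local Notation Im := complex.Im.
Local Notation normc := ComplexField.Normc.normc.

Local Notation "x ^*" := (Num.conj x) : complex_scope.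

(** * Complex numbers and measurable complex functions *)

Section complex_arith.
Context {R : realType}.
Implicit Types x y z : R[i].

Lemma normc2E z : normc z ^+ 2 = Re z ^+ 2 + Im z ^+ 2.
Proof. by case: z => u v; rewrite /= sqr_sqrtr// addr_ge0 ?sqr_ge0. Qed.

Lemma normc_ge0 z : 0 <= normc z.
Proof. by case: z => u v; exact: sqrtr_ge0. Qed.

Lemma complexP z w : Re z = Re w -> Im z = Im w -> z = w.
Proof. by case: z w => ? ? [? ?] /= -> ->. Qed.

Lemma mulcJ z : z * z^* = (normc z ^+ 2)%:C.
Proof.
by rewrite normc2E; case: z => u v; apply: complexP => /=; ring.
Qed.

Lemma normCE z : `|z| = (normc z)%:C.
Proof. by case: z. Qed.

Lemma normc_real (r : R) : 0 <= r -> normc r%:C = r.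
Proof. by move=> r0; rewrite /= expr0n addr0 sqrtr_sqr ger0_norm. Qed.

Lemma normcM2 z w : normc (z * w) ^+ 2 = normc z ^+ 2 * normc w ^+ 2.
Proof. by rewrite ComplexField.Normc.normcM exprMn. Qed.

Lemma normcD2_le z w : normc (z + w) ^+ 2 <= 2 * normc z ^+ 2 + 2 * normc w ^+ 2.
Proof.
rewrite !normc2E; case: z w => a b [c d] /=.
by have := sqr_ge0 (a - c); have := sqr_ge0 (b - d); nra.
Qed.

Lemma normc_conj z : normc z^* = normc z.
Proof. by case: z => a b /=; rewrite sqrrN. Qed.

Lemma normc2N z : normc (- z) ^+ 2 = normc z ^+ 2.
Proof. by rewrite !normc2E; case: z => a b /=; rewrite !sqrrN. Qed.

Lemma normc2_eq0 z : normc z ^+ 2 = 0 -> z = 0.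
Proof.
by move/eqP; rewrite sqrf_eq0 => /eqP /ComplexField.Normc.eq0_normc.
Qed.

Lemma cReM_le z w : `|Re (z * w^*)| <= normc z ^+ 2 + normc w ^+ 2.
Proof.
rewrite !normc2E; case: z w => a b [c d] /=; rewrite ler_norml.
have := sqr_ge0 (a - c); have := sqr_ge0 (b - d).
by have := sqr_ge0 (a + c); have := sqr_ge0 (b + d); move=> *; apply/andP; split; nra.
Qed.

Lemma cImM_le z w : `|Im (z * w^*)| <= normc z ^+ 2 + normc w ^+ 2.
Proof.
rewrite !normc2E; case: z w => a b [c d] /=; rewrite ler_norml.
have := sqr_ge0 (a - d); have := sqr_ge0 (b - c).
by have := sqr_ge0 (a + d); have := sqr_ge0 (b + c); move=> *; apply/andP; split; nra.
Qed.

Lemma cReD z w : Re (z + w) = Re z + Re w. Proof. by case: z w => ? ? []. Qed.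
Lemma cImD z w : Im (z + w) = Im z + Im w. Proof. by case: z w => ? ? []. Qed.
Lemma cReN z : Re (- z) = - Re z. Proof. by case: z. Qed.
Lemma cImN z : Im (- z) = - Im z. Proof. by case: z. Qed.
Lemma cReM z w : Re (z * w) = Re z * Re w - Im z * Im w.
Proof. by case: z w => ? ? []. Qed.
Lemma cImM z w : Im (z * w) = Re z * Im w + Im z * Re w.
Proof. by case: z w => ? ? []. Qed.
Lemma cReJ z : Re z^* = Re z. Proof. by case: z. Qed.
Lemma cImJ z : Im z^* = - Im z. Proof. by case: z. Qed.

Lemma conjcM z w : (z * w)^* = z^* * w^*.
Proof. exact: rmorphM. Qed.
Lemma conjcD z w : (z + w)^* = z^* + w^*.
Proof. exact: rmorphD. Qed.
Lemma conjcN z : (- z)^* = - z^*.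
Proof. exact: rmorphN. Qed.
Lemma conjc_sum I (r : seq I) (P : pred I) (F : I -> R[i]) :
  (\sum_(i <- r | P i) F i)^* = \sum_(i <- r | P i) (F i)^*.
Proof. exact: rmorph_sum. Qed.

(** A crude substitute for Cauchy-Schwarz with an easy induction: only the
finiteness of the constant matters, since it is used for a fixed number of
terms. *)
Lemma normc_sum2_le I (r : seq I) (F : I -> R[i]) :
  normc (\sum_(i <- r) F i) ^+ 2 <= 2 ^+ size r * \sum_(i <- r) normc (F i) ^+ 2.
Proof.
elim: r => [|i r IH]; first by rewrite !big_nil mulr0 ComplexField.Normc.normc0 expr0n.
rewrite !big_cons (le_trans (normcD2_le _ _))// mulrDr [size _]/= (exprS 2) lerD//.
  by rewrite -[leRHS]mulrA ler_wpM2l// ler_peMl ?sqr_ge0// exprn_ege1// ler1n.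
by rewrite -mulrA ler_wpM2l.
Qed.

End complex_arith.

Section cmeasurable.
Context d (T : measurableType d) (R : realType) (D : set T).
Hypothesis mD : measurable D.
Implicit Types f g : T -> R[i].

Lemma cmeasurable_cst (c : R[i]) : cmeasurable D (fun _ => c).
Proof. by split; exact: measurable_cst. Qed.

Lemma cmeasurableD f g : cmeasurable D f -> cmeasurable D g ->
  cmeasurable D (fun x => f x + g x).
Proof.
move=> [f1 f2] [g1 g2]; split.
  by under eq_fun do rewrite cReD; exact: measurable_funD.
by under eq_fun do rewrite cImD; exact: measurable_funD.
Qed.

Lemma cmeasurableN f : cmeasurable D f -> cmeasurable D (fun x => - f x).
Proof.
move=> [f1 f2]; split.
  by under eq_fun do rewrite cReN; exact: measurableT_comp.
by under eq_fun do rewrite cImN; exact: measurableT_comp.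
Qed.

Lemma cmeasurableB f g : cmeasurable D f -> cmeasurable D g ->
  cmeasurable D (fun x => f x - g x).
Proof. by move=> mf mg; apply: cmeasurableD => //; exact: cmeasurableN. Qed.

Lemma cmeasurableM f g : cmeasurable D f -> cmeasurable D g ->
  cmeasurable D (fun x => f x * g x).
Proof.
move=> [f1 f2] [g1 g2]; split.
  by under eq_fun do rewrite cReM; apply: measurable_funB; exact: measurable_funM.
by under eq_fun do rewrite cImM; apply: measurable_funD; exact: measurable_funM.
Qed.

Lemma cmeasurableJ f : cmeasurable D f -> cmeasurable D (fun x => (f x)^*).
Proof.
move=> [f1 f2]; split; first by under eq_fun do rewrite cReJ.
by under eq_fun do rewrite cImJ; exact: measurableT_comp.
Qed.

Lemma cmeasurable_real (f : T -> R) : measurable_fun D f ->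
  cmeasurable D (fun x => (f x)%:C).
Proof. by move=> mf; split => //=; exact: measurable_cst. Qed.

Lemma cmeasurable_sum I (r : seq I) (F : I -> T -> R[i]) :
  (forall i, cmeasurable D (F i)) -> cmeasurable D (fun x => \sum_(i <- r) F i x).
Proof.
move=> mF; elim: r => [|i r IH].
  by under eq_fun do rewrite big_nil; exact: cmeasurable_cst.
by under eq_fun do rewrite big_cons; exact: cmeasurableD.
Qed.

Lemma measurable_normc2 f : cmeasurable D f ->
  measurable_fun D (fun x => normc (f x) ^+ 2).
Proof.
move=> [f1 f2]; under eq_fun do rewrite normc2E.
by apply: measurable_funD; exact: measurable_funX.
Qed.

Lemma eq_cmeasurable f g : {in D, f =1 g} -> cmeasurable D f -> cmeasurable D g.
Proof.
move=> fg [f1 f2]; split.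
  by apply: eq_measurable_fun f1 => x xD; rewrite fg.
by apply: eq_measurable_fun f2 => x xD; rewrite fg.
Qed.

End cmeasurable.

Lemma cmeasurableS d (T : measurableType d) (R : realType) (E D : set T)
  (f : T -> R[i]) :
  measurable E -> D `<=` E -> cmeasurable E f -> cmeasurable D f.
Proof.
move=> mE DE [f1 f2].
by split; [exact: (measurable_funS mE DE f1)|exact: (measurable_funS mE DE f2)].
Qed.

(** * Square-integrable complex functions *)

Definition cintegrable d (T : measurableType d) (R : realType)
    (mu : {measure set T -> \bar R}) (D : set T) (f : T -> R[i]) : Prop :=
  mu.-integrable D (EFin \o (fun x => Re (f x))) /\
  mu.-integrable D (EFin \o (fun x => Im (f x))).

Definition cinner d (T : measurableType d) (R : realType)
    (mu : {measure set T -> \bar R}) (D : set T) (f g : T -> R[i]) : R[i] :=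
  cintegral mu D (fun x => f x * (g x)^*).

Section cintegral.
Context d (T : measurableType d) (R : realType).
Context (mu : {measure set T -> \bar R}) (D : set T) (mD : measurable D).
Implicit Types f g : T -> R[i].

Lemma eq_cintegral f g : {in D, f =1 g} -> cintegral mu D f = cintegral mu D g.
Proof.
by move=> fg; rewrite /cintegral; congr (_ +i* _); apply: eq_Rintegral => x xD;
  rewrite fg.
Qed.

Lemma ae_eq_cintegral f g : cmeasurable D f -> cmeasurable D g ->
  ae_eq mu D f g -> cintegral mu D f = cintegral mu D g.
Proof.
move=> [f1 f2] [g1 g2] fg; rewrite /cintegral /Rintegral.
congr (fine _ +i* fine _); apply: ae_eq_integral => //.
- exact/measurable_EFinP.
- exact/measurable_EFinP.
- by apply: filterS fg => x + Dx => /(_ Dx) ->.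
- exact/measurable_EFinP.
- exact/measurable_EFinP.
- by apply: filterS fg => x + Dx => /(_ Dx) ->.
Qed.

Lemma cintegrableD f g : cintegrable mu D f -> cintegrable mu D g ->
  cintegrable mu D (fun x => f x + g x).
Proof.
move=> [f1 f2] [g1 g2]; split.
  apply: eq_integrable (integrableD mD f1 g1) => // x _.
  by rewrite /= cReD.
apply: eq_integrable (integrableD mD f2 g2) => // x _.
by rewrite /= cImD.
Qed.

Lemma cintegralD f g : cintegrable mu D f -> cintegrable mu D g ->
  cintegral mu D (fun x => f x + g x) = cintegral mu D f + cintegral mu D g.
Proof.
move=> [f1 f2] [g1 g2]; rewrite /cintegral; apply: complexP => /=.
  by rewrite -RintegralD//; apply: eq_Rintegral => x _; rewrite cReD.
by rewrite -RintegralD//; apply: eq_Rintegral => x _; rewrite cImD.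
Qed.

Let integrableZ (c : R) (h : T -> R) : mu.-integrable D (EFin \o h) ->
  mu.-integrable D (EFin \o (fun x => c * h x)).
Proof. by move=> /(integrableZl mD c); apply: eq_integrable. Qed.

Lemma cintegrableZ c f : cintegrable mu D f ->
  cintegrable mu D (fun x => c * f x).
Proof.
move=> [f1 f2]; split.
  apply: eq_integrable (integrableB mD (integrableZ (Re c) f1) (integrableZ (Im c) f2)) => // x _.
  by rewrite /= cReM EFinB.
apply: eq_integrable (integrableD mD (integrableZ (Re c) f2) (integrableZ (Im c) f1)) => // x _.
by rewrite /= cImM.
Qed.

Lemma cintegralZ c f : cintegrable mu D f ->
  cintegral mu D (fun x => c * f x) = c * cintegral mu D f.
Proof.
move=> [f1 f2]; rewrite /cintegral; apply: complexP.
  rewrite cReM/= -!RintegralZl// -RintegralB//; try exact: integrableZ.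
  by apply: eq_Rintegral => x _; rewrite cReM.
rewrite cImM/= -!RintegralZl// -RintegralD//; try exact: integrableZ.
by apply: eq_Rintegral => x _; rewrite cImM.
Qed.

Lemma cintegralJ f : cintegrable mu D f ->
  cintegral mu D (fun x => (f x)^*) = (cintegral mu D f)^*.
Proof.
move=> [f1 f2]; rewrite /cintegral; apply: complexP => /=.
  by apply: eq_Rintegral => x _; rewrite cReJ.
rewrite -mulN1r -RintegralZl//.
by apply: eq_Rintegral => x _; rewrite cImJ mulN1r.
Qed.

Lemma cintegrable0 : cintegrable mu D (fun=> 0).
Proof. by split; exact: integrable0. Qed.

Lemma eq_cintegrable f g : {in D, f =1 g} -> cintegrable mu D f -> cintegrable mu D g.
Proof.
by move=> fg [f1 f2]; split; [apply: eq_integrable f1|apply: eq_integrable f2] => //= x xD;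
  rewrite fg.
Qed.

Lemma cintegral0 : cintegral mu D (fun=> 0) = 0.
Proof. by rewrite /cintegral /= !Rintegral_cst// !mul0r. Qed.

Lemma cintegrable_sum I (r : seq I) (F : I -> T -> R[i]) :
  (forall i, cintegrable mu D (F i)) ->
  cintegrable mu D (fun x => \sum_(i <- r) F i x).
Proof.
move=> iF; elim: r => [|i r IH].
  by under eq_fun do rewrite big_nil; exact: cintegrable0.
by under eq_fun do rewrite big_cons; exact: cintegrableD.
Qed.

Lemma cintegral_sum I (r : seq I) (F : I -> T -> R[i]) :
  (forall i, cintegrable mu D (F i)) ->
  cintegral mu D (fun x => \sum_(i <- r) F i x) =
  \sum_(i <- r) cintegral mu D (F i).
Proof.
move=> iF; elim: r => [|i r IH].
  by under eq_fun do rewrite big_nil; rewrite cintegral0 big_nil.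
under eq_fun do rewrite big_cons.
by rewrite cintegralD// ?IH ?big_cons//; exact: cintegrable_sum.
Qed.

End cintegral.

Section L2.
Context d (T : measurableType d) (R : realType).
Context (mu : {measure set T -> \bar R}) (D : set T) (mD : measurable D).
Implicit Types f g h : T -> R[i].

Local Notation "'N" := (L2normsq mu D).
Local Notation "'<| f , g |>" := (cinner mu D f g) (at level 0).

Lemma emeasurable_normc2 f : cmeasurable D f ->
  measurable_fun D (fun x => (normc (f x) ^+ 2)%:E).
Proof. by move=> mf; exact/measurable_EFinP/measurable_normc2. Qed.

Lemma L2normsq_ge0 f : (0 <= 'N f)%E.
Proof. by apply: integral_ge0 => x _; rewrite lee_fin sqr_ge0. Qed.

Lemma eq_L2normsq f g : {in D, f =1 g} -> 'N f = 'N g.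
Proof. by move=> fg; apply: eq_integral => x xD; rewrite fg. Qed.

Lemma ae_eq_L2normsq f g : cmeasurable D f -> cmeasurable D g ->
  ae_eq mu D f g -> 'N f = 'N g.
Proof.
move=> mf mg fg; apply: ae_eq_integral => //; try exact: emeasurable_normc2.
by apply: filterS fg => x + Dx => /(_ Dx) ->.
Qed.

Lemma L2normsqN f : 'N (fun x => - f x) = 'N f.
Proof. by apply: eq_integral => x _; rewrite normc2N. Qed.

Lemma L2normsqZ c f : cmeasurable D f ->
  'N (fun x => c * f x) = ((normc c ^+ 2)%:E * 'N f)%E.
Proof.
move=> mf; rewrite /L2normsq -ge0_integralZl//.
- by apply: eq_integral => x _; rewrite normcM2 EFinM.
- exact: emeasurable_normc2.
- by move=> x _; rewrite lee_fin sqr_ge0.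
- by rewrite lee_fin sqr_ge0.
Qed.

Lemma L2normsqD_le f g : cmeasurable D f -> cmeasurable D g ->
  ('N (fun x => f x + g x)%R <= 2%:E * 'N f + 2%:E * 'N g)%E.
Proof.
move=> mf mg; rewrite /L2normsq.
have mf' := emeasurable_normc2 mf; have mg' := emeasurable_normc2 mg.
rewrite -!ge0_integralZl//; try by move=> x _; rewrite lee_fin sqr_ge0.
rewrite -ge0_integralD//; first last.
- by move/measurable_EFinP : mg' => ?; exact/measurable_EFinP/measurable_funM.
- by move=> x _; rewrite -EFinM lee_fin mulr_ge0 ?sqr_ge0.
- by move/measurable_EFinP : mf' => ?; exact/measurable_EFinP/measurable_funM.
- by move=> x _; rewrite -EFinM lee_fin mulr_ge0 ?sqr_ge0.
apply: ge0_le_integral => //.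
- by move=> x _; rewrite lee_fin sqr_ge0.
- exact/emeasurable_normc2/cmeasurableD.
- by apply: emeasurable_funD; apply: emeasurable_funM.
- by move=> x _; rewrite -!EFinM -EFinD lee_fin normcD2_le.
Qed.

Lemma L2normsq_le_mul (M : R) f g : cmeasurable D f -> cmeasurable D g ->
  0 <= M -> {ae mu, forall x, D x -> normc (g x) ^+ 2 <= M * normc (f x) ^+ 2} ->
  ('N g <= M%:E * 'N f)%E.
Proof.
move=> mf mg M0 fg; rewrite /L2normsq -ge0_integralZl//; first last.
- by move=> x _; rewrite lee_fin sqr_ge0.
- exact: emeasurable_normc2.
apply: ae_ge0_le_integral => //.
- by move=> x _; rewrite lee_fin sqr_ge0.
- exact: emeasurable_normc2.
- by move=> x _; rewrite -EFinM lee_fin mulr_ge0 ?sqr_ge0.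
- by apply: emeasurable_funM => //; exact: emeasurable_normc2.
Qed.

Lemma L2normsq0 f : cmeasurable D f -> 'N f = 0%E -> ae_eq mu D f (fun=> 0).
Proof.
move=> mf Nf0.
have mN := emeasurable_normc2 mf.
have [+ _] := ae_eq_integral_abs mu mD mN.
have -> : (\int[mu]_(x in D) `|(normc (f x) ^+ 2)%:E|)%E = 'N f.
  by apply: eq_integral => x _; rewrite gee0_abs// lee_fin sqr_ge0.
move=> /(_ Nf0); apply: filterS => x + Dx => /(_ Dx) /= [].
exact: normc2_eq0.
Qed.

Lemma L2normsqB0 f g : cmeasurable D f -> cmeasurable D g ->
  'N (fun x => f x - g x) = 0%E -> ae_eq mu D f g.
Proof.
move=> mf mg /L2normsq0 => /(_ (cmeasurableB mf mg)).
by apply: filterS => x + Dx => /(_ Dx)/eqP; rewrite subr_eq0 => /eqP.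
Qed.

Lemma memL2D f g : memL2 mu D f -> memL2 mu D g -> memL2 mu D (fun x => f x + g x).
Proof.
move=> [mf f2] [mg g2]; split; first exact: cmeasurableD.
apply: le_lt_trans (L2normsqD_le mf mg) _.
by rewrite lte_add_pinfty// lte_mul_pinfty// ?L2normsq_ge0.
Qed.

Lemma memL2Z c f : memL2 mu D f -> memL2 mu D (fun x => c * f x).
Proof.
move=> [mf f2]; split; first by apply: cmeasurableM => //; exact: cmeasurable_cst.
by rewrite L2normsqZ// lte_mul_pinfty// lee_fin sqr_ge0.
Qed.

Lemma memL2N f : memL2 mu D f -> memL2 mu D (fun x => - f x).
Proof. by move=> [mf f2]; split; [exact: cmeasurableN|rewrite L2normsqN]. Qed.

Lemma memL2B f g : memL2 mu D f -> memL2 mu D g -> memL2 mu D (fun x => f x - g x).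
Proof. by move=> f2 g2; apply: memL2D => //; exact: memL2N. Qed.

Lemma memL20 : memL2 mu D (fun=> 0).
Proof.
split; first exact: cmeasurable_cst.
rewrite /L2normsq; under eq_integral do rewrite ComplexField.Normc.normc0 expr0n/=.
by rewrite integral0.
Qed.

Lemma memL2_sum I (r : seq I) (F : I -> T -> R[i]) :
  (forall i, memL2 mu D (F i)) -> memL2 mu D (fun x => \sum_(i <- r) F i x).
Proof.
move=> iF; elim: r => [|i r IH].
  by under eq_fun do rewrite big_nil; exact: memL20.
by under eq_fun do rewrite big_cons; exact: memL2D.
Qed.

Lemma memL2M_bounded (M : R) b f : cmeasurable D b ->
  {ae mu, forall x, D x -> normc (b x) ^+ 2 <= M} -> memL2 mu D f ->
  memL2 mu D (fun x => b x * f x).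
Proof.
move=> mb bM [mf f2]; split; first exact: cmeasurableM.
apply: (@le_lt_trans _ _ (`|M|%:E * 'N f)%E); last by rewrite lte_mul_pinfty.
apply: L2normsq_le_mul => //; first exact: cmeasurableM.
apply: filterS bM => x + Dx => /(_ Dx) bM.
by rewrite normcM2 ler_wpM2r ?sqr_ge0// (le_trans bM) ?ler_norm.
Qed.

Lemma memL2_fin f : memL2 mu D f -> 'N f \is a fin_num.
Proof. by move=> [mf f2]; rewrite ge0_fin_numE ?L2normsq_ge0. Qed.

Lemma memL2_integrable f : memL2 mu D f ->
  mu.-integrable D (EFin \o (fun x => normc (f x) ^+ 2)).
Proof.
move=> [mf f2]; apply/integrableP; split; first exact: emeasurable_normc2.
under eq_integral do rewrite gee0_abs ?lee_fin ?sqr_ge0//.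
exact: f2.
Qed.

Lemma memL2_mulJ f g : memL2 mu D f -> memL2 mu D g ->
  cintegrable mu D (fun x => f x * (g x)^*).
Proof.
move=> f2 g2; have [m1 m2] := cmeasurableM f2.1 (cmeasurableJ g2.1).
have ifg := integrableD mD (memL2_integrable f2) (memL2_integrable g2).
split; (apply: le_integrable ifg => //; first exact/measurable_EFinP) => x Dx /=.
  by rewrite lee_fin (le_trans (cReM_le _ _))// ler_norm.
by rewrite lee_fin (le_trans (cImM_le _ _))// ler_norm.
Qed.

Lemma cinnerC f g : memL2 mu D f -> memL2 mu D g -> '<|g, f|> = ('<|f, g|>)^*.
Proof.
move=> f2 g2; rewrite /cinner -cintegralJ//; last exact: memL2_mulJ.
by apply: eq_cintegral => x _; rewrite conjcM conjCK mulrC.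
Qed.

Lemma cinnerDl f g h : memL2 mu D f -> memL2 mu D g -> memL2 mu D h ->
  '<|fun x => f x + g x, h|> = '<|f, h|> + '<|g, h|>.
Proof.
move=> f2 g2 h2; rewrite /cinner -cintegralD//; try exact: memL2_mulJ.
by apply: eq_cintegral => x _; rewrite mulrDl.
Qed.

Lemma cinnerZl c f h : memL2 mu D f -> memL2 mu D h ->
  '<|fun x => c * f x, h|> = c * '<|f, h|>.
Proof.
move=> f2 h2; rewrite /cinner -cintegralZ//; try exact: memL2_mulJ.
by apply: eq_cintegral => x _; rewrite mulrA.
Qed.

Lemma cinnerBl f g h : memL2 mu D f -> memL2 mu D g -> memL2 mu D h ->
  '<|fun x => f x - g x, h|> = '<|f, h|> - '<|g, h|>.
Proof.
move=> f2 g2 h2; have <- : '<|fun x => - g x, h|> = - '<|g, h|>.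
  rewrite -mulN1r -cinnerZl//; apply: eq_cintegral => x _.
  by rewrite mulN1r.
by rewrite cinnerDl//; exact: memL2N.
Qed.

Lemma cinner_suml I (r : seq I) (F : I -> T -> R[i]) h :
  (forall i, memL2 mu D (F i)) -> memL2 mu D h ->
  '<|fun x => \sum_(i <- r) F i x, h|> = \sum_(i <- r) '<|F i, h|>.
Proof.
move=> F2 h2; rewrite /cinner -cintegral_sum//; last by move=> i; exact: memL2_mulJ.
by apply: eq_cintegral => x _; rewrite mulr_suml.
Qed.

Lemma cinnerBr f g h : memL2 mu D f -> memL2 mu D g -> memL2 mu D h ->
  '<|h, fun x => f x - g x|> = '<|h, f|> - '<|h, g|>.
Proof.
move=> f2 g2 h2; rewrite cinnerC//; last exact: memL2B.
by rewrite cinnerBl// conjcD conjcN -!cinnerC.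
Qed.

Lemma cinnerZr c f h : memL2 mu D f -> memL2 mu D h ->
  '<|h, fun x => c * f x|> = c^* * '<|h, f|>.
Proof.
move=> f2 h2; rewrite cinnerC//; last exact: memL2Z.
by rewrite cinnerZl// conjcM -!cinnerC.
Qed.

Lemma cinner_sumr I (r : seq I) (F : I -> T -> R[i]) h :
  (forall i, memL2 mu D (F i)) -> memL2 mu D h ->
  '<|h, fun x => \sum_(i <- r) F i x|> = \sum_(i <- r) '<|h, F i|>.
Proof.
move=> F2 h2; rewrite cinnerC//; last exact: memL2_sum.
by rewrite cinner_suml// conjc_sum; apply: eq_bigr => i _; rewrite -cinnerC.
Qed.

Lemma cinner_self f : memL2 mu D f -> '<|f, f|> = (fine ('N f))%:C.
Proof.
move=> f2; rewrite /cinner.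
under [X in cintegral _ _ X]eq_fun do rewrite mulcJ.
by rewrite /cintegral /= Rintegral_cst// mul0r.
Qed.

Lemma L2normsqE f : memL2 mu D f -> 'N f = (Re '<|f, f|>)%:E.
Proof. by move=> f2; rewrite cinner_self//= fineK// memL2_fin. Qed.

(** Polarization: together with [Iminner] it makes every linear isometry
preserve inner products. *)
Lemma ReinnerD f g : memL2 mu D f -> memL2 mu D g ->
  Re '<|f, g|> = (fine ('N (fun x => f x + g x)) - fine ('N f) - fine ('N g)) / 2.
Proof.
move=> f2 g2; have fg2 := memL2D f2 g2.
have -> : fine ('N (fun x => f x + g x)) = Re '<|f, f|> + 2 * Re '<|f, g|> + Re '<|g, g|>.
  rewrite -[LHS]/(Re (fine ('N (fun x => f x + g x)))%:C) -cinner_self//.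
  rewrite cinnerDl// (cinnerC fg2)// (cinnerC fg2)// !cinnerDl//.
  rewrite (cinnerC f2 g2) !conjcD !cReD !cReJ; ring.
by rewrite !cinner_self//=; field.
Qed.

Lemma Iminner f g : memL2 mu D f -> memL2 mu D g ->
  Im '<|f, g|> = Re '<|f, (fun x => 'i * g x)|>.
Proof.
move=> f2 g2; rewrite cinnerZr// cReM cReJ cImJ /=; ring.
Qed.

End L2.

(** * Unconditional sums and orthonormal families *)

#[local] Existing Instance summability.totally_filter.

Section unconditional_sums.
Context {R : realType} {I : choiceType}.
Implicit Types (a : I -> \bar R) (A B : {fset I}).

Lemma fset_sum_le_esum a A : (\sum_(i <- A) a i <= \esum_(i in [set: I]) a i)%E.
Proof.
apply: esum_ge; exists [set` A]; first by split=> //; exact: finite_fset.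
by rewrite -fsbig_seq ?fset_uniq.
Qed.

Lemma lt_esum_fset a (b : \bar R) : (b < \esum_(i in [set: I]) a i)%E ->
  exists A, (b < \sum_(i <- A) a i)%E.
Proof.
rewrite /esum => /ereal_sup_gt[_ [X [finX _] <-] bX].
by exists (fset_set X); rewrite -fsbig_finite.
Qed.

Lemma fset_sum_sub (V : nmodType) (F : I -> V) A B : (A `<=` B)%fset ->
  \sum_(i <- B) F i = \sum_(i <- A) F i + \sum_(i <- (B `\` A)%fset) F i.
Proof.
move=> AB; rewrite (big_fsetID _ (mem A) B)/=; congr (_ + _).
  apply: eq_fbigl => x; rewrite !inE/= andbC.
  by case: (boolP (x \in A)) => //= xA; rewrite (fsubsetP AB).
by apply: eq_fbigl => x; rewrite !inE/= andbC.
Qed.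

Lemma fset_sum_le_sub a A B : (forall i, 0 <= a i)%E -> (A `<=` B)%fset ->
  (\sum_(i <- A) a i <= \sum_(i <- B) a i)%E.
Proof. by move=> a0 /(fset_sum_sub a) ->; rewrite leeDl// sume_ge0. Qed.

End unconditional_sums.

Section L2sum.
Context d (T : measurableType d) (R : realType).
Context (mu : {measure set T -> \bar R}) (D : set T) (mD : measurable D).
Context (I : choiceType).
Implicit Types (f g : T -> R[i]) (v : I -> T -> R[i]) (A B : {fset I}).

Local Notation "'N" := (L2normsq mu D).

Lemma L2sum_toP v f : L2sum_to mu D v f <->
  forall e : R, 0 < e -> exists A, forall B, (A `<=` B)%fset ->
    ('N (fun x => (\sum_(i <- B) v i x - f x)%R) < e%:E)%E.
Proof.
rewrite /L2sum_to; split.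
  move=> /fine_cvgP[finN /cvgr0Pnorm_lt cN] e e0.
  have [A _ HA] := filterI finN (cN _ e0).
  exists A => B AB; have [/= fB] := HA B AB.
  rewrite ger0_norm ?fine_ge0 ?L2normsq_ge0// => Be.
  by rewrite -[ltLHS]fineK// lte_fin.
move=> H; apply/fine_cvgP; split.
  have [A HA] := H 1 ltr01; exists A => // B /HA; move/lt_trans => /(_ _ (ltry _)).
  by rewrite ge0_fin_numE ?L2normsq_ge0.
apply/cvgr0Pnorm_lt => e e0; have [A HA] := H e e0; exists A => // B /HA Be /=.
rewrite ger0_norm ?fine_ge0 ?L2normsq_ge0//.
rewrite -lte_fin fineK// ge0_fin_numE ?L2normsq_ge0//.
exact: lt_trans Be (ltry _).
Qed.

Lemma L2sum_to_ae_eq v f g : (forall i, cmeasurable D (v i)) ->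
  cmeasurable D f -> cmeasurable D g -> ae_eq mu D f g ->
  L2sum_to mu D v f -> L2sum_to mu D v g.
Proof.
move=> mv mf mg fg /L2sum_toP H; apply/L2sum_toP => e /H[A HA].
exists A => B /HA; congr (_ < _)%E; apply: ae_eq_L2normsq => //.
- by apply: cmeasurableB => //; exact: cmeasurable_sum.
- by apply: cmeasurableB => //; exact: cmeasurable_sum.
- by apply: filterS fg => x + Dx => /(_ Dx) ->.
Qed.

Lemma L2sum_to_unique v f g : (forall i, cmeasurable D (v i)) ->
  cmeasurable D f -> cmeasurable D g ->
  L2sum_to mu D v f -> L2sum_to mu D v g -> ae_eq mu D f g.
Proof.
move=> mv mf mg /L2sum_toP vf /L2sum_toP vg; apply: (L2normsqB0 mD) => //.
apply/eqP; rewrite eq_le L2normsq_ge0 andbT.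
apply/lee_addgt0Pr => e e0; rewrite add0e.
have e40 : 0 < e / 4 by rewrite divr_gt0.
have [A HA] := vf _ e40; have [B HB] := vg _ e40.
have := HA _ (fsubsetUl A B); have := HB _ (fsubsetUr A B).
set S := fun x => \sum_(i <- (A `|` B)%fset) v i x.
have mS : cmeasurable D S by exact: cmeasurable_sum.
rewrite -/(S _) => Sg Sf.
have -> : 'N (fun x => f x - g x) = 'N (fun x => (S x - g x) + (- (S x - f x))).
  by apply: eq_L2normsq => x _; congr (_ : R[i]); ring.
apply: le_trans (L2normsqD_le mu mD (cmeasurableB mS mg)
  (cmeasurableN (cmeasurableB mS mf))) _.
rewrite L2normsqN.
have -> : (e%:E = 2%:E * (e / 4)%:E + 2%:E * (e / 4)%:E)%E.
  by rewrite -!EFinM -EFinD; congr EFin; field.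
by rewrite leeD// lee_pmul2l//; exact: ltW.
Qed.

(** Unconditional convergence follows from a convergent scalar series: the
tails of the [c i] are small uniformly in the finite set of indices. *)
Lemma L2sum_to_dominated v f (c : I -> R) (t K : R) : (forall i, 0 <= c i) -> 0 <= K ->
  (\esum_(i in [set: I]) (c i)%:E = t%:E)%E ->
  (forall A, 'N (fun x => (\sum_(i <- A) v i x - f x)%R) <=
     (K * (t - \sum_(i <- A) c i))%:E)%E ->
  L2sum_to mu D v f.
Proof.
move=> c0 K0 ct H; apply/L2sum_toP => e e0.
have K1 : 0 < K + 1 by rewrite ltr_wpDl.
have : ((t - e / (K + 1))%:E < \esum_(i in [set: I]) (c i)%:E)%E.
  by rewrite ct lte_fin ltrBlDr ltrDl divr_gt0.
move=> /lt_esum_fset[A HA]; exists A => B AB; apply: le_lt_trans (H B) _.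
have : (\sum_(i <- A) (c i)%:E <= \sum_(i <- B) (c i)%:E)%E.
  by apply: fset_sum_le_sub => // i; rewrite lee_fin.
move/(lt_le_trans HA); rewrite sumEFin lte_fin => HB; rewrite lte_fin.
have {}HB : t - \sum_(i <- B) c i < e / (K + 1) by lra.
have [->|Kn0] := eqVneq K 0; first by rewrite mul0r.
have Kp : 0 < K by rewrite lt_def Kn0.
apply: (@lt_trans _ _ (K * (e / (K + 1)))); first by rewrite ltr_pM2l.
by rewrite mulrA ltr_pdivrMr// mulrC mulrDr mulr1 ltrDl.
Qed.

End L2sum.

Section orthonormal.
Context d (T : measurableType d) (R : realType).
Context (mu : {measure set T -> \bar R}) (D : set T) (mD : measurable D).
Context (I : choiceType) (u : I -> T -> R[i]).
Hypothesis u2 : forall i, memL2 mu D (u i).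
Hypothesis uo : forall i j, cinner mu D (u i) (u j) = (i == j)%:R.
Implicit Types (f g : T -> R[i]) (c : I -> R[i]) (r : seq I).

Local Notation "'N" := (L2normsq mu D).
Local Notation "'<| f , g |>" := (cinner mu D f g) (at level 0).

Let S c r x := \sum_(i <- r) c i * u i x.

Lemma memL2_orthosum c r : memL2 mu D (S c r).
Proof. by apply: memL2_sum => // i; exact: memL2Z. Qed.

Lemma orthosum_coef c r j : uniq r -> j \in r -> '<|S c r, u j|> = c j.
Proof.
move=> ur jr; rewrite cinner_suml//; last by move=> i; exact: memL2Z.
rewrite (bigD1_seq j)//= cinnerZl// uo eqxx mulr1 big1 ?addr0// => i ij.
by rewrite cinnerZl// uo (negbTE ij) mulr0.
Qed.

Lemma orthosum_self c r : uniq r ->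
  '<|S c r, S c r|> = (\sum_(i <- r) normc (c i) ^+ 2)%:C.
Proof.
move=> ur; rewrite {2}/S cinner_sumr; last 3 first.
- by [].
- by move=> i; exact: memL2Z.
- exact: memL2_orthosum.
rewrite raddf_sum/= big_seq [RHS]big_seq; apply: eq_bigr => i ir.
by rewrite cinnerZr// ?orthosum_coef// -?mulcJ 1?mulrC//; exact: memL2_orthosum.
Qed.

Lemma L2normsq_orthosum c r : uniq r ->
  'N (S c r) = (\sum_(i <- r) normc (c i) ^+ 2)%:E.
Proof. by move=> ur; rewrite L2normsqE ?orthosum_self//; exact: memL2_orthosum. Qed.

Lemma bessel_identity f c r : memL2 mu D f -> uniq r ->
  (forall i, c i = '<|f, u i|>) ->
  'N (fun x => S c r x - f x) = ('N f - (\sum_(i <- r) normc (c i) ^+ 2)%:E)%E.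
Proof.
move=> f2 ur cE; have S2 := memL2_orthosum c r.
rewrite L2normsqE ?L2normsqE//; last exact: memL2B.
have Sf : '<|S c r, f|> = (\sum_(i <- r) normc (c i) ^+ 2)%:C.
  rewrite cinner_suml//; last by move=> i; exact: memL2Z.
  rewrite raddf_sum/=; apply: eq_bigr => i _.
  by rewrite cinnerZl// (cinnerC mD f2 (u2 i)) -cE mulcJ.
have fS : '<|f, S c r|> = (\sum_(i <- r) normc (c i) ^+ 2)%:C.
  by rewrite cinnerC// Sf; apply: complexP; rewrite ?cReJ ?cImJ//= oppr0.
rewrite cinnerBl ?cinnerBr//; last exact: memL2B.
by rewrite orthosum_self// Sf fS subrr sub0r !cReN cReD cReN -EFinB; congr EFin => /=; ring.
Qed.

Lemma bessel_ineq f r : memL2 mu D f -> uniq r ->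
  ((\sum_(i <- r) normc '<|f, u i|> ^+ 2)%:E <= 'N f)%E.
Proof.
move=> f2 ur.
have := bessel_identity (c := fun i => '<|f, u i|>) f2 ur (fun=> erefl).
set a := 'N _; have a0 : (0 <= a)%E by exact: L2normsq_ge0.
move=> aE; rewrite aE in a0; rewrite -sube_ge0//.
Qed.

Lemma normc_coef_le f i : memL2 mu D f -> ((normc '<|f, u i|> ^+ 2)%:E <= 'N f)%E.
Proof. by move=> f2; have := bessel_ineq (r := [:: i]) f2 erefl; rewrite big_seq1. Qed.

(** The squared distance from [f] to a partial sum is the part of the energy
of [f] that the partial sum misses. *)
Lemma parseval_L2sum_to f : memL2 mu D f ->
  (\esum_(i in [set: I]) (normc '<|f, u i|> ^+ 2)%:E = 'N f)%E ->
  L2sum_to mu D (fun i x => '<|f, u i|> * u i x) f.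
Proof.
move=> f2 pf.
apply: (L2sum_to_dominated (c := fun i => normc '<|f, u i|> ^+ 2) (t := fine ('N f)) (K := 1)).
- by move=> i; exact: sqr_ge0.
- by [].
- by rewrite fineK// memL2_fin.
- move=> A; rewrite mul1r.
  rewrite (bessel_identity (c := fun i => '<|f, u i|>) f2 (fset_uniq A) (fun=> erefl)).
  by rewrite EFinB fineK// memL2_fin.
Qed.

Lemma L2sum_to_coef c f : cmeasurable D f ->
  L2sum_to mu D (fun i x => c i * u i x) f ->
  memL2 mu D f /\ forall i, '<|f, u i|> = c i.
Proof.
move=> mf /L2sum_toP cf.
have Sf2 e : 0 < e -> exists A : {fset I}, forall B, (A `<=` B)%fset ->
    memL2 mu D (fun x => S c B x - f x) /\ ('N (fun x => (S c B x - f x)%R) < e%:E)%E.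
  move=> /cf[A HA]; exists A => B AB; have Be := HA B AB; split=> //.
  split; first exact: cmeasurableB (memL2_orthosum c B).1 mf.
  exact: lt_trans Be (ltry _).
have f2 : memL2 mu D f.
  have [A /(_ A (fsubset_refl _))[Af _]] := Sf2 1 ltr01.
  have := memL2B mD (memL2_orthosum c A) Af.
  by under [X in memL2 _ _ X]eq_fun do rewrite subKr.
split=> // i; apply/eqP; rewrite eq_sym -subr_eq0; apply/eqP/normc2_eq0/eqP.
rewrite eq_le sqr_ge0 andbT; apply/ler_addgt0Pr => e e0; rewrite add0r.
have [A HA] := Sf2 _ e0; have [Bf /ltW Be] := HA (i |` A)%fset (fsubsetU1 _ _).
rewrite -lee_fin; apply: le_trans Be.
have := normc_coef_le i Bf; rewrite cinnerBl//; last exact: memL2_orthosum.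
by rewrite orthosum_coef ?fset_uniq// fset1U1.
Qed.

End orthonormal.

Section riesz_fischer.
Context d (T : measurableType d) (R : realType).
Context (mu : {measure set T -> \bar R}) (D : set T) (mD : measurable D).
Implicit Types (f g : T -> R[i]).

Local Notation "'N" := (L2normsq mu D).

(** The pointwise limit where it exists. Using the upper limit of both parts
makes it a total and measurable function without any convergence hypothesis. *)
Definition clim (F : nat -> T -> R[i]) (x : T) : R[i] :=
  fine (limn_esup (fun n => (Re (F n x))%:E)) +i*
  fine (limn_esup (fun n => (Im (F n x))%:E)).

Lemma cmeasurable_clim F : (forall n, cmeasurable D (F n)) -> cmeasurable D (clim F).
Proof.
move=> mF; split => /=.
  apply: measurableT_comp => //.
  apply: (measurable_fun_limn_esup (f := fun n x => (Re (F n x))%:E)) => n.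
  by apply/measurable_EFinP; exact: (mF n).1.
apply: measurableT_comp => //.
apply: (measurable_fun_limn_esup (f := fun n x => (Im (F n x))%:E)) => n.
by apply/measurable_EFinP; exact: (mF n).2.
Qed.

Lemma sqr_le_norm (x b : R) : 0 <= b -> (x ^+ 2 <= b ^+ 2) = (`|x| <= b).
Proof. by move=> b0; rewrite -[x ^+ 2]real_normK ?num_real// ler_sqr ?nnegrE. Qed.

(** The sequence is squeezed between the monotone sequences
[v n - 2 s 2^-n] and [v n + 2 s 2^-n], whose distance tends to 0. *)
Lemma fast_cauchy_cvg (v : nat -> R) (s : R) :
  (forall n, `|v n.+1 - v n| <= s * 2^-1 ^+ n) ->
  forall n, `|fine (limn_esup (fun k => (v k)%:E)) - v n| <= 2 * s * 2^-1 ^+ n.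
Proof.
move=> vs.
pose a n := v n - 2 * s * 2^-1 ^+ n; pose b n := v n + 2 * s * 2^-1 ^+ n.
have s0 : 0 <= s by have := vs 0%N; rewrite expr0 mulr1; exact: le_trans.
have nda : nondecreasing_seq a.
  apply/nondecreasing_seqP => n; rewrite /a exprS.
  by have := vs n; rewrite ler_norml => /andP[? ?]; lra.
have nib : nonincreasing_seq b.
  apply/nonincreasing_seqP => n; rewrite /b exprS.
  by have := vs n; rewrite ler_norml => /andP[? ?]; lra.
have ab n : a n <= b n.
  have : 0 <= s * 2^-1 ^+ n by rewrite mulr_ge0// exprn_ge0// invr_ge0.
  by rewrite /a /b; lra.
have ab' n m : a n <= b m.
  apply: (le_trans (nda _ _ (leq_maxl n m))).
  exact: le_trans (ab _) (nib _ _ (leq_maxr n m)).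
have cva : cvgn a.
  by apply: nondecreasing_is_cvgn => //; exists (b 0%N) => _ [n _ <-].
pose l := limn a.
have al n : a n <= l by exact: nondecreasing_cvgn_le.
have lb n : l <= b n by apply: limr_le => //; exact: nearW.
have vl : v @ \oo --> l.
  have -> : v = (fun n => a n + 2 * s * 2^-1 ^+ n) by apply/funext => n; rewrite /a subrK.
  rewrite -[l]addr0; apply: cvgD => //.
  rewrite -(mulr0 (2 * s)); apply: cvgMr.
  by apply: cvg_expr; rewrite ger0_norm ?invr_ge0// invf_lt1// ltr1n.
have -> : limn_esup (fun k => (v k)%:E) = l%:E.
  by apply: (cvg_limn_einf_sup _).2; apply/fine_cvgP; split=> //; exact: nearW.
move=> n /=; rewrite ler_norml; have := al n; have := lb n.
by rewrite /a /b => *; apply/andP; split; lra.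
Qed.

(** The function [H = sum_n 4^n |F (n+1) - F n|^2] has integral at most 2,
hence is finite almost everywhere; where it is finite, the steps of the sequence
are at most [sqrt H 2^-n], so that it converges at a geometric rate controlled
by [H]. The explicit limit [clim F] depends measurably on parameters, which an
abstract limit in L^2 would not. *)
Lemma riesz_fischer F : (forall n, cmeasurable D (F n)) ->
  (forall n, 'N (fun x => (F n.+1 x - F n x)%R) <= (2^-1 ^+ (3 * n))%:E)%E ->
  forall n, ('N (fun x => (clim F x - F n x)%R) <= (16 * 4^-1 ^+ n)%:E)%E.
Proof.
move=> mF NF.
pose dl n x := normc (F n.+1 x - F n x) ^+ 2.
have mdl n : measurable_fun D (dl n).
  by apply: measurable_normc2; exact: cmeasurableB.
pose H x := (\sum_(0 <= n <oo) (4 ^+ n * dl n x)%:E)%E.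
have h0 n x : (0 <= (4 ^+ n * dl n x)%:E)%E.
  by rewrite lee_fin mulr_ge0 ?sqr_ge0// exprn_ge0.
have mh n : measurable_fun D (fun x => (4 ^+ n * dl n x)%:E).
  by apply/measurable_EFinP; exact: measurable_funM.
have mH : measurable_fun D H.
  rewrite /H; have := @ge0_emeasurable_sum _ T R D _ xpredT (fun n x _ _ => h0 n x) (fun n _ => mh n).
  by apply: eq_measurable_fun => x _; apply: eq_eseriesl.
have H0 x : (0 <= H x)%E by exact: nneseries_ge0.
have IH : (\int[mu]_(x in D) H x <= 2%:E)%E.
  rewrite integral_nneseries//.
  have -> : (2%:E : \bar R) = (\sum_(0 <= n <oo) (2 / (2 ^ (n + 1))%:R)%:E)%E.
    apply/esym; have /cvg_lim := @cvg_geometric_eseries_half R 2 0.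
    by rewrite expr0 divr1; apply.
  apply: lee_nneseries => [n _ _|n _]; first by apply: integral_ge0.
  under eq_integral do rewrite EFinM.
  rewrite ge0_integralZl//.
  - apply: (@le_trans _ _ ((4 ^+ n)%:E * (2^-1 ^+ (3 * n))%:E)%E).
      by rewrite lee_pmul2l ?lte_fin ?exprn_gt0//; exact: NF.
    have -> : (2 / (2 ^ (n + 1))%:R = 2^-1 ^+ n :> R).
      by rewrite addn1 natrX (exprS 2 n) invfM mulVKf ?exprVn.
    by rewrite -EFinM lee_fin exprM -exprMn (_ : 4 * 2^-1 ^+ 3 = 2^-1 :> R)//; field.
  - by apply/measurable_EFinP.
  - by move=> x _; rewrite lee_fin sqr_ge0.
have Hfin : {ae mu, forall x, D x -> H x \is a fin_num}.
  apply: integrable_ae => //; apply/integrableP; split=> //.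
  under eq_integral do rewrite gee0_abs//.
  exact: le_lt_trans IH (ltry _).
have key x n : H x \is a fin_num ->
    normc (clim F x - F n x) ^+ 2 <= 8 * 4^-1 ^+ n * fine (H x).
  move=> Hx; pose s := Num.sqrt (fine (H x)).
  have Hx0 : 0 <= fine (H x) by rewrite fine_ge0.
  have s2 : s ^+ 2 = fine (H x) by rewrite sqr_sqrtr.
  have dls k : dl k x <= (s * 2^-1 ^+ k) ^+ 2.
    rewrite exprMn s2 -exprM mulnC exprM.
    have -> : (2^-1 ^+ 2 : R) = 4^-1 by field.
    rewrite exprVn ler_pdivlMr ?exprn_gt0// mulrC -lee_fin fineK//.
    apply: le_trans (nneseries_lim_ge k.+1 (fun n _ _ => h0 n x)).
    by rewrite big_nat_recr//= leeDr// sume_ge0.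
  have s0 k : 0 <= s * 2^-1 ^+ k by rewrite mulr_ge0 ?sqrtr_ge0// exprn_ge0// invr_ge0.
  have HRe := @fast_cauchy_cvg (fun k => Re (F k x)) s _ n.
  have HIm := @fast_cauchy_cvg (fun k => Im (F k x)) s _ n.
  rewrite normc2E cReD cReN cImD cImN /=.
  rewrite [leRHS](_ : _ = (2 * s * 2^-1 ^+ n) ^+ 2 + (2 * s * 2^-1 ^+ n) ^+ 2).
    have sn : 0 <= 2 * s * 2^-1 ^+ n by rewrite -mulrA mulr_ge0.
    rewrite lerD// sqr_le_norm//.
      apply: HRe => k; rewrite -sqr_le_norm//.
      by apply: le_trans (dls k); rewrite /dl normc2E cReD cReN lerDl sqr_ge0.
    apply: HIm => k; rewrite -sqr_le_norm//.
    by apply: le_trans (dls k); rewrite /dl normc2E cImD cImN lerDr sqr_ge0.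
  rewrite !exprMn s2 -!exprM (mulnC n) (exprM _ 2 n).
  by have -> : (2^-1 ^+ 2 : R) = 4^-1; [field|ring].
move=> n; rewrite /L2normsq.
have c0 : 0 <= (8 * 4^-1 ^+ n : R) by rewrite mulr_ge0// exprn_ge0// invr_ge0.
apply: (@le_trans _ _ (\int[mu]_(x in D) ((8 * 4^-1 ^+ n)%:E * H x))%E).
  apply: ae_ge0_le_integral => //.
  - by move=> x _; rewrite lee_fin sqr_ge0.
  - by apply: emeasurable_normc2; apply: cmeasurableB => //; exact: cmeasurable_clim.
  - by move=> x _; rewrite mule_ge0.
  - exact: emeasurable_funM.
  - apply: filterS Hfin => x + Dx => /(_ Dx) Hx.
    by rewrite -[H x]fineK// -EFinM lee_fin key.
rewrite ge0_integralZl//.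
apply: (@le_trans _ _ ((8 * 4^-1 ^+ n)%:E * 2%:E)%E).
  by rewrite lee_wpmul2l// lee_fin.
by rewrite -EFinM lee_fin; set y := 4^-1 ^+ n; lra.
Qed.

Lemma clim_memL2 F : (forall n, memL2 mu D (F n)) ->
  (forall n, 'N (fun x => (F n.+1 x - F n x)%R) <= (2^-1 ^+ (3 * n))%:E)%E ->
  memL2 mu D (clim F).
Proof.
move=> F2 NF; have mF n := (F2 n).1.
have : memL2 mu D (fun x => clim F x - F 0%N x).
  split; first by apply: cmeasurableB => //; exact: cmeasurable_clim.
  exact: le_lt_trans (riesz_fischer mF NF 0) (ltry _).
move=> /(memL2D mD (F2 0%N)).
by under [X in memL2 _ _ X]eq_fun do rewrite addrC subrK.
Qed.

End riesz_fischer.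

(** * Parseval identity for complete orthonormal families *)

Section completeness.
Context d (T : measurableType d) (R : realType).
Context (mu : {measure set T -> \bar R}) (D : set T) (mD : measurable D).
Context (I : choiceType) (u : I -> T -> R[i]).
Hypothesis u2 : forall i, memL2 mu D (u i).
Hypothesis uo : forall i j, cinner mu D (u i) (u j) = (i == j)%:R.

Local Notation "'N" := (L2normsq mu D).
Local Notation "'<| f , g |>" := (cinner mu D f g) (at level 0).

Let q8 : (2^-1 ^+ 3 : R) = 8^-1. Proof. by field. Qed.

Lemma geometric_le_eq0 (z K q : R) : 0 <= z -> 0 <= q -> q < 1 ->
  (forall k, z <= K * q ^+ k) -> z = 0.
Proof.
move=> z0 q0 q1 H; apply/eqP; rewrite eq_le z0 andbT.
have cv : (fun k => K * q ^+ k) @ \oo --> (0 : R).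
  by rewrite -(mulr0 K); apply: cvgMr; apply: cvg_expr; rewrite ger0_norm.
rewrite -(cvg_lim _ cv)//; apply: limr_ge; first by apply/cvg_ex; exists 0.
exact: nearW.
Qed.

(** Riesz-Fischer along an increasing sequence of finite index sets: the
coefficients pass to the limit because they are continuous in L^2. *)
Lemma orthosum_clim (c : I -> R[i]) (A : nat -> {fset I}) :
  (forall k, (A k `<=` A k.+1)%fset) ->
  (forall k (B : {fset I}), (A k `<=` B)%fset ->
     \sum_(i <- B) normc (c i) ^+ 2 - \sum_(i <- A k) normc (c i) ^+ 2
     <= 2^-1 ^+ (3 * k)) ->
  let G := clim (fun k x => \sum_(i <- A k) c i * u i x) in
  [/\ memL2 mu D G, forall i, '<|G, u i|> = c i &
    forall k, 'N (fun x => (G x - \sum_(i <- A k) c i * u i x)%R) <=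
              (16 * 4^-1 ^+ k)%:E]%E.
Proof.
move=> incA tailA; set F := fun k x => _.
have F2 k : memL2 mu D (F k) by exact: memL2_orthosum.
have NF k : ('N (fun x => (F k.+1 x - F k x)%R) <= (2^-1 ^+ (3 * k))%:E)%E.
  have -> : (fun x => (F k.+1 x - F k x)%R) =
            (fun x => \sum_(i <- (A k.+1 `\` A k)%fset) c i * u i x).
    by apply/funext => x; rewrite /F (fset_sum_sub _ (incA k)) addrAC subrr add0r.
  rewrite (L2normsq_orthosum mD u2 uo)// lee_fin; apply: le_trans (tailA k _ (incA k)).
  by rewrite (fset_sum_sub _ (incA k)) addrAC subrr add0r.
move=> G; have G2 : memL2 mu D G by exact: clim_memL2.
have GA k : ('N (fun x => (G x - F k x)%R) <= (16 * 4^-1 ^+ k)%:E)%E.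
  by apply: riesz_fischer => // n; exact: (F2 n).1.
split=> // i; apply/eqP; rewrite -subr_eq0; apply/eqP/normc2_eq0.
apply: (@geometric_le_eq0 _ 34 4^-1); rewrite ?sqr_ge0 ?invr_ge0 ?invf_lt1 ?ltr1n// => k.
have ck : normc ('<|F k, u i|> - c i) ^+ 2 <= 4^-1 ^+ k.
  apply: (@le_trans _ _ (2^-1 ^+ (3 * k))); last first.
    rewrite exprM q8 lerXn2r ?nnegrE ?invr_ge0// lef_pV2 ?posrE// ler_nat//.
  have [iA|iA] := boolP (i \in A k).
    rewrite (orthosum_coef mD u2 uo)// subrr ComplexField.Normc.normc0 expr0n.
    by rewrite exprn_ge0// invr_ge0.
  have -> : '<|F k, u i|> = 0.
    rewrite cinner_suml//; last by move=> j; exact: memL2Z.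
    rewrite big_seq big1// => j jA; rewrite cinnerZl// uo.
    by case: eqVneq => [ji|]; [move: iA; rewrite -ji jA|rewrite mulr0].
  rewrite sub0r normc2N; apply: le_trans (tailA k (i |` A k)%fset (fsubsetU1 _ _)).
  by rewrite big_fsetU1//= addrK.
rewrite (_ : _ - c i = ('<|G, u i|> - '<|F k, u i|>) + ('<|F k, u i|> - c i)); last first.
  by rewrite addrA subrK.
apply: le_trans (normcD2_le _ _) _.
have GF : normc ('<|G, u i|> - '<|F k, u i|>) ^+ 2 <= 16 * 4^-1 ^+ k.
  rewrite -cinnerBl// -lee_fin; apply: le_trans (normc_coef_le mD u2 uo i (memL2B mD G2 (F2 k))) _.
  exact: GA.
by lra.
Qed.

(** The sum [G] of the orthonormal expansion of [f] has the coefficients of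
[f], so completeness applied to [f - G] gives [f = G], and the energy missed by
the partial sums tends to 0. *)
Lemma complete_parseval (f : T -> R[i]) :
  (forall g, memL2 mu D g -> (forall i, '<|g, u i|> = 0) -> ae_eq mu D g (fun=> 0)) ->
  memL2 mu D f ->
  (\esum_(i in [set: I]) (normc '<|f, u i|> ^+ 2)%:E = 'N f)%E.
Proof.
move=> ucomplete f2; set c := fun i => '<|f, u i|>.
have tN : (\esum_(i in [set: I]) (normc (c i) ^+ 2)%:E <= 'N f)%E.
  apply: ge_ereal_sup => _ [X [finX _] <-]; rewrite fsbig_finite// sumEFin.
  exact: bessel_ineq.
apply/eqP; rewrite eq_le tN/=.
have tfin : (\esum_(i in [set: I]) (normc (c i) ^+ 2)%:E)%E \is a fin_num.
  rewrite ge0_fin_numE ?esum_ge0//; last by move=> i _; rewrite lee_fin sqr_ge0.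
  by apply: le_lt_trans tN _; exact: f2.2.
move: tfin; set t := (X in X \is a fin_num) => /fineK tE.
have c0 i : (0 <= (normc (c i) ^+ 2)%:E)%E by rewrite lee_fin sqr_ge0.
have tailX k : {A : {fset I} | fine t - 2^-1 ^+ (3 * k) < \sum_(i <- A) normc (c i) ^+ 2}.
  apply: cid.
  have : ((fine t - 2^-1 ^+ (3 * k))%:E < t)%E.
    by rewrite -[ltRHS]tE lte_fin ltrBlDr ltrDl exprn_gt0// invr_gt0.
  by move=> /lt_esum_fset[A HA]; exists A; rewrite sumEFin lte_fin in HA.
pose A k := (\bigcup_(j <- iota 0 k.+1) sval (tailX j))%fset.
have tAS k : (sval (tailX k) `<=` A k)%fset.
  apply/fsubsetP => y yk; apply/bigfcupP; exists k => //.
  by rewrite andbT mem_iota add0n ltnSn.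
have incA k : (A k `<=` A k.+1)%fset.
  by rewrite /A -[k.+2]addn1 iotaD big_cat/=; exact: fsubsetUl.
have leB (B : {fset I}) : \sum_(i <- B) normc (c i) ^+ 2 <= fine t.
  by rewrite -lee_fin tE -sumEFin; exact: fset_sum_le_esum.
have geA k : fine t - 2^-1 ^+ (3 * k) <= \sum_(i <- A k) normc (c i) ^+ 2.
  apply: (le_trans (ltW (svalP (tailX k)))); rewrite -lee_fin -!sumEFin.
  exact: fset_sum_le_sub.
have tailA k (B : {fset I}) : (A k `<=` B)%fset ->
     \sum_(i <- B) normc (c i) ^+ 2 - \sum_(i <- A k) normc (c i) ^+ 2
     <= 2^-1 ^+ (3 * k).
  by move=> _; have := leB B; have := geA k; lra.
have [] := orthosum_clim incA tailA; set G := clim _ => G2 Gc GA.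
have fG : ae_eq mu D f G.
  have := ucomplete _ (memL2B mD f2 G2).
  have H i : '<|fun x => f x - G x, u i|> = 0 by rewrite cinnerBl// Gc subrr.
  move=> /(_ H); apply: filterS => x + Dx => /(_ Dx) /eqP.
  by rewrite subr_eq0 => /eqP.
have NfA k : ('N f - (\sum_(i <- A k) normc (c i) ^+ 2)%:E <= (16 * 4^-1 ^+ k)%:E)%E.
  rewrite -(bessel_identity mD u2 uo f2 (fset_uniq (A k)) (fun=> erefl)).
  pose S x := \sum_(i <- A k) c i * u i x.
  have S2 : memL2 mu D S by exact: memL2_orthosum.
  have <- : 'N (fun x => G x - S x) = 'N (fun x => S x - f x).
    rewrite -L2normsqN; apply: ae_eq_L2normsq => //.
    - by apply: cmeasurableN; exact: cmeasurableB G2.1 S2.1.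
    - exact: cmeasurableB S2.1 f2.1.
    - by apply: filterS fG => x + Dx => /(_ Dx) ->; rewrite opprB.
  exact: GA.
apply/lee_addgt0Pr => e e0.
have [k ke] : exists k, 16 * 4^-1 ^+ k <= e.
  have cv : (fun k => 16 * 4^-1 ^+ k) @ \oo --> (0 : R).
    rewrite -(mulr0 16); apply: cvgMr; apply: cvg_expr.
    by rewrite ger0_norm ?invr_ge0// invf_lt1// ltr1n.
  have [k _ Hk] := cvgr_le _ cv _ e0.
  by exists k; apply: Hk => /=.
rewrite -[leLHS](@subeK _ _ (\sum_(i <- A k) normc (c i) ^+ 2)%:E)//.
rewrite addeC leeD//; last exact: le_trans (NfA k) _.
by rewrite -sumEFin; exact: fset_sum_le_esum.
Qed.

End completeness.

(** * Fourier series on an interval *)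

Section cis.
Context {R : realType}.
Implicit Types (s t : R) (m k : int).

Lemma cisD s t : cis (s + t) = cis s * cis t.
Proof. by apply: complexP; rewrite ?cReM ?cImM /= ?cosD ?sinD// addrC. Qed.

Lemma cisN t : cis (- t) = (cis t)^*.
Proof. by apply: complexP; rewrite ?cReJ ?cImJ /= ?cosN ?sinN. Qed.

Lemma cis0 : cis (0 : R) = 1.
Proof. by apply: complexP; rewrite /= ?cos0 ?sin0. Qed.

Lemma normc2_cis t : normc (cis t) ^+ 2 = 1.
Proof. by rewrite normc2E /= cos2Dsin2. Qed.

Lemma cis_2pi_int m : cis (2 * pi * m%:~R : R) = 1.
Proof.
have nat_case (n : nat) : cis (2 * pi * n%:R : R) = 1.
  elim: n => [|n IH]; first by rewrite mulr0 cis0.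
  rewrite -[n.+1%:R]natr1 mulrDr cisD IH mul1r mulr1 mulr_natl.
  by apply: complexP; rewrite /= ?cos2pi ?sin2pi.
case: m => n; first exact: nat_case.
rewrite NegzE mulrNz mulrN cisN (nat_case n.+1).
exact: rmorph1.
Qed.

Lemma cmeasurable_cis d (T : measurableType d) (D : set T) (h : T -> R) :
  measurable_fun D h -> cmeasurable D (fun x => cis (h x)).
Proof.
by move=> mh; split; apply: measurableT_comp => //;
  apply: continuous_measurable_fun; [exact: continuous_cos|exact: continuous_sin].
Qed.

End cis.

Section separation.
Context {R : realType}.
Implicit Types (v y : R) (n N : nat).

Let bernoulli_le y N : 0 <= y <= 1 -> 1 - N%:R * y <= (1 - y) ^+ N.
Proof.
move=> /andP[y0 y1]; elim: N => [|N IH]; first by rewrite mul0r subr0 expr0.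
rewrite exprS -natr1; apply: (@le_trans _ _ ((1 - y) * (1 - N%:R * y))).
  have : 0 <= N%:R * y * y by rewrite !mulr_ge0.
  by lra.
by rewrite ler_wpM2l// subr_ge0.
Qed.

Let bernoulli_ge y N : 0 <= y -> N%:R * y <= (1 + y) ^+ N.
Proof.
move=> y0; suff : 1 + N%:R * y <= (1 + y) ^+ N by lra.
elim: N => [|N IH]; first by rewrite mul0r addr0 expr0.
rewrite exprS -natr1; apply: (@le_trans _ _ ((1 + y) * (1 + N%:R * y))).
  have : 0 <= N%:R * y * y by rewrite !mulr_ge0.
  by lra.
by rewrite ler_wpM2l// addr_ge0.
Qed.

(** Polynomials that separate [0, 1/2) from (1/2, 1]: they take values in
[0, 1] and tend to 1 on the left interval and to 0 on the right one. They
approximate indicators boundedly, as in the elementary proofs of the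
Stone-Weierstrass theorem. *)
Definition peak n v : R := (1 - v ^+ n) ^+ (2 ^ n).

Lemma peak_itv n v : 0 <= v <= 1 -> 0 <= peak n v <= 1.
Proof.
move=> /andP[v0 v1]; have vn1 : v ^+ n <= 1 by rewrite exprn_ile1.
have vn0 : 0 <= v ^+ n by rewrite exprn_ge0.
by rewrite /peak exprn_ge0 ?exprn_ile1 ?subr_ge0// lerBlDr lerDl.
Qed.

Let cvg_geo v : 0 <= v < 1 -> (fun n => v ^+ n) @ \oo --> 0.
Proof. by move=> /andP[v0 v1]; apply: cvg_expr; rewrite ger0_norm. Qed.

(** By Bernoulli's inequality, [(1 - v^n)^(2^n) >= 1 - (2v)^n]. *)
Lemma peak_low v : 0 <= v < 2^-1 -> peak ^~ v @ \oo --> (1 : R).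
Proof.
move=> /andP[v0 v1].
apply: (@squeeze_cvgr _ _ _ _ (fun n => 1 - (2 * v) ^+ n) (fun=> 1)).
- apply: nearW => n; have /andP[_ ->] : 0 <= peak n v <= 1.
    by apply: peak_itv; rewrite v0/=; lra.
  rewrite andbT exprMn -natrX; apply: bernoulli_le.
  by rewrite exprn_ge0// exprn_ile1//; lra.
- rewrite -[X in _ --> X]subr0; apply: cvgB; first exact: cvg_cst.
  by apply: cvg_geo; apply/andP; split; lra.
- exact: cvg_cst.
Qed.

(** By Bernoulli's inequality, [(1 - v^n)^(2^n) (2v)^n <= (1 - v^(2n))^(2^n) <= 1]. *)
Lemma peak_high v : 2^-1 < v <= 1 -> peak ^~ v @ \oo --> (0 : R).
Proof.
move=> /andP[v0 v1]; have vp : 0 < v by lra.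
apply: (@squeeze_cvgr _ _ _ _ (fun=> 0) (fun n => (2 * v)^-1 ^+ n)).
- apply: nearW => n; have /andP[-> _] /= : 0 <= peak n v <= 1.
    by apply: peak_itv; rewrite (ltW vp).
  have v2 : 0 < (2 * v) ^+ n by rewrite exprn_gt0// mulr_gt0.
  rewrite exprVn -div1r ler_pdivlMr//.
  have vn0 : 0 <= v ^+ n by rewrite exprn_ge0// ltW.
  have vn1 : v ^+ n <= 1 by rewrite exprn_ile1// ltW.
  apply: (@le_trans _ _ (peak n v * (1 + v ^+ n) ^+ (2 ^ n))).
    rewrite ler_wpM2l//; last by rewrite exprMn -natrX bernoulli_ge.
    by apply: (andP (peak_itv n _)).1; rewrite (ltW vp).
  rewrite /peak -exprMn -subr_sqr expr1n; apply: exprn_ile1.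
    by rewrite subr_ge0 exprn_ile1.
  by rewrite lerBlDr lerDl sqr_ge0.
- exact: cvg_cst.
- apply: cvg_geo; rewrite invr_ge0 invf_lt1 ?mulr_gt0//.
  by apply/andP; split; lra.
Qed.

End separation.

#[local] Instance lebesgue_ae_filter {R : realType} :
  Filter (nbhs (almost_everywhere (@lebesgue_measure R))) :=
  ae_filter_ringOfSetsType _.

Section fourier.
Context {R : realType}.
Variables (s p : R).
Hypothesis p0 : 0 < p.
Local Notation mu := (@lebesgue_measure R).
Local Notation D := `[s, (s + p)[%classic.
Implicit Types (m k : int) (x t : R).

Definition fourier m x : R[i] :=
  ((Num.sqrt p)^-1)%:C * cis (2 * pi * m%:~R * x / p).

Let mD : measurable (D : set (measurableTypeR R)). Proof. exact: measurable_itv. Qed.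

Let muD : mu D = p%:E.
Proof.
by rewrite lebesgue_measure_itv/= lte_fin ltrDl p0 -EFinB addrC addKr.
Qed.

Lemma cmeasurable_fourier m (E : set R) : cmeasurable E (fourier m).
Proof.
apply: cmeasurableM; first exact: cmeasurable_cst.
apply: cmeasurable_cis; apply: (measurable_funS measurableT) => //.
by do 2 apply: measurable_funM => //.
Qed.

Lemma normc2_fourier m x : normc (fourier m x) ^+ 2 = p^-1.
Proof.
by rewrite normcM2 normc2_cis mulr1 normc_real ?invr_ge0 ?sqrtr_ge0// exprVn sqr_sqrtr// ltW.
Qed.

Lemma fourier_mulJ m k x :
  fourier m x * (fourier k x)^* = (p^-1)%:C * cis (2 * pi * (m - k)%:~R / p * x).
Proof.
have -> : 2 * pi * (m - k)%:~R / p * x =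
          2 * pi * m%:~R * x / p + - (2 * pi * k%:~R * x / p) :> R.
  by rewrite intrB; field; exact: lt0r_neq0.
rewrite cisD cisN /fourier conjcM mulrACA; congr (_ * _).
apply: complexP; rewrite ?cReM ?cImM ?cReJ ?cImJ /=; last by ring.
by rewrite oppr0 mul0r subr0 -expr2 exprVn sqr_sqrtr// ltW.
Qed.

Lemma memL2_fourier m : memL2 mu D (fourier m).
Proof.
split; first exact: cmeasurable_fourier.
rewrite /L2normsq; under eq_integral do rewrite normc2_fourier.
by rewrite integral_cst// [X in (_ * X)%E]muD -EFinM ltry.
Qed.

Let integral_derive_periodic (F f : R -> R) :
  (forall x : R, is_derive x (1 : R) F (f x)) -> continuous f -> F (s + p) = F s ->
  \int[mu]_(x in D) f x = 0.
Proof.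
move=> Ff cf Fp.
have sp : s < s + p by rewrite ltrDl.
have cF : continuous F.
  by move=> x; apply: differentiable_continuous; exact/derivable1_diffP.
have icc : mu.-integrable `[s, s + p] (EFin \o f).
  apply: continuous_compact_integrable; first exact: segment_compact.
  exact: continuous_subspaceT.
rewrite Rintegral_itv_bndo_bndc; last first.
  apply: integrableS icc => //.
  by move=> x /=; rewrite !in_itv/= => /andP[-> /ltW].
rewrite /Rintegral (@continuous_FTC2 _ f F s (s + p)) //.
- by rewrite Fp subee.
- exact: continuous_subspaceT.
- split.
  + by move=> x _; have := Ff x.
  + by apply: cvg_at_right_filter; exact: cF.
  + by apply: cvg_at_left_filter; exact: cF.
- by move=> x _; rewrite derive1E; apply: derive_val.
Qed.

Let continuous_lin (h : R -> R) (w : R) : continuous h -> continuous (fun x => h (w * x)).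
Proof.
move=> ch x; apply: (@continuous_comp _ _ _ (fun x => w * x) h); last exact: ch.
exact: mulrl_continuous.
Qed.

(** The primitive [cis (w x) / (i w)] has the period [p]. *)
Lemma integral_cis_period (w : R) : w != 0 -> cis (w * p) = 1 ->
  cintegral mu D (fun x => cis (w * x)) = 0.
Proof.
move=> w0 wp; have E := cisD (w * s) (w * p); rewrite wp mulr1 -mulrDr in E.
rewrite /cintegral /=; apply: complexP => /=.
- apply: (@integral_derive_periodic (fun x => w^-1 * sin (w * x))).
  + by move=> x; apply: is_derive_eq; rewrite /GRing.scale /= mulr1 mulrCA mulVf ?mulr1.
  + by apply: continuous_lin; exact: continuous_cos.
  + by have /(congr1 (@complex.Im R)) /= -> := E.
- apply: (@integral_derive_periodic (fun x => - w^-1 * cos (w * x))).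
  + move=> x; apply: is_derive_eq; rewrite /GRing.scale /= mulr1.
    by field.
  + by apply: continuous_lin; exact: continuous_sin.
  + by have /(congr1 (@complex.Re R)) /= -> := E.
Qed.

Lemma fourierJ m x : (fourier m x)^* = fourier (- m) x.
Proof.
rewrite /fourier conjcM -cisN; congr (_ * cis _).
  by apply: complexP; rewrite ?cReJ ?cImJ //= oppr0.
by rewrite mulrNz !(mulrN, mulNr).
Qed.

Lemma fourier_scale m x : (Num.sqrt p)%:C * fourier m x = cis (2 * pi * m%:~R * x / p).
Proof.
by rewrite /fourier mulrA -rmorphM/= divff ?mul1r// gt_eqF// sqrtr_gt0.
Qed.

Lemma fourier_orthonormal m k :
  cinner mu D (fourier m) (fourier k) = (m == k)%:R.
Proof.
case: eqVneq => [->|mk].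
  rewrite cinner_self//; last exact: memL2_fourier.
  rewrite /L2normsq; under eq_integral do rewrite normc2_fourier.
  by rewrite integral_cst// [X in (_ * X)%E]muD -EFinM /= mulVf// gt_eqF.
transitivity (cintegral mu D (fun x => (p^-1)%:C * cis (2 * pi * (m - k)%:~R / p * x))).
  by apply: eq_cintegral => x _; exact: fourier_mulJ.
rewrite cintegralZ//.
  rewrite integral_cis_period ?mulr0//.
    have mk0 : (m - k)%:~R != 0 :> R by rewrite intr_eq0 subr_eq0.
    by rewrite !mulf_eq0 invr_eq0 pnatr_eq0 (negbTE mk0) !gt_eqF ?pi_gt0.
  by rewrite -mulrA mulVf ?mulr1 ?cis_2pi_int// gt_eqF.
have := cintegrableZ mD p%:C (memL2_mulJ mD (memL2_fourier m) (memL2_fourier k)).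
apply: (eq_cintegrable mD) => x _.
by rewrite fourier_mulJ mulrA -rmorphM/= divff ?gt_eqF// mul1r.
Qed.

Inductive trigpoly : (R -> R[i]) -> Prop :=
| trig_exp m : trigpoly (fun x => cis (2 * pi * m%:~R * x / p))
| trig_add f g : trigpoly f -> trigpoly g -> trigpoly (fun x => f x + g x)
| trig_scale c f : trigpoly f -> trigpoly (fun x => c * f x).

Lemma trigpoly1 : trigpoly (fun=> 1).
Proof.
rewrite (_ : (fun=> 1) = (fun x => cis (2 * pi * (0 : int)%:~R * x / p))).
  exact: trig_exp.
by apply/funext => x; rewrite mulr0 mul0r mul0r cis0.
Qed.

Lemma trigpolyM f g : trigpoly f -> trigpoly g -> trigpoly (fun x => f x * g x).
Proof.
move=> tf tg; elim: tf => [m|f1 f2 _ IH1 _ IH2|c f1 _ IH].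
- elim: tg => [k|g1 g2 _ IH1 _ IH2|c g1 _ IH].
  + rewrite (_ : (fun x => _) = (fun x => cis (2 * pi * (m + k)%:~R * x / p))).
      exact: trig_exp.
    apply/funext => x; rewrite -cisD; congr cis.
    by rewrite intrD; field; exact: lt0r_neq0.
  + by under eq_fun do rewrite mulrDr; exact: trig_add.
  + by under eq_fun do rewrite mulrCA; exact: trig_scale.
- by under eq_fun do rewrite mulrDl; exact: trig_add.
- by under eq_fun do rewrite -mulrA; exact: trig_scale.
Qed.

Lemma trigpolyX f n : trigpoly f -> trigpoly (fun x => f x ^+ n).
Proof.
move=> tf; elim: n => [|n IH]; first exact: trigpoly1.
by under eq_fun do rewrite exprS; exact: trigpolyM.
Qed.

Lemma trigpoly_cos t : trigpoly (fun x => (cos (2 * pi * (x - t) / p))%:C).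
Proof.
pose c := cis (2 * pi * t / p).
rewrite (_ : (fun x => _) = (fun x =>
   ((2^-1)%:C * c^*) * cis (2 * pi * (1 : int)%:~R * x / p) +
   ((2^-1)%:C * c) * cis (2 * pi * (-1 : int)%:~R * x / p))).
  by apply: trig_add; apply: trig_scale; exact: trig_exp.
apply/funext => x.
have -> : 2 * pi * (x - t) / p = 2 * pi * x / p + - (2 * pi * t / p) :> R by ring.
have -> : 2 * pi * (-1 : int)%:~R * x / p = - (2 * pi * x / p) :> R by rewrite mulrN1z; ring.
rewrite mulr1 cosD cosN sinN /c cisN.
by apply: complexP; rewrite ?(cReD, cImD, cReM, cImM, cReJ, cImJ) /=; field.
Qed.

(** An affine function of a cosine, so that its powers are trigonometric
polynomials; it takes values in [0, 1] for [c] in [-1, 1] and is below 1/2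
exactly on an arc centred at [t]. *)
Definition arc_weight c t x : R := 2^-1 + (c - cos (2 * pi * (x - t) / p)) / 4.

Lemma trigpoly_peak n c t : trigpoly (fun x => (peak n (arc_weight c t x))%:C).
Proof.
have vE x : (arc_weight c t x)%:C = (2^-1 + c / 4)%:C * 1 +
    (- 4^-1)%:C * (cos (2 * pi * (x - t) / p))%:C.
  by rewrite mulr1 -rmorphM/= -rmorphD/=; congr (_%:C); rewrite /arc_weight; ring.
have -> : (fun x => (peak n (arc_weight c t x))%:C) =
  (fun x => (1 + -1 * (arc_weight c t x)%:C ^+ n) ^+ (2 ^ n)).
  by apply/funext => x; rewrite /peak rmorphXn/= rmorphB/= rmorphXn/= rmorph1 mulN1r.
under eq_fun do rewrite vE.
apply: trigpolyX; apply: trig_add; first exact: trigpoly1.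
apply/trig_scale/trigpolyX/trig_add; apply/trig_scale.
  exact: trigpoly1.
exact: trigpoly_cos.
Qed.

Section orthogonal.
Variable f : R -> R[i].
Hypothesis f2 : memL2 mu D f.
Hypothesis f0 : forall m, cinner mu D f (fourier m) = 0.

Lemma trigpoly_orthogonal g : trigpoly g ->
  cintegrable mu D (fun x => f x * g x) /\ cintegral mu D (fun x => f x * g x) = 0.
Proof.
elim=> [m|g1 g2 _ [i1 e1] _ [i2 e2]|c g1 _ [i1 e1]].
- have fE x : f x * cis (2 * pi * m%:~R * x / p) =
     (Num.sqrt p)%:C * (f x * (fourier (- m) x)^*).
    by rewrite fourierJ opprK mulrCA fourier_scale.
  have ifm := cintegrableZ mD (Num.sqrt p)%:C (memL2_mulJ mD f2 (memL2_fourier (- m))).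
  split; first by apply: (eq_cintegrable mD) ifm => x _; rewrite fE.
  transitivity (cintegral mu D (fun x => (Num.sqrt p)%:C * (f x * (fourier (- m) x)^*))).
    by apply: eq_cintegral => x _; exact: fE.
  rewrite cintegralZ//; last exact: memL2_mulJ (memL2_fourier (- m)).
  by rewrite [X in _ * X]f0 mulr0.
- rewrite (_ : (fun x => f x * (g1 x + g2 x)) = (fun x => f x * g1 x + f x * g2 x)).
    by split; [exact: cintegrableD|rewrite cintegralD// e1 e2 addr0].
  by apply/funext => x; rewrite mulrDr.
- rewrite (_ : (fun x => f x * (c * g1 x)) = (fun x => c * (f x * g1 x))).
    by split; [exact: cintegrableZ|rewrite cintegralZ// e1 mulr0].
  by apply/funext => x; rewrite mulrCA.
Qed.

End orthogonal.

Lemma cos_gt_arc t x : 0 < t < p -> `|x| < t / 2 -> cos (pi * t / p) < cos (2 * pi * x / p).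
Proof.
move=> /andP[t0 tp] xt; have pi0 := pi_gt0 R.
have -> : cos (2 * pi * x / p) = cos (2 * pi * `|x| / p).
  by case: (ler0P x) => // _; rewrite mulrN mulNr cosN.
have n0 := normr_ge0 x.
have h1 : 2 * pi * `|x| / p < pi * t / p.
  rewrite ltr_pM2r ?invr_gt0// [2 * pi]mulrC -mulrA ltr_pM2l//.
  by rewrite mulrC -ltr_pdivlMr.
have h2 : pi * t / p < pi.
  by rewrite ltr_pdivrMr// ltr_pM2l.
have h3 : 0 <= 2 * pi * `|x| / p.
  by apply: divr_ge0; [rewrite mulr_ge0// mulr_ge0// ltW|exact: ltW].
have i1 : pi * t / p \in `[0, pi] by rewrite in_itv/= (ltW h2) (le_trans h3)// ltW.
have i2 : 2 * pi * `|x| / p \in `[0, pi] by rewrite in_itv/= h3 ltW// (lt_trans h1).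
by rewrite ltr_cos.
Qed.

Lemma cos_lt_arc t x : 0 < t < p -> t / 2 < x < p - t / 2 -> cos (2 * pi * x / p) < cos (pi * t / p).
Proof.
move=> /andP[t0 tp] /andP[tx xt]; have pi0 := pi_gt0 R.
wlog xp : x tx xt / x <= p / 2.
  move=> H; have [|px] := leP x (p / 2); first exact: H.
  have -> : cos (2 * pi * x / p) = cos (2 * pi * (p - x) / p).
    have -> : 2 * pi * (p - x) / p = - (2 * pi * x / p) + pi *+ 2.
      by rewrite mulr2n; field; exact: lt0r_neq0.
    by rewrite cosD2pi cosN.
  by apply: H; lra.
have h1 : pi * t / p < 2 * pi * x / p.
  rewrite ltr_pM2r ?invr_gt0// [2 * pi]mulrC -mulrA ltr_pM2l//.
  by rewrite mulrC -ltr_pdivrMr.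
have h2 : 2 * pi * x / p <= pi.
  rewrite ler_pdivrMr// [2 * pi]mulrC -mulrA ler_pM2l//; lra.
have h3 : 0 <= pi * t / p by apply: divr_ge0; [rewrite mulr_ge0// ltW|exact: ltW].
have i1 : pi * t / p \in `[0, pi] by rewrite in_itv/= h3 ltW// (lt_le_trans h1).
have i2 : 2 * pi * x / p \in `[0, pi] by rewrite in_itv/= h2 (le_trans h3)// ltW.
by rewrite ltr_cos.
Qed.

Lemma arc_weight_itv t u x : 0 <= arc_weight (cos u) t x <= 1.
Proof.
rewrite /arc_weight; set c := cos u; set c' := cos _.
have := cos_geN1 u; have := cos_le1 u; rewrite -/c.
have := cos_geN1 (2 * pi * (x - t) / p); have := cos_le1 (2 * pi * (x - t) / p).
by rewrite -/c' => *; apply/andP; split; lra.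
Qed.

Lemma peak_cvg_arc t x : 0 < t < p -> s < x < s + p -> x != s + t ->
  peak ^~ (arc_weight (cos (pi * t / p)) (s + t / 2) x) @ \oo -->
  (\1_(`]s, (s + t)[%classic) x : R).
Proof.
move=> tp /andP[sx xs] xst; rewrite indicE mem_setE in_itv/= sx/=.
have /andP[w0 w1] := arc_weight_itv (s + t / 2) (pi * t / p) x.
have [xt|] := ltP x (s + t).
  apply: peak_low; rewrite w0/= /arc_weight.
  suff : cos (pi * t / p) < cos (2 * pi * (x - (s + t / 2)) / p) by lra.
  by apply: cos_gt_arc => //; rewrite ltr_norml; apply/andP; split; lra.
rewrite le_eqVlt eq_sym (negbTE xst)/= => xt.
apply: peak_high; rewrite w1 andbT /arc_weight.
suff : cos (2 * pi * (x - (s + t / 2)) / p) < cos (pi * t / p) by lra.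
by apply: cos_lt_arc => //; apply/andP; split; lra.
Qed.

Lemma measurable_arc_weight c t (E : set R) : measurable_fun E (arc_weight c t).
Proof.
apply: (measurable_funS measurableT) => //.
apply: measurable_funD => //; apply: measurable_funM => //.
apply: measurable_funB => //.
apply: (@measurableT_comp _ _ _ _ _ _ (cos : R -> R)).
  by apply: continuous_measurable_fun; exact: continuous_cos.
by do 2 apply: measurable_funM => //; exact: measurable_funB.
Qed.

Lemma negligible_set1 (y : R) : {ae mu, forall x, x != y}.
Proof.
exists [set y]; split => //; first exact: lebesgue_measure_set1.
by move=> x /= /negP; rewrite negbK => /eqP.
Qed.

(** The trigonometric polynomials [peak n (arc_weight c u x)] tend boundedly
to the indicator of the arc, so dominated convergence applies. *)
Lemma arc_integral0 (g : R -> R) t : 0 < t < p ->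
  mu.-integrable D (EFin \o g) ->
  (forall n c u, \int[mu]_(x in D) (g x * peak n (arc_weight c u x)) = 0) ->
  \int[mu]_(x in `]s, (s + t)[) g x = 0.
Proof.
move=> tp ig H.
pose A := `]s, (s + t)[%classic : set R.
have mA : measurable A by exact: measurable_itv.
have AD : A `<=` D.
  move=> x /=; rewrite !in_itv/= => /andP[/ltW-> /lt_trans]; apply.
  by rewrite ltrD2l; case/andP: tp.
have -> : \int[mu]_(x in A) g x = \int[mu]_(x in D) (g \_ A) x.
  by rewrite -Rintegral_mkcondr setIidr.
have mg : measurable_fun D g by apply/measurable_EFinP; exact: measurable_int ig.
pose v := arc_weight (cos (pi * t / p)) (s + t / 2).
have v01 n x : 0 <= peak n (v x) <= 1 by apply: peak_itv; exact: arc_weight_itv.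
have mgp n : measurable_fun D (fun x => (g x * peak n (v x))%:E).
  apply/measurable_EFinP; apply: measurable_funM => //.
  apply: measurable_funX; apply: measurable_funB => //.
  by apply: measurable_funX; exact: measurable_arc_weight.
have gp_le n x : `|g x * peak n (v x)| <= `|g x|.
  by have /andP[q0 q1] := v01 n x; rewrite normrM ler_piMr// ger0_norm.
have cvp : {ae mu, forall x, D x ->
    (fun n => (g x * peak n (v x))%:E) @ \oo --> (EFin \o (g \_ A)) x}.
  apply: filterS2 (negligible_set1 s) (negligible_set1 (s + t)) => x xs xst Dx.
  apply/fine_cvgP; split; first exact: nearW.
  have -> : (g \_ A) x = g x * \1_A x.
    by rewrite patchE indicE; case: (x \in A); rewrite ?mulr1 ?mulr0.
  apply: cvgMr; apply: peak_cvg_arc => //.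
  by move: Dx => /=; rewrite in_itv/= le_eqVlt eq_sym (negbTE xs).
have [] := @dominated_convergence _ _ R mu D mD (fun n x => (g x * peak n (v x))%:E)
  (EFin \o (g \_ A)) (fun x => `|(g x)%:E|%E) mgp _ cvp.
- by apply/measurable_EFinP/measurable_restrict => //; exact: measurable_funS mg.
- exact: integrable_abse.
- by apply: nearW => x n Dx; rewrite /= lee_fin gp_le.
move=> _ _ cvI; rewrite /Rintegral.
suff -> : (\int[mu]_(x in D) (EFin \o (g \_ A)) x = 0)%E by [].
apply: cvg_unique cvI _ => //.
apply: cvg_near_cst; apply: nearW => n.
have ign : mu.-integrable D (fun x => (g x * peak n (v x))%:E).
  by apply: (le_integrable mD (mgp n) _ ig) => x Dx; rewrite /= lee_fin gp_le.
by rewrite -[LHS]fineK ?integrable_fin_num//; congr EFin; exact: H.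
Qed.

(** By Lebesgue's differentiation theorem, [g] is almost everywhere the
derivative of its integral over [(s, s + t)], which vanishes. *)
Lemma ae_eq0_arc (g : R -> R) : mu.-integrable D (EFin \o g) ->
  (forall t, 0 < t < p -> \int[mu]_(x in `]s, (s + t)[) g x = 0) ->
  ae_eq mu D g (fun=> 0).
Proof.
move=> ig H; pose h := g \_ D.
have ih : mu.-integrable setT (EFin \o h).
  by rewrite /h -restrict_EFin; apply/(integrable_mkcond _ mD).
have ihE E : measurable E -> mu.-integrable E (EFin \o h).
  by move=> mE; apply: integrableS ih.
have := @FTC1 R h (BLeft s) (fun y => ihE _ (measurable_itv _)) (integrable_locally_restrict mD ig).
apply: filterS2 (negligible_set1 s) => x xs + Dx.
have : x \in `]s, (s + p)[.
  by move: Dx => /=; rewrite !in_itv/= le_eqVlt eq_sym (negbTE xs).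
rewrite in_itv/= => /andP[sx xp].
have sxE : (s%:E < x%:E)%E by rewrite lte_fin.
move=> /(_ sxE) [_]; rewrite derive1E.
have -> : h x = g x by rewrite /h patchE mem_set.
move=> <-; rewrite (near_eq_derive (g := fun=> 0)) ?derive_cst//.
near=> y.
have sy : s < y by near: y; exact: lt_nbhsr.
have yp : y < s + p by near: y; exact: lt_nbhsl.
rewrite -Rintegral_itv_bndo_bndc; last by apply: ihE; exact: measurable_itv.
rewrite -Rintegral_itv_obnd_cbnd; last by apply: ihE; exact: measurable_itv.
rewrite -(H (y - s)); last by apply/andP; split; lra.
rewrite addrC subrK; apply: eq_Rintegral => z; rewrite inE/= in_itv/= => /andP[sz zy].
by rewrite /h patchE mem_set//= in_itv/= (ltW sz) (lt_trans zy).
Unshelve. all: by end_near.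
Qed.

(** A function orthogonal to the exponentials is orthogonal to all
trigonometric polynomials, hence has integral 0 on all arcs starting at [s]. *)
Lemma fourier_complete (f : R -> R[i]) : memL2 mu D f ->
  (forall m, cinner mu D f (fourier m) = 0) -> ae_eq mu D f (fun=> 0).
Proof.
move=> f2 f0.
have H n c u := trigpoly_orthogonal f2 f0 (trigpoly_peak n c u).
have [i1 i2] : cintegrable mu D f.
  have [] := trigpoly_orthogonal f2 f0 trigpoly1.
  by under [X in cintegrable _ _ X]eq_fun do rewrite mulr1.
have Ref : ae_eq mu D (fun x => Re (f x)) (fun=> 0).
  apply: ae_eq0_arc => // t tp; apply: arc_integral0 => // n c u.
  have [_ /(congr1 (@complex.Re R)) /= <-] := H n c u.
  by apply: eq_Rintegral => x _; rewrite cReM /= mulr0 subr0.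
have Imf : ae_eq mu D (fun x => Im (f x)) (fun=> 0).
  apply: ae_eq0_arc => // t tp; apply: arc_integral0 => // n c u.
  have [_ /(congr1 (@complex.Im R)) /= <-] := H n c u.
  by apply: eq_Rintegral => x _; rewrite cImM /= mulr0 add0r.
by apply: filterS2 Ref Imf => x + + Dx => /(_ Dx) /= Re0 /(_ Dx) /= Im0; exact: complexP.
Qed.

Lemma fourier_parseval (f : R -> R[i]) : memL2 mu D f ->
  (\esum_(m in [set: int]) (normc (cinner mu D f (fourier m)) ^+ 2)%:E =
   L2normsq mu D f)%E.
Proof.
exact: (complete_parseval mD memL2_fourier fourier_orthonormal fourier_complete).
Qed.

End fourier.

(** * Dilations of the half line and integration over rectangles *)

Lemma nat_int_bij : exists e : nat -> int, set_bij [set: nat] [set: int] e.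
Proof.
pose e n : int := if odd n then Negz n./2 else Posz n./2.
pose g (z : int) : nat := match z with Posz k => k.*2 | Negz k => k.*2.+1 end.
have eK : cancel e g.
  by move=> n; have := odd_double_half n; rewrite /e; case: (odd n).
have gK : cancel g e.
  by case=> k; rewrite /e /g/= odd_double ?uphalf_double ?doubleK.
exists e; split=> //; first by move=> x y _ _ /(can_inj eK).
by move=> z _; exists (g z).
Qed.

Section integral_esum.
Context d (T : measurableType d) (R : realType).
Context (mu : {measure set T -> \bar R}) (D : set T) (mD : measurable D).
Variable h : int -> T -> \bar R.
Hypothesis mh : forall m, measurable_fun D (h m).
Hypothesis h0 : forall m x, D x -> (0 <= h m x)%E.

Lemma measurable_fun_esum : measurable_fun D (fun x => \esum_(m in [set: int]) h m x)%E.
Proof.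
have [e ebij] := nat_int_bij.
apply: (@eq_measurable_fun _ _ _ _ D (fun x => \sum_(0 <= n <oo | n \in xpredT) h (e n) x)%E).
  move=> x /set_mem Dx; rewrite (reindex_esum _ _ _ _ ebij).
  by rewrite nneseries_esumT// => n; exact: h0.
by apply: ge0_emeasurable_sum => // k x Dx _; exact: h0.
Qed.

Lemma integral_esum : (\int[mu]_(x in D) (\esum_(m in [set: int]) h m x) =
  \esum_(m in [set: int]) \int[mu]_(x in D) h m x)%E.
Proof.
have [e ebij] := nat_int_bij.
rewrite (reindex_esum _ _ _ _ ebij) -nneseries_esumT; last first.
  by move=> n; apply: integral_ge0 => x; exact: h0.
rewrite -integral_nneseries//; last by move=> n x; exact: h0.
apply: eq_integral => x /set_mem Dx; rewrite (reindex_esum _ _ _ _ ebij).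
by rewrite nneseries_esumT// => n; exact: h0.
Qed.

End integral_esum.

Section scaling.
Context {R : realType}.

Lemma measurable_scale (c : R) (E : set (measurableTypeR R)) :
  measurable_fun E (fun x : measurableTypeR R => c * x : measurableTypeR R).
Proof. by apply: (measurable_funS measurableT) => //; exact: measurable_funM. Qed.

Local Notation mu := (@lebesgue_measure R).
Variable (c : R).
Hypothesis c0 : 0 < c.

Let phi (x : measurableTypeR R) : measurableTypeR R := c * x.

Let mphi : measurable_fun setT phi.
Proof. exact: measurable_scale. Qed.

(** Both sides are measures that agree on half-open intervals. *)
Lemma lebesgue_measure_scale (A : set (measurableTypeR R)) : measurable A ->
  mu A = (c%:E * mu (phi @^-1` A))%E.
Proof.
move=> mA.
unshelve epose proof (@lebesgue_measure_unique R
  (mscale (NngNum (ltW c0)) (pushforward mu phi)) _ A mA) as H; [exact: mphi| |exact H].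
move=> X /ocitvP[->|[[x y]/= xy ->]]; first by rewrite !measure0.
rewrite /mscale/= /pushforward.
have -> : phi @^-1` `]x, y] = `]x / c, y / c]%classic.
  by apply/seteqP; split => z /=; rewrite !in_itv/= /phi ltr_pdivrMr// ler_pdivlMr// ![z * c]mulrC.
rewrite !lebesgue_measure_itv/= !lte_fin xy ltr_pM2r ?invr_gt0// xy.
by rewrite -!EFinB -EFinM; congr EFin; field; exact: lt0r_neq0.
Qed.

Lemma ge0_integral_scale (g : R -> \bar R) (E E' : set (measurableTypeR R)) :
  measurable E -> (forall x, E' x <-> E (c * x)) ->
  measurable_fun E g -> (forall x, E x -> 0 <= g x)%E ->
  (\int[mu]_(x in E) g x = c%:E * \int[mu]_(x in E') g (c * x)%R)%E.
Proof.
move=> mE EE' mg g0.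
have -> : E' = phi @^-1` E by apply/seteqP; split => x /=; rewrite EE'.
rewrite -(ge0_integral_pushforward mphi mu mE mg); last by move=> y /set_mem; exact: g0.
rewrite -(ge0_integral_mscale _ mE (NngNum (ltW c0)))//.
apply: eq_measure_integral => A mA _; exact: lebesgue_measure_scale.
Qed.

End scaling.

Section shells.
Context {R : realType}.
Variable (a : R).
Hypothesis a1 : 1 < a.
Implicit Types (b x : R) (l m : int).

Let a0 : 0 < a. Proof. exact: lt_trans a1. Qed.
(** For [b > 0] the shells partition the half line, and dilation by [a ^ l]
maps the shell of index 0 onto the shell of index [l]. *)
Definition shell b l : set R := `[b * a ^ l, b * a ^ (l + 1)[%classic.

Lemma expz_ln_le x l : 0 < x -> (a ^ l <= x) = (l%:~R <= ln x / ln a).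
Proof.
move=> x0; rewrite ler_pdivlMr ?ln_gt0// -(powR_intmul _ (ltW a0)) -ln_powR.
by rewrite ler_ln// posrE powR_gt0.
Qed.

Lemma mem_shell b x l : 0 < b ->
  shell b l x <-> 0 < x /\ Num.floor (ln (x / b) / ln a) = l.
Proof.
move=> b0; have al k : 0 < a ^ k by exact: exprz_gt0.
rewrite /shell /= in_itv/=; split.
  move=> /andP[blx xbl].
  have x0 : 0 < x by rewrite (lt_le_trans _ blx)// mulr_gt0.
  have xb0 : 0 < x / b by rewrite divr_gt0.
  split=> //; apply: floor_def.
  rewrite -expz_ln_le// ltNge -expz_ln_le// -ltNge.
  by rewrite ler_pdivlMr// ltr_pdivrMr// ![_ * b]mulrC blx.
move=> [x0 <-]; have xb0 : 0 < x / b by rewrite divr_gt0.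
rewrite -ler_pdivlMl// -ltr_pdivrMl// ![b^-1 * x]mulrC expz_ln_le// floor_le/=.
by rewrite ltNge expz_ln_le// -ltNge floorD1_gt.
Qed.

Lemma measurable_shell b l : measurable (shell b l : set (measurableTypeR R)).
Proof. exact: measurable_itv. Qed.

Lemma shell_scale b l x : (shell b 0 x) <-> shell b l (a ^ l * x).
Proof.
have al k : 0 < a ^ k by exact: exprz_gt0.
rewrite /shell /= !in_itv/= expr0z mulr1 add0r expr1z.
have -> : b * a ^ (l + 1) = a ^ l * (b * a) by rewrite expfzDr ?gt_eqF// expr1z; ring.
by rewrite [b * a ^ l]mulrC ler_pM2l// ltr_pM2l.
Qed.

Lemma Rplus_shells b : 0 < b -> (Rplus : set R) = \bigcup_(l in [set: int]) shell b l.
Proof.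
move=> b0; apply/seteqP; split => x.
  rewrite /Rplus /= in_itv/= andbT => x0.
  by exists (Num.floor (ln (x / b) / ln a)) => //; apply/mem_shell.
by move=> [l _ /(mem_shell _ _ b0)[x0 _]]; rewrite /Rplus /= in_itv/= andbT.
Qed.

Lemma measurable_Rplus : measurable (Rplus : set (measurableTypeR R)).
Proof. exact: measurable_itv. Qed.

Lemma shell_Rplus b l : 0 < b -> shell b l `<=` Rplus.
Proof. by move=> b0; rewrite (Rplus_shells b0) => x xl; exists l. Qed.

(** Folding the half line onto one fundamental domain of the dilations. The
base point [b] is free because the transform has to be controlled at almost
every point of the half line and not only on [1, a). *)
Lemma ge0_integral_shells b (g : R -> \bar R) : 0 < b ->
  measurable_fun (Rplus : set (measurableTypeR R)) g ->
  (forall x, Rplus x -> 0 <= g x)%E ->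
  (\int[lebesgue_measure]_(x in Rplus) g x =
   \int[lebesgue_measure]_(x in shell b 0)
      \esum_(l in [set: int]) ((a ^ l)%:E * g (a ^ l * x)%R))%E.
Proof.
move=> b0 mg g0; have [e ebij] := nat_int_bij.
have al k : 0 < a ^ k by exact: exprz_gt0.
have shS l x : shell b 0 x -> shell b l (a ^ l * x) by move/(shell_scale b l).
have m2 l : measurable_fun (shell b 0 : set (measurableTypeR R)) (fun x => g (a ^ l * x)).
  apply: (@measurable_comp _ _ _ (measurableTypeR R) (measurableTypeR R) _ (shell b l) g
    _ (fun x => a ^ l * x)) => //.
  - exact: measurable_shell.
  - by move=> _ [x sx <-]; exact: shS.
  - apply: measurable_funS mg; first exact: measurable_Rplus.
    exact: shell_Rplus.
  - exact: measurable_scale.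
have g02 l x : shell b 0 x -> (0 <= g (a ^ l * x)%R)%E.
  by move=> sx; apply: g0; apply: (shell_Rplus b0 (l := l)); exact: shS.
rewrite integral_esum//; last 3 first.
- exact: measurable_shell.
- by move=> l; apply: emeasurable_funM => //; exact: m2.
- by move=> l x sx; rewrite mule_ge0 ?g02// lee_fin ltW.
have RE : (Rplus : set R) = \bigcup_n shell b (e n).
  rewrite (Rplus_shells b0); apply/seteqP; split => x.
    move=> [l _ xl]; have [n _ en] := (set_bij_sub ebij, set_bij_surj ebij).2 l I.
    by exists n => //; rewrite en.
  by move=> [n _ xn]; exists (e n).
rewrite {1}RE ge0_integral_bigcup//; first last.
- move=> m n _ _ [x [/(mem_shell _ _ b0)[_ xm] /(mem_shell _ _ b0)[_ xn]]].
  by apply: (set_bij_inj ebij); rewrite ?inE// -xm -xn.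
- by rewrite -RE.
- by rewrite -RE.
- by move=> n; exact: measurable_shell.
rewrite (reindex_esum _ _ _ _ ebij) -nneseries_esumT; last first.
  by move=> n; apply: integral_ge0 => x sx; rewrite mule_ge0 ?g02// lee_fin ltW.
apply: eq_eseriesr => n _.
rewrite ge0_integralZl//; last 3 first.
- exact: measurable_shell.
- by move=> x; exact: g02.
- by rewrite lee_fin ltW.
apply: ge0_integral_scale => //; try exact: measurable_shell.
- by move=> x; exact: shell_scale.
- apply: measurable_funS mg; first exact: measurable_Rplus.
  exact: shell_Rplus.
- by move=> x xn; apply: g0; exact: (shell_Rplus b0 xn).
Qed.

End shells.

Section fubini_rectangles.
Context d1 d2 (T1 : measurableType d1) (T2 : measurableType d2) (R : realType).
Context (m1 : {sigma_finite_measure set T1 -> \bar R}).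
Context (m2 : {sigma_finite_measure set T2 -> \bar R}).
Context (A : set T1) (B : set T2) (mA : measurable A) (mB : measurable B).

Let mAB : measurable (A `*` B). Proof. exact: measurableX. Qed.

Let section_patch (f : T1 * T2 -> \bar R) x y :
  (f \_ (A `*` B)) (x, y) = ((fun x => ((fun y => f (x, y)) \_ B) y) \_ A) x.
Proof.
rewrite !patchE in_setX; case: (x \in A) => //=.
Qed.

Lemma ge0_integral_rectangle (f : T1 * T2 -> \bar R) :
  measurable_fun (A `*` B) f -> (forall z, (A `*` B) z -> 0 <= f z)%E ->
  measurable_fun A (fun x => \int[m2]_(y in B) f (x, y))%E /\
  (\int[(m1 \x m2)]_(z in A `*` B) f z = \int[m1]_(x in A) \int[m2]_(y in B) f (x, y))%E.
Proof.
move=> mf f0; pose h := f \_ (A `*` B).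
have mh : measurable_fun setT h by apply/(measurable_restrictT _ mAB).
have h0 z : (0 <= h z)%E.
  by rewrite /h patchE; case: ifPn => // /set_mem; exact: f0.
have FE x : (\int[m2]_y h (x, y))%E = ((fun x => \int[m2]_(y in B) f (x, y))%E \_ A) x.
  rewrite patchE; case: ifPn => xA.
    rewrite [RHS]integral_mkcond; apply: eq_integral => y _.
    by rewrite /h section_patch patchE xA.
  by rewrite integral0_eq// => y _; rewrite /h section_patch patchE (negbTE xA).
split.
  apply/(measurable_restrictT _ mA).
  by rewrite -(funext FE); exact: measurable_fun_fubini_tonelli_F.
rewrite integral_mkcond (fubini_tonelli1 _ mh h0) [RHS]integral_mkcond.
by apply: eq_integral => x _; rewrite -FE.
Qed.

Lemma integral_rectangle (f : T1 * T2 -> R) :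
  (m1 \x m2)%E.-integrable (A `*` B) (EFin \o f) ->
  [/\ {ae m1, forall x, A x -> m2.-integrable B (fun y => (f (x, y))%:E)},
     m1.-integrable A (fun x => (\int[m2]_(y in B) f (x, y))%:E) &
     \int[(m1 \x m2)%E]_(z in A `*` B) f z =
     \int[m1]_(x in A) \int[m2]_(y in B) f (x, y)].
Proof.
move=> iF; pose h := (EFin \o f) \_ (A `*` B).
have ih : (m1 \x m2)%E.-integrable setT h by apply/(integrable_mkcond _ mAB).
have hE x : A x -> (fun y => h (x, y)) = (fun y => (f (x, y))%:E) \_ B.
  by move=> Ax; apply/funext => y; rewrite /h section_patch patchE mem_set.
have FE x : (\int[m2]_y h (x, y))%E = ((fun x => \int[m2]_(y in B) (f (x, y))%:E)%E \_ A) x.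
  rewrite patchE; case: ifPn => xA.
    by rewrite [RHS]integral_mkcond hE//; exact: set_mem.
  by rewrite integral0_eq// => y _; rewrite /h section_patch patchE (negbTE xA).
have iA : m1.-integrable A (fun x => \int[m2]_(y in B) (f (x, y))%:E)%E.
  apply/(integrable_mkcond _ mA); have := integrable_fubini_F ih.
  by apply: eq_integrable => // x _; rewrite -FE.
have aeB : {ae m1, forall x, A x -> m2.-integrable B (fun y => (f (x, y))%:E)}.
  have := ae_integrable1 ih; apply: filterS => x + Ax.
  by rewrite hE// => ?; apply/(integrable_mkcond _ mB).
have iA' : m1.-integrable A (fun x => (\int[m2]_(y in B) f (x, y))%:E).
  have [miA _] := integrableP _ _ _ iA.
  apply: le_integrable iA => //.
    by apply/measurable_EFinP; apply: measurableT_comp.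
  move=> x Ax; rewrite /Rintegral.
  by case: (\int[m2]_(y in B) (f (x, y))%:E)%E => [r| |] //=; rewrite normr0 leey.
split=> //; rewrite /Rintegral; congr fine.
rewrite integral_mkcond -(integral12_prod_meas1 ih).
transitivity (\int[m1]_(x in A) \int[m2]_(y in B) (f (x, y))%:E)%E.
  by rewrite [RHS]integral_mkcond; apply: eq_integral => x _; rewrite -FE.
apply: ae_eq_integral => //.
- exact: measurable_int iA.
- exact: measurable_int iA'.
- by apply: filterS aeB => x + Ax => /(_ Ax) iB; rewrite fineK// integrable_fin_num.
Qed.

Lemma cintegral_rectangle (f : T1 * T2 -> R[i]) :
  cintegrable (m1 \x m2)%E (A `*` B) f ->
  cmeasurable A (fun x => cintegral m2 B (fun y => f (x, y))) /\
  cintegral (m1 \x m2)%E (A `*` B) f =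
  cintegral m1 A (fun x => cintegral m2 B (fun y => f (x, y))).
Proof.
move=> [/integral_rectangle[_ i1 e1] /integral_rectangle[_ i2 e2]]; split.
  by split; apply/measurable_EFinP; [exact: measurable_int i1|exact: measurable_int i2].
by rewrite /cintegral /= e1 e2.
Qed.

End fubini_rectangles.

(** * The transform described by its slices *)

Section theta_basis.
Context {R : realType}.
Local Notation mu := (@lebesgue_measure R).
Implicit Types (n l m : int).

Definition period n : set (measurableTypeR R) := `[n%:~R, (n + 1)%:~R[%classic.

Definition theta_exp l (xi : R) : R[i] := cis (- (2 * pi * l%:~R * xi)).

Lemma measurable_period n : measurable (period n).
Proof. exact: measurable_itv. Qed.

Lemma periodE n : period n = `[n%:~R, n%:~R + 1[%classic.
Proof. by rewrite /period intrD. Qed.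

(** The minus sign in the transform reverses the indices of the Fourier
basis. *)
Lemma theta_expE l : theta_exp l = fourier 1 (- l).
Proof.
apply/funext => x; rewrite /theta_exp /fourier sqrtr1 invr1 mul1r.
by congr cis; rewrite mulrNz mulr1 !(mulrN, mulNr).
Qed.

Lemma theta_expD l m xi : theta_exp (l + m) xi = theta_exp l xi * theta_exp m xi.
Proof. by rewrite /theta_exp -cisD; congr cis; rewrite intrD; ring. Qed.

Lemma theta_expJ l xi : (theta_exp l xi)^* = theta_exp (- l) xi.
Proof. by rewrite /theta_exp -cisN mulrNz; congr cis; ring. Qed.

Lemma normc2_theta_exp l xi : normc (theta_exp l xi) ^+ 2 = 1.
Proof. exact: normc2_cis. Qed.

Lemma memL2_theta_exp n l : memL2 mu (period n) (theta_exp l).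
Proof. by rewrite periodE theta_expE; exact: memL2_fourier ltr01 _. Qed.

Lemma theta_exp_orthonormal n l m :
  cinner mu (period n) (theta_exp l) (theta_exp m) = (l == m)%:R.
Proof.
by rewrite periodE !theta_expE (fourier_orthonormal _ ltr01) eqr_opp.
Qed.

Lemma theta_exp_parseval n (f : R -> R[i]) : memL2 mu (period n) f ->
  (\esum_(l in [set: int]) (normc (cinner mu (period n) f (theta_exp l)) ^+ 2)%:E =
   L2normsq mu (period n) f)%E.
Proof.
rewrite periodE => f2; rewrite -(fourier_parseval ltr01 f2).
rewrite [RHS](reindex_esum [set: int] [set: int] -%R); last by split.
by apply: eq_esum => l _; rewrite theta_expE.
Qed.

End theta_basis.

Section theta.
Context {R : realType}.
Variable a : R.
Hypothesis a1 : 1 < a.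
Local Notation T1 := (measurableTypeR R).
Local Notation T2 := (measurableTypeR R * measurableTypeR R)%type.
Local Notation mu := (@lebesgue_measure R).
Local Notation mu2 := (@lebesgue_measure2 R).
Local Notation U := (@period R 0).
Local Notation base := (`[1, a[%classic : set T1).
Local Notation dom := (Theta_dom a : set T2).
Implicit Types (f g : R -> R[i]) (F G : R * R -> R[i]) (l m j : int).

Let a0 : 0 < a. Proof. exact: lt_trans a1. Qed.

Lemma measurable_base : measurable base. Proof. exact: measurable_itv. Qed.
Let mU : measurable U := measurable_period 0.

Lemma Theta_domE : Theta_dom a = base `*` U.
Proof. by rewrite /Theta_dom /period add0r. Qed.

Lemma measurable_Theta_dom : measurable dom.
Proof. by rewrite Theta_domE; apply: measurableX; [exact: measurable_base|exact: mU]. Qed.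

Lemma shell_base : shell a 1 0 = base.
Proof. by rewrite /shell expr0z mulr1 add0r expr1z mul1r. Qed.

Lemma base_Rplus : base `<=` Rplus.
Proof. by rewrite -shell_base; exact: shell_Rplus. Qed.

Definition theta_coef f l (x : R) : R[i] := (a `^ (l%:~R / 2))%:C * f (a ^ l * x).

Lemma normc2_theta_coef f l x :
  normc (theta_coef f l x) ^+ 2 = a ^ l * normc (f (a ^ l * x)) ^+ 2.
Proof.
rewrite normcM2 normc_real ?powR_ge0//; congr (_ * _).
by rewrite -powR_mulrn ?powR_ge0// -powRrM divfK// powR_intmul// ltW.
Qed.

Lemma cmeasurable_scale f l (E : set T1) : measurable E -> E `<=` Rplus ->
  cmeasurable (Rplus : set T1) f -> cmeasurable E (fun x => f (a ^ l * x)).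
Proof.
move=> mE ER [f1 f2]; have al : 0 < a ^ l by exact: exprz_gt0.
have sub : (fun x => a ^ l * x) @` E `<=` Rplus.
  by move=> _ [x /ER + <-]; rewrite /Rplus/= !in_itv/= !andbT => x0; rewrite mulr_gt0.
split.
  apply: (@measurable_comp _ _ _ T1 T1 _ Rplus (fun y => Re (f y)) _ (fun x => a ^ l * x)) => //.
    exact: measurable_Rplus.
  exact: measurable_scale.
apply: (@measurable_comp _ _ _ T1 T1 _ Rplus (fun y => Im (f y)) _ (fun x => a ^ l * x)) => //.
  exact: measurable_Rplus.
exact: measurable_scale.
Qed.

Lemma cmeasurable_theta_coef f l (E : set T1) : measurable E -> E `<=` Rplus ->
  cmeasurable (Rplus : set T1) f -> cmeasurable E (theta_coef f l).
Proof.
move=> mE ER mf; apply: cmeasurableM; first exact: cmeasurable_cst.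
exact: cmeasurable_scale.
Qed.

Lemma L2normsq_shells f b : 0 < b -> cmeasurable (Rplus : set T1) f ->
  (L2normsq mu Rplus f = \int[mu]_(x in shell a b 0)
     \esum_(l in [set: int]) (normc (theta_coef f l x) ^+ 2)%:E)%E.
Proof.
move=> b0 mf; rewrite /L2normsq (@ge0_integral_shells _ _ a1 b)//.
- by apply: eq_integral => x _; apply: eq_esum => l _; rewrite -EFinM normc2_theta_coef.
- exact: emeasurable_normc2.
- by move=> x _; rewrite lee_fin sqr_ge0.
Qed.

(** The form in which the transform is used: on the fundamental domain, a
slice is determined by its Fourier coefficients. All properties of the transform
below are read off from this characterization, which is linear in [(f, F)] and
involves no convergence. *)
Definition Theta_slices f F : Prop := cmeasurable dom F /\
  {ae mu, forall x, base x -> memL2 mu U (fun xi => F (x, xi)) /\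
    forall l, cinner mu U (fun xi => F (x, xi)) (theta_exp l) = theta_coef f l x}.

Lemma L2normsq_rectangle F : cmeasurable dom F ->
  (L2normsq mu2 dom F = \int[mu]_(x in base) L2normsq mu U (fun xi => F (x, xi)))%E.
Proof.
move=> mF; rewrite /L2normsq Theta_domE in mF *.
apply: (ge0_integral_rectangle mu mu measurable_base mU _ _).2.
  exact: emeasurable_normc2.
by move=> z _; rewrite lee_fin sqr_ge0.
Qed.

Lemma measurable_L2normsq_slices F : cmeasurable dom F ->
  measurable_fun base (fun x => L2normsq mu U (fun xi => F (x, xi))).
Proof.
rewrite Theta_domE => mF.
apply: (ge0_integral_rectangle mu mu measurable_base mU
  (f := fun z => (normc (F z) ^+ 2)%:E) _ _).1.
  exact: emeasurable_normc2.
by move=> z _; rewrite lee_fin sqr_ge0.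
Qed.

(** Parseval on every slice, then folding the half line onto [1, a). *)
Lemma Theta_isometry f F : cmeasurable (Rplus : set T1) f -> Theta_slices f F ->
  L2normsq mu2 dom F = L2normsq mu Rplus f.
Proof.
move=> mf [mF FE]; rewrite L2normsq_rectangle// (L2normsq_shells ltr01 mf) shell_base.
apply: ae_eq_integral.
- exact: measurable_base.
- exact: measurable_L2normsq_slices.
- apply: measurable_fun_esum.
  + by move=> l; apply: emeasurable_normc2; exact: cmeasurable_theta_coef measurable_base base_Rplus mf.
  + by move=> l x _; rewrite lee_fin sqr_ge0.
- apply: filterS FE => x + bx => /(_ bx)[F2 FE].
  by rewrite -theta_exp_parseval//; apply: eq_esum => l _; rewrite FE.
Qed.

Lemma Theta_memL2 f F : L2Rplus f -> Theta_slices f F -> memL2 mu2 dom F.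
Proof. by move=> [mf f2] fF; split; [exact: fF.1|rewrite (Theta_isometry mf fF)]. Qed.

Lemma Theta_slices_memL2 f F : memL2 mu2 dom F -> cmeasurable (Rplus : set T1) f ->
  Theta_slices f F -> L2Rplus f.
Proof. by move=> [_ F2] mf fF; split=> //; rewrite -(Theta_isometry mf fF). Qed.

Lemma Theta_slicesD f g F G : Theta_slices f F -> Theta_slices g G ->
  Theta_slices (fun x => f x + g x) (fun z => F z + G z).
Proof.
move=> [mF FE] [mG GE]; split; first exact: cmeasurableD.
apply: filterS2 FE GE => x + + bx => /(_ bx)[F2 FE] /(_ bx)[G2 GE]; split; first exact: memL2D.
move=> l; rewrite cinnerDl ?FE ?GE ?/theta_coef ?mulrDr//.
exact: memL2_theta_exp.
Qed.

Lemma Theta_slicesZ c f F : Theta_slices f F -> Theta_slices (fun x => c * f x) (fun z => c * F z).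
Proof.
move=> [mF FE]; split; first by apply: cmeasurableM => //; exact: cmeasurable_cst.
apply: filterS FE => x + bx => /(_ bx)[F2 FE]; split; first exact: memL2Z.
move=> l; rewrite cinnerZl ?FE ?/theta_coef 1?mulrCA//.
exact: memL2_theta_exp.
Qed.

Lemma Theta_slicesB f g F G : Theta_slices f F -> Theta_slices g G ->
  Theta_slices (fun x => f x - g x) (fun z => F z - G z).
Proof.
move=> fF gG; have := Theta_slicesD fF (Theta_slicesZ (-1) gG).
by under eq_fun do rewrite mulN1r; under [X in Theta_slices _ X]eq_fun do rewrite mulN1r.
Qed.

Lemma Theta_slices0 : Theta_slices (fun=> 0) (fun=> 0).
Proof.
split; first exact: cmeasurable_cst.
apply: nearW => x _; split; first exact: memL20.
move=> l; rewrite /theta_coef mulr0 /cinner.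
by under [X in cintegral _ _ X]eq_fun do rewrite mul0r; exact: cintegral0.
Qed.

Lemma Theta_slices_sum I (r : seq I) (f : I -> R -> R[i]) (F : I -> R * R -> R[i]) :
  (forall i, Theta_slices (f i) (F i)) ->
  Theta_slices (fun x => \sum_(i <- r) f i x) (fun z => \sum_(i <- r) F i z).
Proof.
move=> fF; elim: r => [|i r IH].
  by under eq_fun do rewrite big_nil; under [X in Theta_slices _ X]eq_fun do rewrite big_nil;
    exact: Theta_slices0.
by under eq_fun do rewrite big_cons; under [X in Theta_slices _ X]eq_fun do rewrite big_cons;
  exact: Theta_slicesD.
Qed.

(** By polarization of [Theta_isometry]. *)
Lemma Theta_inner f g F G : L2Rplus f -> L2Rplus g -> Theta_slices f F -> Theta_slices g G ->
  inner f g = cinner mu2 dom F G.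
Proof.
move=> f2 g2 fF gG; have F2 := Theta_memL2 f2 fF; have G2 := Theta_memL2 g2 gG.
have ReE h H : L2Rplus h -> Theta_slices h H -> Re (inner f h) = Re (cinner mu2 dom F H).
  move=> h2 hH; have H2 := Theta_memL2 h2 hH.
  rewrite (ReinnerD measurable_Rplus f2 h2) (ReinnerD measurable_Theta_dom F2 H2).
  rewrite (Theta_isometry f2.1 fF) (Theta_isometry h2.1 hH).
  by rewrite (Theta_isometry (cmeasurableD f2.1 h2.1) (Theta_slicesD fF hH)).
apply: complexP; first exact: ReE.
rewrite (Iminner measurable_Rplus f2 g2) (Iminner measurable_Theta_dom F2 G2).
by apply: ReE; [exact: (memL2Z measurable_Rplus 'i g2)|exact: Theta_slicesZ].
Qed.

(** The isometry applied to [f - g]. *)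
Lemma Theta_slices_unique f g F G : cmeasurable (Rplus : set T1) f ->
  cmeasurable (Rplus : set T1) g -> Theta_slices f F -> Theta_slices g G ->
  ae_eq mu2 dom F G <-> ae_eq mu Rplus f g.
Proof.
move=> mf mg fF gG; have isoB := Theta_isometry (cmeasurableB mf mg) (Theta_slicesB fF gG).
split=> [FG|fg].
  apply: (L2normsqB0 measurable_Rplus) => //; rewrite -isoB.
  rewrite (ae_eq_L2normsq (f := fun z => F z - G z) (g := fun=> 0) measurable_Theta_dom).
  - by rewrite /L2normsq; under eq_integral do rewrite ComplexField.Normc.normc0 expr0n/=; rewrite integral0.
  - exact: cmeasurableB fF.1 gG.1.
  - exact: cmeasurable_cst.
  - by apply: filterS FG => z + Dz => /(_ Dz) ->; rewrite subrr.
apply: (L2normsqB0 measurable_Theta_dom); [exact: fF.1|exact: gG.1|rewrite isoB].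
rewrite (ae_eq_L2normsq (f := fun z => f z - g z) (g := fun=> 0) measurable_Rplus).
- by rewrite /L2normsq; under eq_integral do rewrite ComplexField.Normc.normc0 expr0n/=; rewrite integral0.
- exact: cmeasurableB.
- exact: cmeasurable_cst.
- by apply: filterS fg => z + Dz => /(_ Dz) ->; rewrite subrr.
Qed.

End theta.

(** * Existence and surjectivity of the transform *)

Section theta_modulation.
Context {R : realType}.
Variable a : R.
Hypothesis a1 : 1 < a.
Local Notation T1 := (measurableTypeR R).
Local Notation T2 := (measurableTypeR R * measurableTypeR R)%type.
Local Notation mu := (@lebesgue_measure R).
Local Notation mu2 := (@lebesgue_measure2 R).
Local Notation U := (@period R 0).
Local Notation base := (`[1, a[%classic : set T1).
Local Notation dom := (Theta_dom a : set T2).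
Implicit Types (f g : R -> R[i]) (F G : R * R -> R[i]) (l m j : int).

Let a0 : 0 < a. Proof. exact: lt_trans a1. Qed.
Let mU : measurable U := measurable_period 0.

Lemma dilation_rep_base l x : base x -> dilation_rep a (a ^ l * x) = x.
Proof.
move=> bx; rewrite /dilation_rep.
have : shell a 1 l (a ^ l * x) by apply/(shell_scale a1); rewrite shell_base.
move=> /(mem_shell a1 _ _ ltr01)[_]; rewrite divr1 => ->.
by rewrite mulrA -expfzDr ?gt_eqF// addNr expr0z mul1r.
Qed.

(** Modulations are constant along the orbits of the dilation, and on [1, a)
they are the Fourier basis. *)
Lemma Lambda_orbit m l x : base x -> Lambda a m (a ^ l * x) = fourier (a - 1) m x.
Proof. by move=> bx; rewrite /Lambda dilation_rep_base. Qed.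

Lemma cmeasurable_shells f :
  (forall l, cmeasurable (shell a 1 l : set T1) f) -> cmeasurable (Rplus : set T1) f.
Proof.
move=> shl; have [e ebij] := nat_int_bij.
have RE : (Rplus : set R) = \bigcup_n shell a 1 (e n).
  rewrite (Rplus_shells a1 ltr01); apply/seteqP; split => x.
    move=> [l _ xl]; have [n _ en] := (set_bij_surj ebij) l I.
    by exists n => //; rewrite en.
  by move=> [n _ xn]; exists (e n).
rewrite RE; split; apply/measurable_fun_bigcup => n.
- exact: measurable_shell.
- exact: (shl (e n)).1.
- exact: measurable_shell.
- exact: (shl (e n)).2.
Qed.

Lemma cmeasurable_Lambda m : cmeasurable (Rplus : set T1) (Lambda a m).
Proof.
apply: cmeasurable_shells => l.
apply: (@eq_cmeasurable _ _ _ _ (fun x => fourier (a - 1) m (a ^ (- l) * x))).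
  move=> x /set_mem /(mem_shell a1 _ _ ltr01)[_].
  by rewrite divr1 /Lambda /dilation_rep => ->.
apply: cmeasurableM; first exact: cmeasurable_cst.
by apply: cmeasurable_cis; apply: measurable_funM => //; apply: measurable_funM.
Qed.

Lemma cmeasurable_MD (L : nat) (psi : 'I_L -> R -> R[i]) i mj :
  cmeasurable (Rplus : set T1) (psi i) -> cmeasurable (Rplus : set T1) (MD a psi (i, mj)).
Proof.
case: mj => m j mpsi; apply: cmeasurableM; first exact: cmeasurable_Lambda.
apply: cmeasurableM; first exact: cmeasurable_cst.
by apply: cmeasurable_scale => //; exact: measurable_Rplus.
Qed.

(** The orthonormal exponentials of the fundamental domain; the sign makes up
for the minus sign in [theta_exp]. *)
Definition MD_symbol (mj : int * int) (z : R * R) : R[i] :=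
  fourier (a - 1) mj.1 z.1 * theta_exp (- mj.2) z.2.

Lemma cmeasurable_MD_symbol mj (E : set T2) : cmeasurable E (MD_symbol mj).
Proof.
have mE : measurable_fun E (@fst T1 T1) by exact: measurable_funTS measurable_fst.
have mE2 : measurable_fun E (@snd T1 T1) by exact: measurable_funTS measurable_snd.
apply: cmeasurableM.
  apply: cmeasurableM; first exact: cmeasurable_cst.
  by apply: cmeasurable_cis; do 2 apply: measurable_funM => //.
apply: cmeasurable_cis; apply: measurableT_comp => //.
exact: measurable_funM.
Qed.

Lemma normc2_MD_symbol mj z : normc (MD_symbol mj z) ^+ 2 = (a - 1)^-1.
Proof. by rewrite normcM2 normc2_fourier ?subr_gt0// normc2_theta_exp mulr1. Qed.

Lemma theta_coef_MD (L : nat) (psi : 'I_L -> R -> R[i]) i m j l x : base x ->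
  theta_coef a (MD a psi (i, (m, j))) l x =
  fourier (a - 1) m x * theta_coef a (psi i) (l + j) x.
Proof.
move=> bx; rewrite /theta_coef /MD /dilate Lambda_orbit// mulrCA; congr (_ * _).
have -> : a ^ (l + j) * x = a ^ j * (a ^ l * x).
  by rewrite mulrA -expfzDr ?gt_eqF// addrC.
have -> : a `^ ((l + j)%:~R / 2) = a `^ (l%:~R / 2) * Num.sqrt (a ^ j).
  rewrite -powR12_sqrt ?exprz_ge0 ?ltW// -powR_intmul ?ltW// -powRrM -powRD.
    by rewrite intrD mulrDl.
  by apply/implyP => _; rewrite gt_eqF.
by rewrite (rmorphM (real_complex R)) [LHS]mulrA.
Qed.

(** Multiplying a slice by [theta_exp (- j)] shifts its Fourier coefficients
by [j], which is the effect of a dilation by [a ^ j]. *)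
Lemma Theta_slices_MD (L : nat) (psi : 'I_L -> R -> R[i]) i mj F :
  Theta_slices a (psi i) F ->
  Theta_slices a (MD a psi (i, mj)) (fun z => MD_symbol mj z * F z).
Proof.
case: mj => m j [mF FE]; split.
  by apply: cmeasurableM => //; exact: cmeasurable_MD_symbol.
apply: filterS FE => x + bx => /(_ bx)[F2 FE].
have E : (fun xi => MD_symbol (m, j) (x, xi) * F (x, xi)) =
         (fun xi => fourier (a - 1) m x * (theta_exp (- j) xi * F (x, xi))).
  by apply/funext => xi; rewrite /MD_symbol/= mulrA.
have eF2 : memL2 mu U (fun xi => theta_exp (- j) xi * F (x, xi)).
  apply: (@memL2M_bounded _ _ _ mu U mU 1) => //; first exact: (memL2_theta_exp 0 _).1.
  by apply: nearW => xi _; rewrite normc2_theta_exp.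
rewrite E; split; first exact: memL2Z.
move=> l; rewrite cinnerZl//; last exact: memL2_theta_exp.
rewrite theta_coef_MD//; congr (_ * _); rewrite -FE.
apply: eq_cintegral => xi _; rewrite !theta_expJ opprD theta_expD.
by rewrite [theta_exp (- j) xi * _]mulrC -mulrA [theta_exp (- j) xi * _]mulrC.
Qed.

Lemma section_cmeasurable (A B : set T1) F x : measurable A -> measurable B -> A x ->
  @cmeasurable _ T2 R (A `*` B) F -> cmeasurable B (fun xi => F (x, xi)).
Proof.
move=> mA mB Ax [F1 F2]; have mAB : measurable (A `*` B : set T2) by exact: measurableX.
have sub : [set (x, y) | y in B] `<=` A `*` B by move=> _ [y By <-].
have mp : measurable_fun B (fun y : T1 => (x, y) : T2).
  by apply: measurable_funTS; exact: pair1_measurable.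
split.
  exact: (@measurable_comp _ _ _ T1 T2 _ (A `*` B) (fun z => Re (F z)) B (fun y => (x, y)) mAB sub F1 mp).
exact: (@measurable_comp _ _ _ T1 T2 _ (A `*` B) (fun z => Im (F z)) B (fun y => (x, y)) mAB sub F2 mp).
Qed.

(** A function that is the sum of an orthonormal series has the terms of the
series as its coefficients. *)
Lemma is_Theta_slices f F : is_Theta a f F -> Theta_slices a f F.
Proof.
move=> [mF FE]; have mF' : @cmeasurable _ T2 R (Rplus `*` setT) F by exact: mF.
split.
  rewrite Theta_domE; apply: cmeasurableS mF'; first exact: measurableX measurable_Rplus _.
  by move=> z [/(base_Rplus a1)].
apply: filterS FE => x + bx; have xR := base_Rplus a1 bx.
move=> /(_ xR 0) FE.
have mFx : cmeasurable U (fun xi => F (x, xi)).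
  apply: cmeasurableS (section_cmeasurable measurable_Rplus measurableT xR mF') => //.
by have [] := L2sum_to_coef mU (memL2_theta_exp 0) (theta_exp_orthonormal 0) mFx FE.
Qed.

Lemma memL2_bounded_finite d (T : measurableType d) (nu : {measure set T -> \bar R})
    (D : set T) (M : R) (b : T -> R[i]) : measurable D -> (nu D < +oo)%E ->
  cmeasurable D b -> {ae nu, forall x, D x -> normc (b x) ^+ 2 <= M} -> memL2 nu D b.
Proof.
move=> mD nuD mb bM; have m1 : memL2 nu D (fun=> 1).
  split; first exact: cmeasurable_cst.
  rewrite /L2normsq; under eq_integral do rewrite ComplexField.Normc.normc1 expr1n.
  by rewrite integral_cst// mul1e.
have := memL2M_bounded mD mb bM m1.
by under [X in memL2 _ _ X]eq_fun do rewrite mulr1.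
Qed.

Lemma mu2_dom : (mu2 dom < +oo)%E.
Proof.
have -> : mu2 dom = (mu base * mu U)%E.
  by rewrite Theta_domE; exact: (product_measure1E _ _ (measurable_base a) mU).
rewrite [X in (X * _)%E](_ : _ = (a - 1)%:E); last first.
  by rewrite lebesgue_measure_itv/= lte_fin a1.
by rewrite /period [X in (_ * X)%E]lebesgue_measure_itv/= lte_fin ltr_int ltrDl ltr01 -EFinB -EFinM ltry.
Qed.

Lemma memL2_slice_symbol l : memL2 mu2 dom (fun z => theta_exp l z.2).
Proof.
apply: (memL2_bounded_finite (M := 1)).
- exact: measurable_Theta_dom.
- exact: mu2_dom.
- apply: cmeasurable_cis; apply: measurableT_comp => //.
  by apply: measurable_funM => //; exact: measurable_funTS measurable_snd.
- by apply: nearW => z _; rewrite normc2_theta_exp.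
Qed.

Lemma ae_memL2_slices F : memL2 mu2 dom F ->
  {ae mu, forall x, base x -> memL2 mu U (fun xi => F (x, xi))}.
Proof.
move=> [mF F2]; have mF' := mF; rewrite L2normsq_rectangle// in F2.
have mN := measurable_L2normsq_slices mF.
have : {ae mu, forall x, base x -> L2normsq mu U (fun xi => F (x, xi)) \is a fin_num}.
  apply: integrable_ae; first exact: measurable_base.
  apply/integrableP; split=> //.
  by under eq_integral do rewrite gee0_abs ?L2normsq_ge0//.
apply: filterS => x + bx => /(_ bx); rewrite ge0_fin_numE ?L2normsq_ge0// => Fx; split=> //.
by rewrite Theta_domE in mF; exact: section_cmeasurable (measurable_base a) mU bx mF.
Qed.

Lemma cmeasurable_slice_coef F l : memL2 mu2 dom F ->
  cmeasurable base (fun x => cinner mu U (fun xi => F (x, xi)) (theta_exp l)).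
Proof.
move=> F2; have := memL2_mulJ (measurable_Theta_dom a) F2 (memL2_slice_symbol l).
by rewrite Theta_domE => /(cintegral_rectangle (measurable_base a) mU)[].
Qed.

End theta_modulation.
Section theta_surjective.
Context {R : realType}.
Variable a : R.
Hypothesis a1 : 1 < a.
Local Notation T1 := (measurableTypeR R).
Local Notation T2 := (measurableTypeR R * measurableTypeR R)%type.
Local Notation mu := (@lebesgue_measure R).
Local Notation mu2 := (@lebesgue_measure2 R).
Local Notation U := (@period R 0).
Local Notation base := (`[1, a[%classic : set T1).
Local Notation dom := (Theta_dom a : set T2).

Let a0 : 0 < a. Proof. exact: lt_trans a1. Qed.
Let mU : measurable U := measurable_period 0.

(** The inverse transform: on the shell [a^k, a^(k+1)) the function is read
off from the Fourier coefficients of index [k] of the slices. *)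
Definition Theta_inv (F : R * R -> R[i]) (x : R) : R[i] :=
  let k := Num.floor (ln x / ln a) in
  (a `^ (- (k%:~R / 2)))%:C *
  cinner mu U (fun xi => F (a ^ (- k) * x, xi)) (theta_exp k).

Lemma Theta_inv_coef F l x : base x ->
  theta_coef a (Theta_inv F) l x = cinner mu U (fun xi => F (x, xi)) (theta_exp l).
Proof.
move=> bx; rewrite /theta_coef /Theta_inv.
have : shell a 1 l (a ^ l * x) by apply/(shell_scale a1); rewrite shell_base.
move=> /(mem_shell a1 _ _ ltr01)[_]; rewrite divr1 => ->.
have -> : a ^ (- l) * (a ^ l * x) = x.
  by rewrite mulrA -expfzDr ?gt_eqF// addNr expr0z mul1r.
rewrite mulrA -(rmorphM (real_complex R)) -powRD; last by rewrite subrr eqxx gt_eqF.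
by rewrite subrr powRr0 mul1r.
Qed.

Lemma cmeasurable_Theta_inv F : memL2 mu2 dom F ->
  cmeasurable (Rplus : set T1) (Theta_inv F).
Proof.
move=> F2; apply: (cmeasurable_shells a1) => l.
apply: (@eq_cmeasurable _ _ _ _ (fun x => (a `^ (- (l%:~R / 2)))%:C *
  (fun y => cinner mu U (fun xi => F (y, xi)) (theta_exp l)) (a ^ (- l) * x))).
  move=> x /set_mem /(mem_shell a1 _ _ ltr01)[_].
  by rewrite divr1 /Theta_inv => ->.
apply: cmeasurableM; first exact: cmeasurable_cst.
have [G1 G2] := cmeasurable_slice_coef a1 l F2.
have sub : (fun x => a ^ (- l) * x) @` (shell a 1 l) `<=` base.
  move=> _ [x xl <-]; rewrite -(shell_base a); apply/(shell_scale a1 _ l).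
  by rewrite mulrA -expfzDr ?gt_eqF// subrr expr0z mul1r.
split.
  apply: (@measurable_comp _ _ _ T1 T1 _ base _ _ (fun x => a ^ (- l) * x) _ sub G1).
    exact: measurable_base.
  exact: measurable_scale.
apply: (@measurable_comp _ _ _ T1 T1 _ base _ _ (fun x => a ^ (- l) * x) _ sub G2).
  exact: measurable_base.
exact: measurable_scale.
Qed.

Lemma Theta_slices_surjective F : memL2 mu2 dom F ->
  exists2 f, L2Rplus f & Theta_slices a f F.
Proof.
move=> F2; have mf := cmeasurable_Theta_inv F2.
have fF : Theta_slices a (Theta_inv F) F.
  split; first exact: F2.1.
  apply: filterS (ae_memL2_slices F2) => x + bx => /(_ bx) Fx.
  by split=> // l; rewrite Theta_inv_coef.
by exists (Theta_inv F) => //; exact: Theta_slices_memL2 F2 mf fF.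
Qed.

End theta_surjective.

Section theta_exists.
Context {R : realType}.
Variable a : R.
Hypothesis a1 : 1 < a.
Local Notation T1 := (measurableTypeR R).
Local Notation T2 := (measurableTypeR R * measurableTypeR R)%type.
Local Notation mu := (@lebesgue_measure R).

Let a0 : 0 < a. Proof. exact: lt_trans a1. Qed.

(** The half line is covered by countably many fundamental domains
[a^k, a^(k+1)), and on each of them the energy of [f] is the integral of the
sum of the squared coefficients. *)
Lemma ae_theta_coef_summable f : L2Rplus f -> {ae mu, forall x, Rplus x ->
  \esum_(l in [set: int]) (normc (theta_coef a f l x) ^+ 2)%:E \is a fin_num}.
Proof.
move=> [mf f2]; have [e ebij] := nat_int_bij.
have shl n : {ae mu, forall x, shell a (a ^ (e n)) 0 x ->
    \esum_(l in [set: int]) (normc (theta_coef a f l x) ^+ 2)%:E \is a fin_num}.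
  have b0 : 0 < a ^ (e n) by exact: exprz_gt0.
  apply: integrable_ae; first exact: measurable_shell.
  have ms := measurable_shell a (a ^ e n) 0.
  have sub : shell a (a ^ e n) 0 `<=` Rplus by exact: shell_Rplus.
  apply/integrableP; split.
    apply: measurable_fun_esum.
      by move=> l; apply: emeasurable_normc2; exact: cmeasurable_theta_coef.
    by move=> l x _; rewrite lee_fin sqr_ge0.
  rewrite (eq_integral (fun x : T1 => \esum_(l in [set: int]) (normc (theta_coef a f l x) ^+ 2)%:E)%E).
    by rewrite -(L2normsq_shells a1 b0 mf).
  by move=> x _; rewrite gee0_abs// esum_ge0// => l _; rewrite lee_fin sqr_ge0.
apply: filterS (ae_foralln shl) => x Hx xR.
have [n _ en] := (set_bij_surj ebij) (Num.floor (ln x / ln a)) I.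
apply: (Hx n); rewrite en.
have x0 : 0 < x by move: xR; rewrite /Rplus/= in_itv/= andbT.
have : shell a 1 (Num.floor (ln x / ln a)) x.
  by apply/(mem_shell a1 _ _ ltr01); rewrite divr1.
by rewrite /shell /= !in_itv/= !mul1r expr0z mulr1 add0r expr1z expfzDr ?gt_eqF// expr1z.
Qed.

Lemma clim_eventually d (T : measurableType d) (F : nat -> T -> R[i]) (n : nat) x v :
  (forall N, (n <= N)%N -> F N x = v) -> clim F x = v.
Proof.
move=> Fv; have cst_esup (h : nat -> R) r : (forall N, (n <= N)%N -> h N = r) ->
    limn_esup (fun N => (h N)%:E) = r%:E.
  move=> hr; apply: (cvg_limn_einf_sup _).2; apply: cvg_near_cst.
  by exists n => // N /= nN; rewrite hr.
by rewrite /clim (cst_esup _ (Re v)) ?(cst_esup _ (Im v))/=; [case: (v)|move=> N /Fv ->..].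
Qed.

Section initial_segments.
Variable e : nat -> int.
Hypothesis einj : injective e.

Definition segment n : {fset int} := iteri n (fun i s => e i |` s)%fset fset0.

Let mem_segment n i : (e i \in segment n) = (i < n)%N.
Proof.
elim: n => [|n IH]; first by rewrite /segment/= inE.
by rewrite /segment/= in_fset1U -/(segment n) IH (inj_eq einj) ltnS [RHS]leq_eqVlt.
Qed.

Lemma sum_segment (V : nmodType) (F : int -> V) n :
  \sum_(l <- segment n) F l = \sum_(i < n) F (e i).
Proof.
elim: n => [|n IH]; first by rewrite big_ord0 /segment/= big_nil.
by rewrite big_ord_recr/= -IH addrC /segment/= big_fsetU1//= mem_segment ltnn.
Qed.

Lemma segmentS m n : (m <= n)%N -> (segment m `<=` segment n)%fset.
Proof.
elim: n => [|n IH]; first by rewrite leqn0 => /eqP ->; exact: fsubset_refl.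
rewrite leq_eqVlt => /predU1P[->|]; first exact: fsubset_refl.
by rewrite ltnS => /IH mn; apply: fsubset_trans mn _; exact: fsubsetU1.
Qed.

End initial_segments.

(** The partial sums of the Fourier series of a slice converge only in L^2,
at a speed that depends on the slice, so they need not converge pointwise. The
series is therefore cut off at indices that depend measurably on the slice and
that make the convergence geometric; then [riesz_fischer] applies to every slice
with the same jointly measurable limit. *)
Lemma is_Theta_exists f : L2Rplus f -> exists F, is_Theta a f F.
Proof.
move=> f2; have [e ebij] := nat_int_bij.
have einj : injective e by move=> i j; apply: (set_bij_inj ebij); rewrite inE.
pose c i x := theta_coef a f (e i) x.
have mc i : cmeasurable (Rplus : set T1) (c i).
  by apply: cmeasurable_theta_coef => //; [exact: measurable_Rplus|exact: f2.1].
pose P N x := \sum_(i < N) normc (c i x) ^+ 2.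
have mP N : measurable_fun (Rplus : set T1) (P N).
  rewrite /P; elim: N => [|N IH].
    by under eq_fun do rewrite big_ord0; exact: measurable_cst.
  under eq_fun do rewrite big_ord_recr/=.
  by apply: measurable_funD => //; exact: measurable_normc2.
pose t x := fine (\esum_(l in [set: int]) (normc (theta_coef a f l x) ^+ 2)%:E)%E.
have mt : measurable_fun (Rplus : set T1) t.
  apply: measurableT_comp => //; apply: measurable_fun_esum.
    move=> l; apply: emeasurable_normc2.
    by apply: cmeasurable_theta_coef => //; [exact: measurable_Rplus|exact: f2.1].
  by move=> l x _; rewrite lee_fin sqr_ge0.
(* The indices below the first one at which the tail of the coefficient
   sequence is at most 8^-k; truncating there makes the partial sums of every
   slice converge geometrically, at a rate that is the same for all slices. *)
pose b k N x := 2^-1 ^+ (3 * k) < t x - P N x.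
pose mask k N x : R := if b k N x then 1 else 0.
have mmask k N : measurable_fun (Rplus : set T1) (mask k N).
  apply: measurable_fun_if => //; first exact: measurable_Rplus.
  by apply: measurable_fun_ltr => //; exact: measurable_funB.
pose G k N (z : T2) := \sum_(i < N) ((mask k i z.1)%:C * c i z.1) * theta_exp (e i) z.2.
pose F := clim (fun k => clim (fun N => G k N)).
pose D : set T2 := Rplus `*` setT.
have mD : measurable D by exact: measurableX measurable_Rplus _.
have comp1 (h : T1 -> R) : measurable_fun (Rplus : set T1) h -> measurable_fun D (h \o fst).
  move=> mh; apply: (@measurable_comp _ _ _ T2 T1 _ Rplus) => //.
  - exact: measurable_Rplus.
  - by move=> _ [z [z1 _] <-].
  - exact: measurable_funTS measurable_fst.
have mG k N : cmeasurable D (G k N).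
  apply: cmeasurable_sum => i; apply: cmeasurableM; first apply: cmeasurableM.
  - by apply: cmeasurable_real; exact: (comp1 (mask k i)).
  - by split; [exact: (comp1 (fun x => Re (c i x)) (mc i).1)|exact: (comp1 (fun x => Im (c i x)) (mc i).2)].
  - apply: cmeasurable_cis; apply: measurableT_comp => //.
    by apply: measurable_funM => //; exact: measurable_funTS measurable_snd.
have mF : cmeasurable D F by apply: cmeasurable_clim => k; exact: cmeasurable_clim.
exists F; split; first exact: mF.
apply: filterS (ae_theta_coef_summable f2) => x + xR n => /(_ xR) tfin.
have tE : (\esum_(l in [set: int]) (normc (theta_coef a f l x) ^+ 2)%:E = (t x)%:E)%E.
  by rewrite fineK.
have cvP : (fun N => P N x) @ \oo --> t x.
  have cv : (fun N => (P N x)%:E) @ \oo --> (t x)%:E.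
    rewrite -tE (reindex_esum _ _ _ _ ebij) -nneseries_esumT; last first.
      by move=> i; rewrite lee_fin sqr_ge0.
    rewrite (_ : (fun N => (P N x)%:E) = (fun N => \sum_(0 <= i < N) (normc (c i x) ^+ 2)%:E)%E).
      by apply: is_cvg_nneseries => i _ _; rewrite lee_fin sqr_ge0.
    by apply/funext => N; rewrite sumEFin big_mkord.
  by have /fine_cvgP[] := cv.
have ltP N M : (N <= M)%N -> P N x <= P M x.
  move=> NM; rewrite /P -!(big_mkord xpredT (fun i => normc (c i x) ^+ 2)).
  by rewrite (big_cat_nat _ NM)//= lerDl sumr_ge0// => i _; exact: sqr_ge0.
have exN k : exists N, ~~ b k N x.
  have q0 : t x - 2^-1 ^+ (3 * k) < t x by rewrite ltrBlDr ltrDl exprn_gt0// invr_gt0.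
  have [N _ HN] := cvgr_gt _ cvP _ q0; exists N; rewrite /b -leNgt.
  by have /= := HN N (leqnn N); lra.
pose Nk k := ex_minn (exN k).
have bE k i : b k i x = (i < Nk k)%N.
  rewrite /Nk; case: ex_minnP => N bN minN; apply/idP/idP => [bi|iN].
    rewrite ltnNge; apply/negP => Ni; move/negP: bN; apply.
    by apply: lt_le_trans bi _; rewrite lerB// ltP.
  by apply/negPn/negP => /minN; rewrite leqNgt iN.
pose A k := segment e (Nk k).
have FE k xi : clim (fun N => G k N) (x, xi) =
    \sum_(l <- A k) theta_coef a f l x * theta_exp l xi.
  apply: (@clim_eventually _ _ _ (Nk k)) => N NkN.
  have -> : G k N (x, xi) = \sum_(0 <= i < N) (mask k i x)%:C * c i x * theta_exp (e i) xi.
    by rewrite big_mkord.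
  rewrite (big_cat_nat _ NkN)//= [X in _ + X]big_nat_cond [X in _ + X]big1 ?addr0.
    rewrite sum_segment// -(big_mkord xpredT (fun i => c i x * theta_exp (e i) xi)).
    rewrite big_nat_cond [RHS]big_nat_cond; apply: eq_bigr => i /andP[/andP[_ iN] _].
    by rewrite /mask bE iN mul1r.
  move=> i /andP[/andP[iN _] _].
  by rewrite /mask bE ltnNge iN !mul0r.
(* Beyond the cut-off the truncated sums are constant, so the inner limit in
   [F] is the truncated partial sum of the Fourier series at [x]. *)
have slE : (fun xi => F (x, xi)) =
    clim (fun k xi => \sum_(l <- A k) theta_coef a f l x * theta_exp l xi).
  by apply/funext => xi; rewrite /F /clim; congr (fine (limn_esup _) +i* fine (limn_esup _));
    apply/funext => k; rewrite -FE.
have incA k : (A k `<=` A k.+1)%fset.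
  apply: segmentS; rewrite leqNgt -bE -leNgt.
  have : ~~ b k.+1 (Nk k.+1) x by rewrite bE ltnn.
  rewrite /b -leNgt => /le_trans; apply.
  have q1 : (2^-1 : R) <= 1 by rewrite invf_le1// ler1n.
  by rewrite mulnS exprD ler_piMl ?exprn_ge0 ?invr_ge0// exprn_ile1// invr_ge0.
have tailA k (B : {fset int}) : (A k `<=` B)%fset ->
    \sum_(l <- B) normc (theta_coef a f l x) ^+ 2 -
    \sum_(l <- A k) normc (theta_coef a f l x) ^+ 2 <= 2^-1 ^+ (3 * k).
  move=> _; rewrite /A sum_segment// -/(P (Nk k) x).
  have : ~~ b k (Nk k) x by rewrite bE ltnn.
  rewrite /b -leNgt; apply: le_trans; rewrite lerB//.
  by rewrite -lee_fin -tE -sumEFin; exact: fset_sum_le_esum.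
have [G2' Gc' _] := orthosum_clim (measurable_period n) (memL2_theta_exp n)
  (theta_exp_orthonormal n) (c := fun l => theta_coef a f l x) incA tailA.
have G2 : memL2 mu (period n) (fun xi => F (x, xi)) by rewrite slE; exact: G2'.
have Gc l : cinner mu (period n) (fun xi => F (x, xi)) (theta_exp l) = theta_coef a f l x.
  by rewrite slE; exact: Gc'.
have := parseval_L2sum_to (measurable_period n) (memL2_theta_exp n) (theta_exp_orthonormal n)
  G2 (theta_exp_parseval G2).
have -> : (fun l (xi : R) => (a `^ (l%:~R / 2))%:C * f (a ^ l * x) * cis (- (2 * pi * l%:~R * xi))) =
  (fun l xi => cinner mu (period n) (fun xi => F (x, xi)) (theta_exp l) * theta_exp l xi).
  by apply/funext => l; apply/funext => xi; rewrite Gc.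
exact.
Qed.

End theta_exists.

(** * Exponentials on the fundamental domain *)

Section symbol_basis.
Context {R : realType}.
Variable a : R.
Hypothesis a1 : 1 < a.
Local Notation T1 := (measurableTypeR R).
Local Notation T2 := (measurableTypeR R * measurableTypeR R)%type.
Local Notation mu := (@lebesgue_measure R).
Local Notation mu2 := (@lebesgue_measure2 R).
Local Notation U := (@period R 0).
Local Notation base := (`[1, a[%classic : set T1).
Local Notation dom := (Theta_dom a : set T2).
Implicit Types (F G : R * R -> R[i]) (m j l : int).

Let mU : measurable U := measurable_period 0.
Let p0 : 0 < a - 1. Proof. by rewrite subr_gt0. Qed.
Let baseE : base = (`[1, 1 + (a - 1)[%classic : set T1).
Proof. by rewrite (_ : 1 + (a - 1) = a)//; ring. Qed.

Lemma memL2_MD_symbol mj : memL2 mu2 dom (MD_symbol a mj).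
Proof.
apply: (memL2_bounded_finite (M := (a - 1)^-1)).
- exact: measurable_Theta_dom.
- exact: mu2_dom.
- exact: cmeasurable_MD_symbol.
- by apply: nearW => z _; rewrite normc2_MD_symbol.
Qed.

Let coef l G x := cinner mu U (fun xi => G (x, xi)) (theta_exp l).

Lemma memL2_slice_coef l G : memL2 mu2 dom G -> memL2 mu base (coef l G).
Proof.
move=> G2; have mc := cmeasurable_slice_coef a1 l G2; split; first exact: mc.
apply: le_lt_trans G2.2; rewrite (L2normsq_rectangle G2.1).
apply: ae_ge0_le_integral.
- exact: measurable_base.
- by move=> x _; rewrite lee_fin sqr_ge0.
- exact: emeasurable_normc2.
- by move=> x _; exact: L2normsq_ge0.
- exact: measurable_L2normsq_slices G2.1.
- apply: filterS (ae_memL2_slices G2) => x + bx => /(_ bx).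
  exact: (normc_coef_le mU (memL2_theta_exp 0) (theta_exp_orthonormal 0)).
Qed.

(** Fubini: a double Fourier coefficient is an iterated one. *)
Lemma cinner_MD_symbol mj G : memL2 mu2 dom G ->
  cinner mu2 dom G (MD_symbol a mj) = cinner mu base (coef (- mj.2) G) (fourier (a - 1) mj.1).
Proof.
move=> G2; have := memL2_mulJ (measurable_Theta_dom a) G2 (memL2_MD_symbol mj).
rewrite /cinner Theta_domE => /(cintegral_rectangle (measurable_base a) mU)[mI ->].
apply: ae_eq_cintegral.
- exact: measurable_base.
- exact: mI.
- apply: cmeasurableM; first exact: (memL2_slice_coef _ G2).1.
  by apply: cmeasurableJ; exact: cmeasurable_fourier.
- apply: filterS (ae_memL2_slices G2) => x + bx => /(_ bx) Gx.
  have iGx := memL2_mulJ mU Gx (memL2_theta_exp 0 (- mj.2)).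
  rewrite [RHS]mulrC -(cintegralZ mU _ iGx).
  by apply: eq_cintegral => xi _; rewrite /MD_symbol conjcM/= mulrCA.
Qed.

Lemma MD_symbol_orthonormal mj mk :
  cinner mu2 dom (MD_symbol a mj) (MD_symbol a mk) = (mj == mk)%:R.
Proof.
rewrite cinner_MD_symbol; last exact: memL2_MD_symbol.
have -> : coef (- mk.2) (MD_symbol a mj) = fun x => (mj.2 == mk.2)%:R * fourier (a - 1) mj.1 x.
  apply/funext => x; rewrite /coef /MD_symbol/= cinnerZl//; try exact: memL2_theta_exp.
  by rewrite (theta_exp_orthonormal 0) eqr_opp mulrC.
rewrite baseE cinnerZl//; try exact: (memL2_fourier 1 p0).
by rewrite (fourier_orthonormal 1 p0) -natrM mulnb andbC -xpair_eqE -!surjective_pairing.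
Qed.

(** Parseval in [xi] on almost every slice, followed by Parseval in [x] for
every coefficient of the slices. *)
Lemma MD_symbol_parseval G : memL2 mu2 dom G ->
  (\esum_(mj in [set: int * int]) (normc (cinner mu2 dom G (MD_symbol a mj)) ^+ 2)%:E =
   L2normsq mu2 dom G)%E.
Proof.
move=> G2; rewrite (L2normsq_rectangle G2.1).
have -> : (\int[mu]_(x in base) L2normsq mu U (fun xi => G (x, xi)) =
    \int[mu]_(x in base) \esum_(l in [set: int]) (normc (coef l G x) ^+ 2)%:E)%E.
  apply: ae_eq_integral.
  - exact: measurable_base.
  - exact: measurable_L2normsq_slices G2.1.
  - apply: measurable_fun_esum.
      by move=> l; apply: emeasurable_normc2; exact: (memL2_slice_coef _ G2).1.
    by move=> l x _; rewrite lee_fin sqr_ge0.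
  - apply: filterS (ae_memL2_slices G2) => x + bx => /(_ bx) Gx.
    by rewrite -theta_exp_parseval.
rewrite integral_esum; first last.
- by move=> l x _; rewrite lee_fin sqr_ge0.
- by move=> l; apply: emeasurable_normc2; exact: (memL2_slice_coef _ G2).1.
- exact: measurable_base.
have cE l : (\int[mu]_(x in base) (normc (coef l G x) ^+ 2)%:E =
    \esum_(m in [set: int]) (normc (cinner mu base (coef l G) (fourier (a - 1) m)) ^+ 2)%:E)%E.
  have c2 := memL2_slice_coef l G2; rewrite baseE in c2 *.
  by rewrite (fourier_parseval p0 c2).
under [RHS]eq_esum do rewrite cE.
rewrite esum_esum; last by move=> l m _ _; rewrite lee_fin sqr_ge0.
rewrite [RHS](reindex_esum [set: int * int] _ (fun mj => (- mj.2, mj.1))); last first.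
  split => //; first by move=> [m j] [k l] _ _ /= [/oppr_inj -> ->].
  by move=> [l m] _; exists (m, - l) => //=; rewrite opprK.
by apply: eq_esum => mj _; rewrite cinner_MD_symbol.
Qed.

End symbol_basis.

(** * Frame bounds as pointwise bounds *)

Section frame_symbols.
Context {R : realType}.
Variable a : R.
Hypothesis a1 : 1 < a.
Local Notation T1 := (measurableTypeR R).
Local Notation T2 := (measurableTypeR R * measurableTypeR R)%type.
Local Notation mu := (@lebesgue_measure R).
Local Notation mu2 := (@lebesgue_measure2 R).
Local Notation dom := (Theta_dom a : set T2).
Context {L : nat}.
Implicit Types (f g : R -> R[i]) (F G : R * R -> R[i]) (i : 'I_L).

Let mdom : measurable dom. Proof. exact: measurable_Theta_dom. Qed.

Definition transforms (psi : 'I_L -> R -> R[i]) (Psi : 'I_L -> R * R -> R[i]) : Prop :=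
  forall l, L2Rplus (psi l) /\ Theta_slices a (psi l) (Psi l).

Definition power (Psi : 'I_L -> R * R -> R[i]) (z : R * R) : R :=
  \sum_(l < L) normc (Psi l z) ^+ 2.

Lemma power_ge0 Psi z : 0 <= power Psi z.
Proof. by apply: sumr_ge0 => l _; exact: sqr_ge0. Qed.

Lemma normc2_le_power Psi l z : normc (Psi l z) ^+ 2 <= power Psi z.
Proof. by rewrite /power (bigD1 l)//= lerDl sumr_ge0// => k _; exact: sqr_ge0. Qed.

Lemma measurable_power Psi : (forall l, cmeasurable dom (Psi l)) ->
  measurable_fun dom (power Psi).
Proof. by move=> mPsi; apply: measurable_sum => l; exact: measurable_normc2. Qed.

Section system.
Variables (psi : 'I_L -> R -> R[i]) (Psi : 'I_L -> R * R -> R[i]).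
Hypothesis psiE : transforms psi Psi.

Let mPsi l : cmeasurable dom (Psi l). Proof. exact: (psiE l).2.1. Qed.

Lemma memL2_MD (i : 'I_L * (int * int)) : L2Rplus (MD a psi i).
Proof.
case: i => l mj; have [psi2 psiT] := psiE l.
apply: Theta_slices_memL2 (Theta_slices_MD a1 mj psiT) => //.
  apply: (memL2M_bounded mdom (M := (a - 1)^-1)) => //.
  - exact: cmeasurable_MD_symbol.
  - by apply: nearW => z _; rewrite normc2_MD_symbol.
  - exact: Theta_memL2 psi2 psiT.
exact: cmeasurable_MD psi2.1.
Qed.

Lemma inner_MD f F l mj : L2Rplus f -> Theta_slices a f F ->
  inner f (MD a psi (l, mj)) = cinner mu2 dom (fun z => (Psi l z)^* * F z) (MD_symbol a mj).
Proof.
move=> f2 fF; have [psi2 psiT] := psiE l.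
rewrite (Theta_inner a1 f2 (memL2_MD _) fF (Theta_slices_MD a1 mj psiT)).
by apply: eq_cintegral => z _; rewrite conjcM [_^* * F z]mulrC -mulrA [_^* * _^*]mulrC.
Qed.

Lemma MD_energy f F l : L2Rplus f -> Theta_slices a f F ->
  memL2 mu2 dom (fun z => (Psi l z)^* * F z) ->
  (\esum_(mj in [set: int * int]) (normc (inner f (MD a psi (l, mj))) ^+ 2)%:E =
   L2normsq mu2 dom (fun z => (Psi l z)^* * F z)%R)%E.
Proof.
move=> f2 fF H2; rewrite -(MD_symbol_parseval a1 H2).
by apply: eq_esum => mj _; rewrite (inner_MD _ _ f2 fF).
Qed.

Lemma MD_energy_power f F : L2Rplus f -> Theta_slices a f F ->
  (forall l, memL2 mu2 dom (fun z => (Psi l z)^* * F z)) ->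
  (\sum_(l < L) \esum_(mj in [set: int * int]) (normc (inner f (MD a psi (l, mj))) ^+ 2)%:E =
   \int[mu2]_(z in dom) (power Psi z * normc (F z) ^+ 2)%:E)%E.
Proof.
move=> f2 fF H2; under eq_bigr do rewrite (MD_energy f2 fF (H2 _)).
rewrite /L2normsq -ge0_integral_sum//; first last.
- by move=> l z _; rewrite lee_fin sqr_ge0.
- by move=> l; exact: emeasurable_normc2 (H2 l).1.
apply: eq_integral => z _; rewrite sumEFin /power mulr_suml; congr EFin.
by apply: eq_bigr => l _; rewrite normcM2 normc_conj.
Qed.

Lemma le_power_energy F c : cmeasurable dom F -> 0 <= c ->
  {ae mu2, forall z, dom z -> c * normc (F z) ^+ 2 <= power Psi z * normc (F z) ^+ 2} ->
  (c%:E * L2normsq mu2 dom F <= \int[mu2]_(z in dom) (power Psi z * normc (F z) ^+ 2)%:E)%E.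
Proof.
move=> mF c0 cF; rewrite /L2normsq -ge0_integralZl//; first last.
- by move=> z _; rewrite lee_fin sqr_ge0.
- exact: emeasurable_normc2.
apply: ae_ge0_le_integral => //.
- by move=> z _; rewrite -EFinM lee_fin mulr_ge0 ?sqr_ge0.
- by apply: emeasurable_funM => //; exact: emeasurable_normc2.
- by move=> z _; rewrite lee_fin mulr_ge0 ?sqr_ge0 ?power_ge0.
- apply/measurable_EFinP; apply: measurable_funM; last exact: measurable_normc2.
  exact: measurable_power.
Qed.

Lemma power_energy_le F c : cmeasurable dom F -> 0 <= c ->
  {ae mu2, forall z, dom z -> power Psi z * normc (F z) ^+ 2 <= c * normc (F z) ^+ 2} ->
  (\int[mu2]_(z in dom) (power Psi z * normc (F z) ^+ 2)%:E <= c%:E * L2normsq mu2 dom F)%E.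
Proof.
move=> mF c0 cF; rewrite /L2normsq -ge0_integralZl//; first last.
- by move=> z _; rewrite lee_fin sqr_ge0.
- exact: emeasurable_normc2.
apply: ae_ge0_le_integral => //.
- by move=> z _; rewrite lee_fin mulr_ge0 ?sqr_ge0 ?power_ge0.
- apply/measurable_EFinP; apply: measurable_funM; last exact: measurable_normc2.
  exact: measurable_power.
- by move=> z _; rewrite -EFinM lee_fin mulr_ge0 ?sqr_ge0.
- by apply: emeasurable_funM => //; exact: emeasurable_normc2.
Qed.

Lemma memL2_mul_transform (K : R) F l : {ae mu2, forall z, dom z -> power Psi z <= K} ->
  memL2 mu2 dom F -> memL2 mu2 dom (fun z => (Psi l z)^* * F z).
Proof.
move=> PK F2; apply: (memL2M_bounded mdom (M := K)) => //; first exact: cmeasurableJ.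
apply: filterS PK => z + Dz => /(_ Dz); apply: le_trans.
by rewrite normc_conj normc2_le_power.
Qed.

(** A set [P] is negligible as soon as the hypotheses force every transform
supported in [P] to vanish: the indicator of [P] is such a transform. *)
Lemma ae_not_of_frame (P : pred T2) (n : R) :
  (forall f F, L2Rplus f -> Theta_slices a f F ->
    (forall l, memL2 mu2 dom (fun z => (Psi l z)^* * F z)) ->
    (forall z, ~~ P z -> F z = 0) -> L2normsq mu2 dom F = 0%E) ->
  measurable_fun dom P -> (forall z, P z -> power Psi z <= n) ->
  {ae mu2, forall z, dom z -> ~~ P z}.
Proof.
move=> H mP Pn; pose F (z : T2) : R[i] := (if P z then 1 else 0)%:C.
have mF : cmeasurable dom F.
  by apply: cmeasurable_real; apply: measurable_fun_if => //; exact: measurable_cst.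
have F2 : memL2 mu2 dom F.
  apply: (memL2_bounded_finite (M := 1) mdom (mu2_dom a1) mF); apply: nearW => z _.
  by rewrite /F; case: ifP => _; rewrite normc_real// ?expr1n// expr0n.
have [f f2 fF] := Theta_slices_surjective a1 F2.
have PsiF2 l : memL2 mu2 dom (fun z => (Psi l z)^* * F z).
  apply: (memL2_bounded_finite (M := `|n|) mdom (mu2_dom a1)).
    by apply: cmeasurableM => //; exact: cmeasurableJ.
  apply: nearW => z _; rewrite /F normcM2 normc_conj; case: ifPn => Pz.
    rewrite normc_real// expr1n mulr1 (le_trans (normc2_le_power _ _ _))//.
    by rewrite (le_trans (Pn _ Pz)) ?ler_norm.
  by rewrite normc_real// expr0n mulr0.
have F0 : L2normsq mu2 dom F = 0%E.
  by apply: (H f) => // z /negbTE Pz; rewrite /F Pz.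
apply: filterS (L2normsq0 mdom mF F0) => z + Dz => /(_ Dz) Fz.
by apply/negP => Pz; move: Fz; rewrite /F Pz => /eqP; rewrite oner_eq0.
Qed.

(** The sets where the power violates the bounds by at least [1/(n+1)] are
negligible, because functions with a transform supported there violate the frame
inequality. The truncation [power Psi z <= n+1] keeps the products
[conj (Psi l) F] square integrable. *)
Lemma power_bounds_of_frame : is_MD_frame a psi ->
  exists C1 C2 : R, 0 < C1 /\ {ae mu2, forall z, dom z -> C1 <= power Psi z <= C2}.
Proof.
move=> [C1 [C2 [C10 C12 H]]]; exists C1, C2; split=> //.
have C20 : 0 <= C2 by rewrite (le_trans (ltW C10)).
have HE f F : L2Rplus f -> Theta_slices a f F ->
    (forall l, memL2 mu2 dom (fun z => (Psi l z)^* * F z)) ->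
    (C1%:E * L2normsq mu2 dom F <= \int[mu2]_(z in dom) (power Psi z * normc (F z) ^+ 2)%:E)%E /\
    (\int[mu2]_(z in dom) (power Psi z * normc (F z) ^+ 2)%:E <= C2%:E * L2normsq mu2 dom F)%E.
  move=> f2 fF H2; have := H f f2; rewrite /= (MD_energy_power f2 fF H2).
  by rewrite (Theta_isometry a1 f2.1 fF).
have N0 (c d : R) f F : c < d -> L2Rplus f -> Theta_slices a f F ->
    (d%:E * L2normsq mu2 dom F <= c%:E * L2normsq mu2 dom F)%E -> L2normsq mu2 dom F = 0%E.
  move=> cd f2 fF; have F2 := Theta_memL2 a1 f2 fF.
  have := L2normsq_ge0 mu2 dom F; rewrite -(fineK (memL2_fin F2)) -!EFinM !lee_fin.
  set n := fine _ => n0 dc; congr EFin; apply/eqP; rewrite eq_le n0 andbT leNgt.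
  by apply/negP => np; move: dc; rewrite ler_pM2r// leNgt cd.
have mpow := measurable_power mPsi.
have low n : {ae mu2, forall z, dom z -> ~~ (power Psi z <= C1 - n.+1%:R^-1)}.
  apply: (ae_not_of_frame (n := C1 - n.+1%:R^-1)) => //.
    move=> f F f2 fF H2 F0; have [C1F _] := HE f F f2 fF H2.
    (* The maximum keeps the constant nonnegative; it is still below [C1]. *)
    pose c := Num.max 0 (C1 - n.+1%:R^-1).
    apply: (N0 c C1 f F) => //; first by rewrite gt_max C10/= ltrBlDr ltrDl invr_gt0.
    apply: le_trans C1F _; apply: power_energy_le; first exact: fF.1.
      by rewrite le_max lexx.
    apply: nearW => z _; have [Pz|/F0 ->] := boolP (power Psi z <= C1 - n.+1%:R^-1).
      by rewrite ler_wpM2r ?sqr_ge0// le_max Pz orbT.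
    by rewrite ComplexField.Normc.normc0 expr0n !mulr0.
  by apply: measurable_fun_ler => //; exact: measurable_cst.
have high n : {ae mu2, forall z, dom z ->
    ~~ ((C2 + n.+1%:R^-1 <= power Psi z) && (power Psi z <= n.+1%:R))}.
  apply: (ae_not_of_frame (n := n.+1%:R)) => //.
  - move=> f F f2 fF H2 F0; have [_ C2F] := HE f F f2 fF H2.
    apply: (N0 C2 (C2 + n.+1%:R^-1) f F) => //; first by rewrite ltrDl invr_gt0.
    apply: le_trans C2F; apply: le_power_energy => //; first exact: fF.1.
      by rewrite addr_ge0.
    apply: nearW => z _; have [/andP[Pz _]|/F0 ->] :=
      boolP (C2 + n.+1%:R^-1 <= power Psi z <= n.+1%:R).
      by rewrite ler_wpM2r ?sqr_ge0.
    by rewrite ComplexField.Normc.normc0 expr0n !mulr0.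
  - by apply: measurable_and; apply: measurable_fun_ler => //; exact: measurable_cst.
  - by move=> z /andP[].
apply: filterS2 (ae_foralln low) (ae_foralln high) => z lowz highz Dz.
apply/andP; split; rewrite leNgt; apply/negP => pz.
  have [k kP] := ltr_add_invr pz; have := lowz k Dz.
  by rewrite lerBrDr (ltW kP).
have [k kP] := ltr_add_invr pz; have /archi_boundP := power_ge0 Psi z.
set m := Num.bound _ => mP; have := highz (k + m)%N Dz.
have -> : power Psi z <= (k + m).+1%:R.
  by rewrite (le_trans (ltW mP))// ler_nat leqW// leq_addl.
rewrite andbT (le_trans _ (ltW kP))// lerD2l lef_pV2 ?posrE//.
by rewrite ler_nat ltnS leq_addr.
Qed.

Lemma frame_of_power_bounds (C1 C2 : R) : 0 < C1 ->
  {ae mu2, forall z, dom z -> C1 <= power Psi z <= C2} -> is_MD_frame a psi.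
Proof.
move=> C10 PC; exists C1, (Num.max C1 C2); split=> //; first by rewrite le_max lexx.
have PC2 : {ae mu2, forall z, dom z -> power Psi z <= C2}.
  by apply: filterS PC => z + Dz => /(_ Dz) /andP[].
move=> f f2; have [F fT] := is_Theta_exists a1 f2.
have fF := is_Theta_slices a1 fT; have F2 := Theta_memL2 a1 f2 fF.
have H2 l := memL2_mul_transform l PC2 F2.
rewrite /= (MD_energy_power f2 fF H2) -(Theta_isometry a1 f2.1 fF); split.
  apply: le_power_energy; [exact: F2.1|exact: ltW|].
  by apply: filterS PC => z + Dz => /(_ Dz) /andP[Cz _]; rewrite ler_wpM2r ?sqr_ge0.
apply: power_energy_le; [exact: F2.1|by rewrite le_max (ltW C10)|].
by apply: filterS PC2 => z + Dz => /(_ Dz) Cz; rewrite ler_wpM2r ?sqr_ge0// le_max Cz orbT.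
Qed.

End system.
End frame_symbols.

(** * Mixed frame operators as multiplications *)

Section mixed_operator.
Context {R : realType}.
Variable a : R.
Hypothesis a1 : 1 < a.
Local Notation T1 := (measurableTypeR R).
Local Notation T2 := (measurableTypeR R * measurableTypeR R)%type.
Local Notation mu := (@lebesgue_measure R).
Local Notation mu2 := (@lebesgue_measure2 R).
Local Notation dom := (Theta_dom a : set T2).
Context {L : nat}.
Implicit Types (f g : R -> R[i]) (F G : R * R -> R[i]).

Let mdom : measurable dom. Proof. exact: measurable_Theta_dom. Qed.

Lemma normc2_sum_mul_le (Psi D : 'I_L -> R * R -> R[i]) z :
  normc (\sum_(l < L) Psi l z * D l z) ^+ 2 <=
  2 ^+ size (index_enum 'I_L) * (power Psi z * power D z).
Proof.
apply: le_trans (normc_sum2_le _ _) _; rewrite ler_pM2l ?exprn_gt0// /power mulr_sumr.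
apply: ler_sum => l _; rewrite normcM2 ler_wpM2r ?sqr_ge0//.
exact: normc2_le_power.
Qed.

Variables (psi phi : 'I_L -> R -> R[i]) (Psi Phi : 'I_L -> R * R -> R[i]).
Hypothesis psiE : transforms a psi Psi.
Hypothesis phiE : transforms a phi Phi.
Variable K : R.
Hypothesis PsiK : {ae mu2, forall z, dom z -> power Psi z <= K}.
Hypothesis PhiK : {ae mu2, forall z, dom z -> power Phi z <= K}.

Let mPsi l : cmeasurable dom (Psi l). Proof. exact: (psiE l).2.1. Qed.

Definition mixed_symbol (z : R * R) : R[i] := \sum_(l < L) Psi l z * (Phi l z)^*.

Lemma L2normsq_sum_mul_le (D : 'I_L -> R * R -> R[i]) :
  (forall l, memL2 mu2 dom (D l)) ->
  (L2normsq mu2 dom (fun z => (\sum_(l < L) Psi l z * D l z)%R) <=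
   (2 ^+ size (index_enum 'I_L) * `|K|)%:E * \sum_(l < L) L2normsq mu2 dom (D l))%E.
Proof.
move=> D2; have mD l : cmeasurable dom (D l) := (D2 l).1.
rewrite /L2normsq -ge0_integral_sum//; first last.
- by move=> l z _; rewrite lee_fin sqr_ge0.
- by move=> l; exact: emeasurable_normc2.
have mS : measurable_fun dom (fun z => \sum_(l < L) (normc (D l z) ^+ 2)%:E)%E.
  by apply: emeasurable_sum => l; exact: emeasurable_normc2.
have c0 : 0 <= 2 ^+ size (index_enum 'I_L) * `|K| by rewrite mulr_ge0// exprn_ge0.
rewrite -ge0_integralZl//; last first.
  by move=> z _; apply: sume_ge0 => l _; rewrite lee_fin sqr_ge0.
apply: ae_ge0_le_integral => //.
- by move=> z _; rewrite lee_fin sqr_ge0.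
- by apply: emeasurable_normc2; apply: cmeasurable_sum => l; exact: cmeasurableM.
- by move=> z _; rewrite mule_ge0 ?lee_fin// sume_ge0// => l _; rewrite lee_fin sqr_ge0.
- exact: emeasurable_funM.
- apply: filterS PsiK => z + Dz => /(_ Dz) PK.
  rewrite sumEFin -EFinM lee_fin (le_trans (normc2_sum_mul_le _ _ _))// -[leRHS]mulrA.
  rewrite ler_pM2l ?exprn_gt0// ler_wpM2r//; first by apply: sumr_ge0 => l _; exact: sqr_ge0.
  by rewrite (le_trans PK) ?ler_norm.
Qed.

(** A partial sum over a finite set of indices splits according to [l] into
products of [Psi l] with partial sums of the expansion of [conj (Phi l) F] in the
exponentials. As [Psi] is bounded, the error is controlled by the energies that
these partial sums miss. *)
Lemma mixed_L2sum_to f F g : L2Rplus f -> Theta_slices a f F ->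
  cmeasurable (Rplus : set T1) g -> Theta_slices a g (fun z => mixed_symbol z * F z) ->
  L2sum_to mu Rplus (fun i x => inner f (MD a phi i) * MD a psi i x) g.
Proof.
move=> f2 fF mg gG; have F2 := Theta_memL2 a1 f2 fF.
pose H l z := (Phi l z)^* * F z.
have H2 l : memL2 mu2 dom (H l) by exact: memL2_mul_transform phiE _ _ _ PhiK F2.
pose c (i : 'I_L * (int * int)) := inner f (MD a phi i).
pose t := \sum_(l < L) fine (L2normsq mu2 dom (H l)).
have tE : (t%:E = \sum_(l < L) L2normsq mu2 dom (H l))%E.
  by rewrite /t -sumEFin; apply: eq_bigr => l _; rewrite fineK// memL2_fin.
apply: (L2sum_to_dominated (c := fun i => normc (c i) ^+ 2) (t := t)
  (K := 2 ^+ size (index_enum 'I_L) * `|K|)).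
- by move=> i; exact: sqr_ge0.
- by rewrite mulr_ge0// exprn_ge0.
- rewrite tE; under [RHS]eq_bigr do rewrite -(MD_energy a1 phiE f2 fF (H2 _)).
  transitivity (\esum_(l in [set: 'I_L]) \esum_(mj in [set: int * int])
      (normc (c (l, mj)) ^+ 2)%:E)%E.
    rewrite (esum_esum (a := fun l mj => (normc (c (l, mj)) ^+ 2)%:E)); last first.
      by move=> l mj _ _; rewrite lee_fin sqr_ge0.
    have -> : [set: 'I_L] `*`` (fun=> [set: int * int]) = [set: 'I_L * (int * int)].
      by apply/seteqP; split=> // -[].
    by apply: eq_esum => i _; rewrite -surjective_pairing.
  rewrite esum_fset; last 2 first.
  - exact: finite_finset.
  - by move=> l _; apply: esum_ge0 => mj _; rewrite lee_fin sqr_ge0.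
  have -> : [set: 'I_L] = [set` index_enum 'I_L].
    by apply/seteqP; split=> // l _ /=; rewrite mem_index_enum.
  by rewrite -fsbig_seq ?index_enum_uniq.
move=> A.
(* The fibre of [A] over [l]; a sequence without repetitions is enough for
   the Bessel identity. *)
pose r l := [seq i.2 | i <- A & i.1 == l].
have ur l : uniq (r l).
  rewrite map_inj_in_uniq ?filter_uniq ?fset_uniq// => -[i1 x] [i2 y].
  by rewrite !mem_filter/= => /andP[/eqP -> _] /andP[/eqP -> _] ->.
have split_sum (V : nmodType) (h : 'I_L * (int * int) -> V) :
    \sum_(i <- A) h i = \sum_(l < L) \sum_(mj <- r l) h (l, mj).
  rewrite (partition_big (fun i => i.1) xpredT)//=; apply: eq_bigr => l _.
  rewrite big_map big_filter; apply: eq_bigr => -[i mj] /= /eqP <- //.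
pose S l z := \sum_(mj <- r l) c (l, mj) * MD_symbol a mj z.
have sumT : Theta_slices a (fun x => \sum_(i <- A) c i * MD a psi i x - g x)
    (fun z => \sum_(l < L) Psi l z * (S l z - H l z)).
  have E z : \sum_(l < L) Psi l z * (S l z - H l z) =
      \sum_(i <- A) c i * (MD_symbol a i.2 z * Psi i.1 z) - mixed_symbol z * F z.
    rewrite split_sum /mixed_symbol mulr_suml -sumrB; apply: eq_bigr => l _.
    rewrite mulrBr /S mulr_sumr /H mulrA; congr (_ - _); apply: eq_bigr => mj _.
    by rewrite mulrCA [Psi _ _ * _]mulrC.
  under [X in Theta_slices _ _ X]eq_fun do rewrite E.
  apply: Theta_slicesB => //; apply: Theta_slices_sum => -[l mj].
  by apply: Theta_slicesZ; apply: Theta_slices_MD => //; exact: (psiE l).2.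
have mv : cmeasurable (Rplus : set T1) (fun x => \sum_(i <- A) c i * MD a psi i x).
  apply: cmeasurable_sum => i; apply: cmeasurableM; first exact: cmeasurable_cst.
  exact: (memL2_MD a1 psiE i).1.
rewrite -(Theta_isometry a1 (cmeasurableB mv mg) sumT).
have SH2 l : memL2 mu2 dom (fun z => S l z - H l z).
  apply: memL2B => //; apply: memL2_sum => // mj; apply: memL2Z => //.
  exact: memL2_MD_symbol.
apply: le_trans (L2normsq_sum_mul_le SH2) _.
have {}SH2 l : (L2normsq mu2 dom (fun z => (S l z - H l z)%R) =
    (fine (L2normsq mu2 dom (H l)) - \sum_(mj <- r l) normc (c (l, mj)) ^+ 2)%:E)%E.
  rewrite (bessel_identity (c := fun mj => c (l, mj)) mdom (memL2_MD_symbol a1)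
    (MD_symbol_orthonormal a1) (H2 l) (ur l)).
    by rewrite EFinB fineK// memL2_fin.
  by move=> mj; exact: inner_MD.
under eq_bigr do rewrite SH2.
by rewrite sumEFin -EFinM sumrB (split_sum _ (fun i => normc (c i) ^+ 2)).
Qed.

Lemma cmeasurable_mixed_symbol : cmeasurable dom mixed_symbol.
Proof.
apply: cmeasurable_sum => l; apply: cmeasurableM => //; apply: cmeasurableJ.
exact: (phiE l).2.1.
Qed.

Lemma memL2_mixed F : memL2 mu2 dom F -> memL2 mu2 dom (fun z => mixed_symbol z * F z).
Proof.
apply: (memL2M_bounded mdom (M := 2 ^+ size (index_enum 'I_L) * (`|K| * `|K|))).
  exact: cmeasurable_mixed_symbol.
apply: filterS2 PsiK PhiK => z + + Dz => /(_ Dz) PsiKz /(_ Dz) PhiKz.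
apply: le_trans (normc2_sum_mul_le _ (fun l z => (Phi l z)^*) _) _.
rewrite ler_pM2l ?exprn_gt0// ler_pM ?power_ge0//.
  by rewrite (le_trans PsiKz) ?ler_norm.
rewrite (le_trans _ (le_trans PhiKz (ler_norm _)))// /power.
by apply: ler_sum => l _; rewrite normc_conj.
Qed.

Lemma L2sum_to_mixedP f F g G : L2Rplus f -> Theta_slices a f F ->
  L2Rplus g -> Theta_slices a g G ->
  L2sum_to mu Rplus (fun i x => inner f (MD a phi i) * MD a psi i x) g <->
  ae_eq mu2 dom (fun z => mixed_symbol z * F z) G.
Proof.
move=> f2 fF g2 gG.
have [h h2 hT] := Theta_slices_surjective a1 (memL2_mixed (Theta_memL2 a1 f2 fF)).
have sum_h := mixed_L2sum_to f2 fF h2.1 hT.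
have mv i : cmeasurable (Rplus : set T1) (fun x => inner f (MD a phi i) * MD a psi i x).
  by apply: cmeasurableM; [exact: cmeasurable_cst|exact: (memL2_MD a1 psiE i).1].
rewrite (Theta_slices_unique a1 h2.1 g2.1 hT gG); split => [sum_g|hg].
  exact: (L2sum_to_unique measurable_Rplus mv h2.1 g2.1 sum_h sum_g).
exact: (L2sum_to_ae_eq measurable_Rplus mv h2.1 g2.1 hg sum_h).
Qed.

(** Multiplication by the mixed symbol is the identity on L^2 if and only if
it fixes the constant function 1. *)
Lemma reproducingP :
  (forall f, L2Rplus f ->
     L2sum_to mu Rplus (fun i x => inner f (MD a phi i) * MD a psi i x) f) <->
  ae_eq mu2 dom mixed_symbol (fun=> 1).
Proof.
split=> [H|mix1 f f2].
  have one2 : memL2 mu2 dom (fun=> 1).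
    apply: (memL2_bounded_finite (M := 1) mdom (mu2_dom a1)); first exact: cmeasurable_cst.
    by apply: nearW => z _; rewrite ComplexField.Normc.normc1 expr1n.
  have [f f2 fF] := Theta_slices_surjective a1 one2.
  have := (L2sum_to_mixedP f2 fF f2 fF).1 (H f f2).
  by apply: filterS => z + Dz => /(_ Dz); rewrite mulr1.
have [F /(is_Theta_slices a1) fF] := is_Theta_exists a1 f2.
apply/(L2sum_to_mixedP f2 fF f2 fF).
by apply: filterS mix1 => z + Dz => /(_ Dz) ->; rewrite mul1r.
Qed.

End mixed_operator.

(** * Canonical and general duals *)

Section duality.
Context {R : realType}.
Variable a : R.
Hypothesis a1 : 1 < a.
Local Notation T1 := (measurableTypeR R).
Local Notation T2 := (measurableTypeR R * measurableTypeR R)%type.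
Local Notation mu := (@lebesgue_measure R).
Local Notation mu2 := (@lebesgue_measure2 R).
Local Notation dom := (Theta_dom a : set T2).
Context {L : nat}.
Implicit Types (f g : R -> R[i]) (F G : R * R -> R[i]) (psi phi : 'I_L -> R -> R[i]).

Let mdom : measurable dom. Proof. exact: measurable_Theta_dom. Qed.

Lemma Theta_slices_Theta f : L2Rplus f -> Theta_slices a f (Theta a f).
Proof.
move=> f2; apply: (is_Theta_slices a1).
by have := xgetPex (fun=> 0) (is_Theta_exists a1 f2).
Qed.

Lemma transforms_Theta psi : (forall l, L2Rplus (psi l)) ->
  transforms a psi (fun l => Theta a (psi l)).
Proof. by move=> psi2 l; split=> //; exact: Theta_slices_Theta. Qed.

Lemma sum_normC2 (Psi : 'I_L -> R * R -> R[i]) z :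
  \sum_(k < L) `|Psi k z| ^+ 2 = (power Psi z)%:C.
Proof. by rewrite rmorph_sum/=; apply: eq_bigr => k _; rewrite normCE rmorphXn. Qed.

Lemma mixed_symbol_self (Psi : 'I_L -> R * R -> R[i]) z :
  mixed_symbol Psi Psi z = (power Psi z)%:C.
Proof. by rewrite rmorph_sum/=; apply: eq_bigr => k _; rewrite mulcJ. Qed.

Section frame.
Variables (psi : 'I_L -> R -> R[i]) (Psi : 'I_L -> R * R -> R[i]) (C1 C2 : R).
Hypothesis psiE : transforms a psi Psi.
Hypothesis C10 : 0 < C1.
Hypothesis PsiC : {ae mu2, forall z, dom z -> C1 <= power Psi z <= C2}.

Let mPsi l : cmeasurable dom (Psi l). Proof. exact: (psiE l).2.1. Qed.
Let PsiC2 : {ae mu2, forall z, dom z -> power Psi z <= C2}.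
Proof. by apply: filterS PsiC => z + Dz => /(_ Dz) /andP[]. Qed.

Lemma cmeasurable_inv_power : cmeasurable dom (fun z => ((power Psi z)%:C)^-1).
Proof.
under eq_fun do rewrite -(fmorphV (real_complex R)) /= -(powR_inv1 (power_ge0 _ _)).
apply: cmeasurable_real; apply: (@measurableT_comp _ _ _ _ _ _ (fun x : R => x `^ (-1))).
  exact: measurable_powR.
exact: measurable_power.
Qed.

Lemma normc2_div_power c z : C1 <= power Psi z ->
  normc (c / (power Psi z)%:C) ^+ 2 <= C1^-1 ^+ 2 * normc c ^+ 2.
Proof.
move=> Cz; rewrite -(fmorphV (real_complex R)) normcM2 mulrC ler_wpM2r ?sqr_ge0//.
have Pz : 0 < power Psi z by exact: lt_le_trans Cz.
rewrite normc_real ?invr_ge0 ?(ltW Pz)// lerXn2r ?nnegrE ?invr_ge0 ?(ltW Pz) ?(ltW C10)//.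
by rewrite lef_pV2.
Qed.

(** The frame operator is the mixed operator of [psi] with itself, whose
symbol is [power Psi]. *)
Lemma frame_op_transform f F : L2Rplus f -> Theta_slices a f F ->
  L2Rplus (frame_op a psi f) /\
  exists2 g, Theta_slices a g (fun z => (power Psi z)%:C * F z) &
    L2Rplus g /\ ae_eq mu Rplus (frame_op a psi f) g.
Proof.
move=> f2 fF; have F2 := Theta_memL2 a1 f2 fF.
have [g g2] := Theta_slices_surjective a1 (memL2_mixed psiE psiE PsiC2 PsiC2 F2).
have -> : (fun z => mixed_symbol Psi Psi z * F z) = (fun z => (power Psi z)%:C * F z).
  by apply/funext => z; rewrite mixed_symbol_self.
move=> gG.
have sum_g : L2sum_to mu Rplus (fun i x => inner f (MD a psi i) * MD a psi i x) g.
  apply/(L2sum_to_mixedP a1 psiE psiE PsiC2 PsiC2 f2 fF g2 gG).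
  by apply: nearW => z _; rewrite mixed_symbol_self.
have [fo2 fosum] := xgetPex (fun=> 0) (ex_intro
  (fun g => L2Rplus g /\ L2sum_to mu Rplus (fun i x => inner f (MD a psi i) * MD a psi i x) g)
  g (conj g2 sum_g)).
split=> //; exists g => //; split=> //.
apply: (L2sum_to_unique measurable_Rplus) fosum sum_g => //.
- move=> i; apply: cmeasurableM; first exact: cmeasurable_cst.
  exact: (memL2_MD a1 psiE i).1.
- exact: fo2.1.
- exact: g2.1.
Qed.

(** The frame operator is multiplication by [power Psi] on the transforms. A
function whose transform is the quotient is therefore a preimage of [psi l], and
every preimage has this transform. *)
Lemma canonical_dual_transform l :
  {ae mu2, forall z, dom z -> Theta a (frame_op_inv a psi (psi l)) z =
     Psi l z / (power Psi z)%:C}.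
Proof.
have [psi2 psiT] := psiE l.
have Pn0 : {ae mu2, forall z, dom z -> (power Psi z)%:C != 0}.
  apply: filterS PsiC => z + Dz => /(_ Dz) /andP[Cz _].
  by rewrite fmorph_eq0 gt_eqF// (lt_le_trans C10).
have F2 : memL2 mu2 dom (fun z => Psi l z / (power Psi z)%:C).
  have [mF N] := Theta_memL2 a1 psi2 psiT; split.
    by apply: cmeasurableM => //; exact: cmeasurable_inv_power.
  apply: (@le_lt_trans _ _ ((C1^-1 ^+ 2)%:E * L2normsq mu2 dom (Psi l))%E).
    apply: L2normsq_le_mul => //; first by apply: cmeasurableM => //; exact: cmeasurable_inv_power.
      exact: sqr_ge0.
    by apply: filterS PsiC => z + Dz => /(_ Dz) /andP[Cz _]; exact: normc2_div_power.
  by rewrite lte_mul_pinfty// lee_fin sqr_ge0.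
have [f f2 fF] := Theta_slices_surjective a1 F2.
have [_ [g gG [g2 fg]]] := frame_op_transform f2 fF.
have g_psi : ae_eq mu Rplus g (psi l).
  apply/(Theta_slices_unique a1 g2.1 psi2.1 gG psiT).
  by apply: filterS Pn0 => z + Dz => /(_ Dz) P0; rewrite mulrC divfK.
have f_inv : ae_eq mu Rplus (frame_op a psi f) (psi l) by exact: ae_eq_trans fg g_psi.
have [h2 hpsi] := xgetPex (fun=> 0) (ex_intro
  (fun f => L2Rplus f /\ frame_op a psi f = psi l %[ae mu in Rplus]) f (conj f2 f_inv)).
rewrite -/(frame_op_inv a psi (psi l)) in h2 hpsi.
have hT := Theta_slices_Theta h2.
have [_ [k kK [k2 hk]]] := frame_op_transform h2 hT.
have k_psi : ae_eq mu Rplus k (psi l) by apply: ae_eq_trans hpsi; exact: ae_eq_sym.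
have := (Theta_slices_unique a1 k2.1 psi2.1 kK psiT).2 k_psi.
apply: filterS2 Pn0 => z P0 + Dz => /(_ Dz) <-.
by rewrite mulrAC divff ?mul1r// P0.
Qed.

Section duals.
Variables (phi : 'I_L -> R -> R[i]) (Phi : 'I_L -> R * R -> R[i]).
Hypothesis phiE : transforms a phi Phi.

(** The reproducing formula is the pointwise identity. Given this identity,
[normc2_sum_mul_le] bounds [power Phi] from below by a multiple of the inverse of the
upper bound of [power Psi], so that [phi] generates a frame. *)
Lemma is_MD_dualP : is_MD_dual a psi phi <->
  (exists K : R, {ae mu2, forall z, dom z -> power Phi z <= K}) /\
  {ae mu2, forall z, dom z -> \sum_(l < L) (Psi l z)^* * Phi l z = 1}.
Proof.
have mixE z : mixed_symbol Psi Phi z = (\sum_(l < L) (Psi l z)^* * Phi l z)^*.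
  by rewrite conjc_sum; apply: eq_bigr => l _; rewrite conjcM conjCK.
have bound K K' : {ae mu2, forall z, dom z -> power Phi z <= K'} ->
    {ae mu2, forall z, dom z -> power Phi z <= Num.max K K'}.
  by apply: filterS => z + Dz => /(_ Dz) PK; rewrite le_max PK orbT.
have bound2 K' : {ae mu2, forall z, dom z -> power Psi z <= Num.max C2 K'}.
  by apply: filterS PsiC2 => z + Dz => /(_ Dz) PK; rewrite le_max PK.
split=> [[phi_frame dual]|[[K PhiK] sum1]].
  have [D1 [D2 [_ PhiD]]] := power_bounds_of_frame a1 phiE phi_frame.
  have PhiD2 : {ae mu2, forall z, dom z -> power Phi z <= D2}.
    by apply: filterS PhiD => z + Dz => /(_ Dz) /andP[].
  split; first by exists D2.
  have := (reproducingP a1 psiE phiE (bound2 D2) (bound C2 D2 PhiD2)).1 dual.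
  apply: filterS => z + Dz => /(_ Dz); rewrite mixE => /(congr1 Num.conj).
  by rewrite conjCK conjC1.
have mix1 : ae_eq mu2 dom (mixed_symbol Psi Phi) (fun=> 1).
  by apply: filterS sum1 => z + Dz => /(_ Dz) s1; rewrite mixE s1 conjC1.
split; last exact/(reproducingP a1 psiE phiE (bound2 K) (bound C2 K PhiK)).
(* The summand 1 makes the constant positive whatever [C2] is. *)
pose c : R := 2 ^+ size (index_enum 'I_L) * `|C2| + 1.
have c0 : 0 < c by rewrite ltr_wpDl// mulr_ge0// exprn_ge0.
apply: (frame_of_power_bounds a1 phiE (C1 := c^-1) (C2 := K)); first by rewrite invr_gt0.
apply: filterS (filterI sum1 (filterI PsiC2 PhiK)) => z [s1 [PsiCz PhiKz]] Dz.
rewrite (PhiKz Dz) andbT -[leLHS]mul1r ler_pdivrMr//.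
have := normc2_sum_mul_le (fun l z => (Psi l z)^*) Phi z.
rewrite (s1 Dz) ComplexField.Normc.normc1 expr1n => /le_trans; apply.
have -> : power (fun l z => (Psi l z)^*) z = power Psi z.
  by apply: eq_bigr => l _; rewrite normc_conj.
rewrite mulrA [leRHS]mulrC ler_wpM2r ?power_ge0// /c ler_wpDr//.
rewrite ler_pM2l ?exprn_gt0//.
by rewrite (le_trans (PsiCz Dz)) ?ler_norm.
Qed.

End duals.

End frame.

Lemma power_memLinfty (X : 'I_L -> R * R -> R[i]) :
  (forall l, memLinfty mu2 dom (X l)) <->
  (forall l, cmeasurable dom (X l)) /\
  exists K : R, {ae mu2, forall z, dom z -> power X z <= K}.
Proof.
split=> [X_bd|[mX [K XK]] l].
  split; first by move=> l; exact: (X_bd l).1.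
  have [M MP] : exists M : 'I_L -> R, forall l,
      {ae mu2, forall z, dom z -> normc (X l z) <= M l}.
    have H l : {M : R | {ae mu2, forall z, dom z -> normc (X l z) <= M}}.
      by apply: cid; exact: (X_bd l).2.
    by exists (fun l => sval (H l)) => l; exact: svalP (H l).
  exists (\sum_(l < L) `|M l| ^+ 2).
  have : {ae mu2, forall z, forall l, dom z -> normc (X l z) <= M l}.
    exact: filter_forall.
  apply: filterS => z XM Dz; apply: ler_sum => l _.
  rewrite lerXn2r ?nnegrE ?normc_ge0//.
  by rewrite (le_trans (XM l Dz)) ?ler_norm.
split; first exact: mX.
exists (Num.sqrt K); apply: filterS XK => z + Dz => /(_ Dz) XKz.
rewrite -[leLHS]ger0_norm ?normc_ge0// -sqrtr_sqr ler_wsqrtr//.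
by rewrite (le_trans (normc2_le_power _ _ _)).
Qed.

Section dual_formula.
Variables (psi : 'I_L -> R -> R[i]) (C1 C2 : R).
Hypothesis psi2 : forall l, L2Rplus (psi l).
Let Psi l := Theta a (psi l).
Hypothesis C10 : 0 < C1.
Hypothesis PsiC : {ae mu2, forall z, dom z -> C1 <= power Psi z <= C2}.

Let psiE : transforms a psi Psi. Proof. exact: transforms_Theta. Qed.

(** For a dual frame, [X l = Theta a (phi l)] makes the factor in parentheses
vanish. Conversely, [sum_l conj (Psi l) Phi l = (1 - s) + s = 1] with
[s = sum_k conj (Psi k) X k]. *)
Lemma dual_formulaP phi : (forall l, L2Rplus (phi l)) ->
  is_MD_dual a psi phi <->
  exists X : 'I_L -> R * R -> R[i],
    (forall l, memLinfty mu2 dom (X l)) /\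
    forall l, {ae mu2, forall z, dom z ->
      Theta a (phi l) z =
      Psi l z * (1 - \sum_(k < L) (Psi k z)^* * X k z) /
        (\sum_(k < L) `|Psi k z| ^+ 2) + X l z}.
Proof.
move=> phi2; have phiE := transforms_Theta phi2.
rewrite (is_MD_dualP psiE PsiC phiE).
split=> [[[K PhiK] sum1]|[X [X_bd PhiX]]].
  exists (fun l => Theta a (phi l)); split.
    by apply/power_memLinfty; split; [move=> l; exact: (phiE l).2.1|exists K].
  by move=> l; apply: filterS sum1 => z + Dz => /(_ Dz) ->; rewrite subrr mulr0 mul0r add0r.
have {}PhiX : {ae mu2, forall z, forall l, dom z ->
      Theta a (phi l) z =
      Psi l z * (1 - \sum_(k < L) (Psi k z)^* * X k z) / (power Psi z)%:C + X l z}.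
  by apply: filter_forall => l; apply: filterS (PhiX l) => z; rewrite sum_normC2.
have [_ [M XM]] := (power_memLinfty X).1 X_bd.
split; last first.
  apply: filterS2 PsiC PhiX => z + PhiXz Dz => /(_ Dz) /andP[Cz _].
  have Pz : (power Psi z)%:C != 0 by rewrite fmorph_eq0 gt_eqF// (lt_le_trans C10).
  under eq_bigr do rewrite PhiXz// mulrDr.
  rewrite big_split/=; set s := \sum_(k < L) (Psi k z)^* * X k z.
  have -> : \sum_(l < L) (Psi l z)^* * (Psi l z * (1 - s) / (power Psi z)%:C) =
      \sum_(l < L) (Psi l z * (Psi l z)^*) * ((1 - s) / (power Psi z)%:C).
    by apply: eq_bigr => l _; ring.
  rewrite -mulr_suml -/(mixed_symbol Psi Psi z) mixed_symbol_self.
  by rewrite mulrCA divff// mulr1 subrK.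
pose n : R := 2 ^+ size (index_enum 'I_L).
pose B := 2 * (C1^-1 ^+ 2 * (`|C2| * (2 + 2 * (n * (`|C2| * `|M|))))) + 2 * `|M|.
exists (\sum_(l < L) B).
apply: filterS (filterI PsiC (filterI XM PhiX)) => z [PsiCz [XMz PhiXz]] Dz.
have /andP[Cz zC] := PsiCz Dz; apply: ler_sum => l _; rewrite (PhiXz _ Dz).
set s := \sum_(k < L) (Psi k z)^* * X k z.
have zC2 : power Psi z <= `|C2| by rewrite (le_trans zC) ?ler_norm.
have zM : power X z <= `|M| by rewrite (le_trans (XMz Dz)) ?ler_norm.
have s2 : normc s ^+ 2 <= n * (`|C2| * `|M|).
  apply: le_trans (normc2_sum_mul_le (fun l z => (Psi l z)^*) X z) _.
  rewrite ler_pM2l ?exprn_gt0// ler_pM ?power_ge0//.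
  by apply: le_trans zC2; apply: ler_sum => k _; rewrite normc_conj.
have s1 : normc (1 - s) ^+ 2 <= 2 + 2 * (n * (`|C2| * `|M|)).
  apply: le_trans (normcD2_le _ _) _; rewrite ComplexField.Normc.normc1 expr1n mulr1.
  by rewrite normc2N lerD2l ler_pM2l.
apply: le_trans (normcD2_le _ _) _; rewrite lerD// ler_pM2l//; last first.
  by rewrite (le_trans (normc2_le_power _ _ _)).
apply: le_trans (normc2_div_power C10 _ Cz) _; rewrite ler_wpM2l ?sqr_ge0//.
rewrite normcM2 ler_pM ?sqr_ge0//.
by rewrite (le_trans (normc2_le_power _ _ _)).
Qed.

End dual_formula.
End duality.

(* The statement is about [conjc], to which [Num.conj] unfolds on complex numbers. *)
Local Notation "x ^*" := (conjc x) : complex_scope.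

Theorem theorem3p2 (R : realType) (a : R) (L : nat) (psi : 'I_L -> R -> R[i])
    (a_gt1 : 1 < a)
    (psiL2 : forall l, L2Rplus (psi l))
    (psi_distinct : forall k l, k != l ->
      ~ (psi k = psi l %[ae lebesgue_measure in Rplus]))
    (psi_frame : is_MD_frame a psi) :
  (forall l : 'I_L,
     {ae lebesgue_measure2, forall z, Theta_dom a z ->
        Theta a (frame_op_inv a psi (psi l)) z =
        Theta a (psi l) z / \sum_(k < L) `|Theta a (psi k) z| ^+ 2}) /\
  (forall phi : 'I_L -> R -> R[i], (forall l, L2Rplus (phi l)) ->
     (is_MD_dual a psi phi <->
      exists X : 'I_L -> R * R -> R[i],
        (forall l, memLinfty lebesgue_measure2 (Theta_dom a) (X l)) /\
        (forall l : 'I_L,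
           {ae lebesgue_measure2, forall z, Theta_dom a z ->
              Theta a (phi l) z =
              Theta a (psi l) z *
                (1 - \sum_(k < L) (Theta a (psi k) z)^* * X k z) /
                (\sum_(k < L) `|Theta a (psi k) z| ^+ 2) + X l z}))).
Proof.
have psiE := transforms_Theta a_gt1 psiL2.
have [C1 [C2 [C10 PsiC]]] := power_bounds_of_frame a_gt1 psiE psi_frame.
split=> [l|phi phiL2].
  have := canonical_dual_transform a_gt1 psiE C10 PsiC l.
  by apply: filterS => z + Dz => /(_ Dz) ->; rewrite (sum_normC2 (fun l => Theta a (psi l))).
exact (dual_formulaP a_gt1 psiL2 C10 PsiC phiL2).
Qed.
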